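(* Let $\mathcal B$ be a unital $C^*$-algebra with norm $\|\cdot\|$, let $(\mathcal A, E:\mathcal A\to\mathcal B)$ be a $\mathcal B$-valued probability space, and let $S,T$ be index sets. For each $n\in\mathbb N$ let $\{a(i,j;s,n): s\in S,\ 1\le i,j\le n\}$ be a family of elements of $\mathcal A$ such that: (Y1) $a(i,j;s,n)=a(j,i;s,n)^*$ for all $1\le i,j\le n$, $s\in S$; (Y2) $E[a(i,j;s,n)]=0$ for all $1\le i,j\le n$, $s\in S$; (Y3) for each $s\in S$ there is a completely positive map $\eta_s:\mathcal B\to\mathcal B$ (independent of $i,j,n$) such that $E[a(i,j;s,n)\,b\,a(j,i;s,n)]=\frac1n\eta_s(b)$ for all $b\in\mathcal B$, $1\le i,j\le n$; (Y4) for each $m\in\mathbb N$ there is $M_m>0$ such that for all $n$ and all $b_1,\dots,b_{m-1}\in\mathcal B$, $$\sup_{\substack{s_1,\dots,s_m\in S\\ 1\le i_1,\dots,i_m,j_1,\dots,j_m\le n}}\big\|E[a(i_1,j_1;s_1,n)b_1a(i_2,j_2;s_2,n)b_2\cdots b_{m-1}a(i_m,j_m;s_m,n)]\big\|\le M_m n^{-m/2}\prod_{k=1}^{m-1}\|b_k\|;$$ (Y5) for each $n$, the family $\{a(i,j;s,n): s\in S,\ 1\le i\le j\le n\}$ is conditionally independent with respect to $E$. Put $Y(s,n)=\sum_{1\le i,j\le n}a(i,j;s,n)\otimes e(i,j;n)\in\mathcal A\otimes M_n(\mathbb C)$. In addition, for $t\in T$ and $n\in\mathbb N$ let $D(t,n)=\sum_{1\le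 i\le n}b(i;t,n)\otimes e(i,i;n)\in\mathcal B\otimes M_n(\mathbb C)$ with $b(i;t,n)\in\mathcal B$, such that: (D1) the joint distribution of $\{D(t,n)\}_{t\in T}$ (with respect to $E_n$) converges weakly in norm as $n\to\infty$; (D2) $\lim_{n\to\infty}\frac{\|D(t,n)\|^k}{n}=0$ for all $t\in T$, $k\in\mathbb N$; (D3) $\limsup_{n\to\infty}\frac1n\sum_{i=1}^n\|b(i;t,n)\|^k<\infty$ for all $t\in T$, $k\in\mathbb N$. Let $E_n:\mathcal A\otimes M_n(\mathbb C)\to\mathcal B$ be $E_n[(a_{i,j})_{i,j=1}^n]=\frac1n\sum_{i=1}^nE[a_{i,i}]$. Then there are a $\mathcal B$-valued probability space and families $\{Y_s\}_{s\in S}$, $\{D_t\}_{t\in T}$ in it such that the joint distribution of $\{Y(s,n)\}_{s\in S}\cup\{D(t,n)\}_{t\in T}$ with respect to $E_n$ converges weakly in norm, as $n\to\infty$, to the joint distribution of $\{Y_s\}_{s\in S}\cup\{D_t\}_{t\in T}$, and the family of subsets consisting of the singletons $\{Y_s\}$, $s\in S$, together with the set $\{D_t: t\in T\}$ is freely independent over $\mathcal B$. Moreover, for each $s\in S$, the distribution of $Y_s$ is a $\mathcal B$-valued semicircular law with variance $\eta_s$.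
   Context: $\mathcal B$-valued probability space $(\mathcal A,E)$: $\mathcal B$ is a unital $C^*$-algebra, $\mathcal A$ is a unital $*$-algebra which is also a $\mathcal B$-bimodule ($\mathcal B$ is regarded as a subalgebra of $\mathcal A$ via $b\mapsto b1_{\mathcal A}$), and $E:\mathcal A\to\mathcal B$ is a linear map with $E[b_1ab_2]=b_1E[a]b_2$, $E[b1_{\mathcal A}]=b$, and $E[aa^*]\ge0$ for all $a\in\mathcal A$, $b,b_1,b_2\in\mathcal B$. Elements of $\mathcal A$ are called ($\mathcal B$-valued) random variables. $e(i,j;n)$ are the matrix units of $M_n(\mathbb C)$. $\mathcal A\otimes M_n(\mathbb C)=M_n(\mathcal A)$ is a $\mathcal B$-bimodule by $b_1(a_{ij})b_2=(b_1a_{ij}b_2)$, and $(M_n(\mathcal A),E_n)$ is a $\mathcal B$-valued probability space; $\mathcal B\otimes M_n(\mathbb C)$ is viewed inside $\mathcal A\otimes M_n(\mathbb C)$ and $\|D(t,n)\|$ is the $C^*$-norm of $\mathcal B\otimes M_n(\mathbb C)$. $\mathcal B\langle X_i,X_i^*: i\in I\rangle$ is the $*$-algebra freely generated by $\mathcal B$ and noncommuting indeterminates $X_i,X_i^*$; its elements are called $\mathcal B$-polynomials. The joint distribution of a family $(x_i)_{i\in I}$ in $(\mathcal A,E)$ is the map $\mu:\mathcal B\langle X_i,X_i^*: i\in I\rangle\to\mathcal B$, $\mu(p)=E[p((x_i)_{i\in I})]$. A sequence of joint distributions $\mu_n$ converges weakly in norm if $(\mu_n(p))_n$ converges in norm in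 $\mathcal B$ for every $\mathcal B$-polynomial $p$; it converges weakly in norm to $\mu$ if $\mu_n(p)\to\mu(p)$ in norm for every $p$. Conditional independence: unital $*$-subalgebras $\mathcal A_i\supset\mathcal B$, $i\in I$, are conditionally independent with respect to $E$ if $E[a_1a_2a_3]=E[a_1E[a_2]a_3]$ whenever $a_1,a_3$ lie in the $*$-algebra generated by $\mathcal B$ and $\{\mathcal A_i: i\in I_1\}$, $a_2$ lies in the $*$-algebra generated by $\mathcal B$ and $\{\mathcal A_i: i\in I_2\}$, and $I_1\cap I_2=\emptyset$. Random variables $(x_i)$ are conditionally independent if the unital $*$-subalgebras generated by $\mathcal B$ and $x_i$ are. Free independence: unital $*$-subalgebras $\mathcal A_i\supset\mathcal B$ are freely independent over $\mathcal B$ if $E[a_1\cdots a_n]=0$ whenever $a_k\in\mathcal A_{i_k}$, $E[a_k]=0$ and $i_1\ne i_2\ne\cdots\ne i_n$; subsets are freely independent if the unital $*$-subalgebras generated by each subset and $\mathcal B$ are. Free cumulants: $NC(n)$ is the set of noncrossing partitions of $[n]=\{1,\dots,n\}$. For $n$-$\mathcal B$-linear maps $\rho^{(n)}$ ($n\ge1$) and $\pi\in NC(n)$, $\rho^{(\pi)}$ is defined recursively: $\rho^{(\{[n]\})}=\rho^{(n)}$, and otherwise $\rho^{(\pi)}(a_1,\dots,a_n)=\rho^{(\pi\setminus V)}(a_1,\dots,a_l\,\rho^{(r)}(a_{l+1},\dots,a_{l+r}),a_{l+r+1},\dots,a_n)$ for an interval block $V=\{l+1,\dots,l+r\}$ of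 $\pi$ (if $l=0$ the value multiplies $a_{r+1}$ from the left). The free cumulants $\kappa_E^{(n)}$ are defined recursively by $\kappa_E^{(n)}(a_1,\dots,a_n)=E[a_1\cdots a_n]-\sum_{\pi\in NC(n),\,\pi\ne\{[n]\}}\kappa_E^{(\pi)}(a_1,\dots,a_n)$. A selfadjoint $Y$ is $\mathcal B$-valued (centered) semicircular with variance $\eta$ if, for all $m\ge1$ and $b_1,\dots,b_{m+1}\in\mathcal B$, $\kappa_E^{(\pi)}(b_1Y,b_2Y,\dots,b_mYb_{m+1})=0$ for every $\pi\in NC(m)$ that is not a pair partition (all blocks of size 2), and $E[YbY]=\eta(b)$ for all $b\in\mathcal B$. *)

(* Defs.v *)
From HB Require Import structures.
From mathcomp Require Import all_boot all_order all_algebra.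
From mathcomp Require Import all_classical all_reals all_analysis.
From mathcomp Require Import complex zify.
Import Order.TTheory GRing.Theory Num.Theory.
Import numFieldNormedType.Exports.

Set Implicit Arguments.
Unset Strict Implicit.
Unset Printing Implicit Defensive.

Local Open Scope classical_set_scope.
Local Open Scope ring_scope.

HB.mixin Record Algebra_hasStar (R : realType) A of GRing.Algebra R[i] A := {
  star : A -> A;
  starK : involutive star;
  starD : forall x y, star (x + y) = star x + star y;
  starZ : forall (c : R[i]) x, star (c *: x) = Num.conj c *: star x;
  starM : forall x y, star (x * y) = star y * star x
}.

#[short(type="starAlgType")]
HB.structure Definition StarAlgebra (R : realType) :=
  {A of Algebra_hasStar R A & GRing.Algebra R[i] A}.

Lemma star0 (R : realType) (A : starAlgType R) : star (0 : A) = 0.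
Proof. by apply: (addrI (star (0 : A))); rewrite -starD !addr0. Qed.

Record is_cstar_norm (R : realType) (A : starAlgType R) (N : A -> R) : Prop := {
  cstar_norm_ge0 : forall x, 0 <= N x;
  cstar_norm_eq0 : forall x, N x = 0 -> x = 0;
  cstar_normD : forall x y, N (x + y) <= N x + N y;
  cstar_normZ : forall (c : R[i]) x, N (c *: x) = complex.Re `|c| * N x;
  cstar_normM : forall x y, N (x * y) <= N x * N y;
  cstar_identity : forall x, N (star x * x) = N x ^+ 2
}.

(* The norm is kept apart from MathComp-Analysis' normed modules: their
   hierarchy has no join with noncommutative rings, and their norm on a
   complex space takes its values in R[i]. *)
HB.mixin Record StarAlgebra_isCStar (R : realType) B of StarAlgebra R B := {
  cnorm : B -> R;
  cnorm_cstar : is_cstar_norm cnorm;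
  cnorm_complete : forall u : nat -> B,
    (forall e : R, 0 < e -> exists N, forall m n : nat,
       (N <= m)%N -> (N <= n)%N -> cnorm (u m - u n) < e) ->
    exists l : B, cnorm (u n - l) @[n --> \oo] --> (0 : R)
}.

#[short(type="cstarType")]
HB.structure Definition CStarAlgebra (R : realType) :=
  {B of StarAlgebra_isCStar R B & StarAlgebra R B}.

Definition norm_cvg_to (R : realType) (B : cstarType R) (u : nat -> B) (l : B) :=
  cnorm (u n - l) @[n --> \oo] --> (0 : R).

Definition norm_cvg (R : realType) (B : cstarType R) (u : nat -> B) :=
  exists l : B, norm_cvg_to u l.

Definition invertible (R : realType) (A : starAlgType R) (x : A) :=
  exists y : A, x * y = 1 /\ y * x = 1.

Definition spectrum (R : realType) (A : starAlgType R) (x : A) : set R[i] :=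
  [set z | ~ invertible (z%:A - x)].

(* In R[i], 0 <= z means that z is real and nonnegative. *)
Definition positive (R : realType) (A : starAlgType R) (x : A) :=
  star x = x /\ spectrum x `<=` [set z | 0 <= z].

(* The *-algebra M_{n+1}(A). An alias of 'M[A]_n.+1 is needed since the latter
   is already a module, but over A instead of R[i]. *)
Definition matalg (R : realType) (A : starAlgType R) (n : nat) : Type :=
  'M[A]_n.+1.

Section MatAlg.
Variables (R : realType) (A : starAlgType R) (n : nat).

HB.instance Definition _ := GRing.NzRing.copy (matalg A n) 'M[A]_n.+1.

Definition matalg_scale (c : R[i]) (M : matalg A n) : matalg A n :=
  \matrix_(i, j) (c *: M i j).

Fact matalg_scaleA a b M :
  matalg_scale a (matalg_scale b M) = matalg_scale (a * b) M.
Proof. by apply/matrixP=> i j; rewrite !mxE scalerA. Qed.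
Fact matalg_scale1 : left_id 1 matalg_scale.
Proof. by move=> M; apply/matrixP=> i j; rewrite !mxE scale1r. Qed.
Fact matalg_scaleDr : right_distributive matalg_scale +%R.
Proof. by move=> a M N; apply/matrixP=> i j; rewrite !mxE scalerDr. Qed.
Fact matalg_scaleDl M : {morph matalg_scale^~ M : a b / a + b}.
Proof. by move=> a b; apply/matrixP=> i j; rewrite !mxE scalerDl. Qed.

HB.instance Definition _ := GRing.Zmodule_isLmodule.Build R[i] (matalg A n)
  matalg_scaleA matalg_scale1 matalg_scaleDr matalg_scaleDl.

Fact matalg_scaleAl (a : R[i]) (M N : matalg A n) :
  a *: (M * N) = (a *: M) * N.
Proof.
apply/matrixP=> i j; rewrite !mxE scaler_sumr.
by apply: eq_bigr => k _; rewrite !mxE scalerAl.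
Qed.

HB.instance Definition _ :=
  GRing.Lmodule_isLalgebra.Build R[i] (matalg A n) matalg_scaleAl.

Fact matalg_scaleAr (a : R[i]) (M N : matalg A n) :
  a *: (M * N) = M * (a *: N).
Proof.
apply/matrixP=> i j; rewrite !mxE scaler_sumr.
by apply: eq_bigr => k _; rewrite !mxE scalerAr.
Qed.

HB.instance Definition _ :=
  GRing.Lalgebra_isAlgebra.Build R[i] (matalg A n) matalg_scaleAr.

Definition matalg_star (M : matalg A n) : matalg A n :=
  \matrix_(i, j) star (M j i).

Fact matalg_starK : involutive matalg_star.
Proof. by move=> M; apply/matrixP=> i j; rewrite !mxE starK. Qed.
Fact matalg_starD M N : matalg_star (M + N) = matalg_star M + matalg_star N.
Proof. by apply/matrixP=> i j; rewrite !mxE starD. Qed.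
Fact matalg_starZ (c : R[i]) M :
  matalg_star (c *: M) = Num.conj c *: matalg_star M.
Proof. by apply/matrixP=> i j; rewrite !mxE starZ. Qed.
Fact matalg_starM (M N : matalg A n) :
  matalg_star (M * N) = matalg_star N * matalg_star M.
Proof.
apply/matrixP=> i j; rewrite !mxE.
rewrite (big_morph (@star R A) (@starD R A) (@star0 R A)).
by apply: eq_bigr => k _; rewrite !mxE starM.
Qed.

HB.instance Definition _ := Algebra_hasStar.Build R (matalg A n)
  matalg_starK matalg_starD matalg_starZ matalg_starM.

End MatAlg.

(* The C*-norm of M_{n+1}(B): a C*-algebra B has exactly one such norm on its
   matrix algebra. *)
Definition mxnorm (R : realType) (B : cstarType R) (n : nat) :
    matalg B n -> R :=
  xget (fun=> 0) [set N | is_cstar_norm N].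

Definition completely_positive (R : realType) (B : cstarType R)
    (eta : {linear B -> B}) :=
  forall n (x : matalg B n), positive x ->
    positive ((\matrix_(i, j) eta (x i j)) : matalg B n).

(* A unital *-algebra containing B by b |-> emb b, which plays the role of
   b 1_A; the bimodule structure is b1 a b2 = emb b1 * a * emb b2. *)
Record balg (R : realType) (B : cstarType R) := BAlg {
  balg_sort :> starAlgType R;
  emb : {lrmorphism B -> balg_sort};
  emb_star : forall b, emb (star b) = star (emb b)
}.

Section BAlgTheory.
Variables (R : realType) (B : cstarType R).

Record bprob := BProb {
  bprob_alg :> balg B;
  expect : {linear bprob_alg -> B};
  expect_bimod : forall (b1 b2 : B) (a : bprob_alg),
    expect (emb bprob_alg b1 * a * emb bprob_alg b2) = b1 * expect a * b2;
  expect_emb : forall b : B, expect (emb bprob_alg b) = b;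
  expect_pos : forall a : bprob_alg, positive (expect (a * star a))
}.

Section MatBAlg.
Variables (A : balg B) (n : nat).

Definition mat_emb (b : B) : matalg A n := (emb A b)%:M.

Fact mat_emb_linear : linear mat_emb.
Proof.
move=> c x y; apply/matrixP=> i j; rewrite !mxE linearP.
by case: (i == j); rewrite ?mulr1n ?mulr0n // scaler0 addr0.
Qed.
Fact mat_emb_monoid : monoid_morphism mat_emb.
Proof. by split=> [|x y]; rewrite /mat_emb ?rmorph1 ?rmorphM ?scalar_mxM. Qed.

HB.instance Definition _ :=
  GRing.isLinear.Build R[i] B (matalg A n) *:%R mat_emb mat_emb_linear.
HB.instance Definition _ :=
  GRing.isMonoidMorphism.Build B (matalg A n) mat_emb mat_emb_monoid.

Fact mat_emb_star b : mat_emb (star b) = star (mat_emb b).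
Proof.
apply/matrixP=> i j; rewrite !mxE emb_star eq_sym.
by case: (j == i); rewrite ?mulr1n ?mulr0n ?star0.
Qed.

Definition mat_balg : balg B := @BAlg R B (matalg A n) mat_emb mat_emb_star.

Definition mat_expect (E : A -> B) (M : mat_balg) : B :=
  n.+1%:R^-1 *: \sum_(i < n.+1) E (M i i).

End MatBAlg.

(* Expressions denoting the elements of the free *-algebra B<X_i, X_i^* : i in I>.
   An element is denoted by many expressions, but substitution, hence the joint
   distribution, only depends on the element. *)
Inductive bpoly (I : Type) :=
  | PConst of B
  | PVar of I
  | PVarStar of I
  | PAdd of bpoly I & bpoly I
  | PMul of bpoly I & bpoly I.

Fixpoint bpoly_eval (A : balg B) (I : Type) (x : I -> A) (p : bpoly I) : A :=
  match p with
  | PConst b => emb A b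
  | PVar i => x i
  | PVarStar i => star (x i)
  | PAdd p q => bpoly_eval x p + bpoly_eval x q
  | PMul p q => bpoly_eval x p * bpoly_eval x q
  end.

Definition jdist (A : balg B) (E : A -> B) (I : Type) (x : I -> A) :
    bpoly I -> B :=
  fun p => E (bpoly_eval x p).

Definition cvg_weakly (I : Type) (mu : nat -> bpoly I -> B) :=
  forall p, norm_cvg (fun n => mu n p).

Definition cvg_weakly_to (I : Type) (mu : nat -> bpoly I -> B)
    (nu : bpoly I -> B) :=
  forall p, norm_cvg_to (fun n => mu n p) (nu p).

Section Independence.
Variables (A : balg B) (E : A -> B).

Record is_star_subalg (C : set A) : Prop := {
  star_subalg_emb : forall b, C (emb A b);
  star_subalg_add : forall x y, C x -> C y -> C (x + y);
  star_subalg_mul : forall x y, C x -> C y -> C (x * y);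
  star_subalg_star : forall x, C x -> C (star x)
}.

(* The unital *-subalgebra generated by B and G. Stability under complex
   scalars follows from C 1 being contained in B. *)
Definition star_gen (G : set A) : set A := smallest is_star_subalg G.

Definition cond_indep (I : Type) (F : I -> set A) :=
  forall I1 I2 : set I, I1 `&` I2 = set0 ->
  forall a1 a2 a3 : A,
    star_gen (\bigcup_(i in I1) F i) a1 ->
    star_gen (\bigcup_(i in I2) F i) a2 ->
    star_gen (\bigcup_(i in I1) F i) a3 ->
    E (a1 * a2 * a3) = E (a1 * emb A (E a2) * a3).

Definition cond_indep_rv (I : Type) (x : I -> A) :=
  cond_indep (fun i => star_gen [set x i]).

Definition free_indep (I : Type) (F : I -> set A) :=
  forall (n : nat) (i : nat -> I) (a : nat -> A),
    (forall k, (k <= n)%N -> F (i k) (a k)) ->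
    (forall k, (k <= n)%N -> E (a k) = 0) ->
    (forall k, (k < n)%N -> i k <> i k.+1) ->
    E (\prod_(k < n.+1) a k) = 0.

Definition free_indep_subsets (I : Type) (G : I -> set A) :=
  free_indep (fun i => star_gen (G i)).

(* A partitioned argument list (a_1, ..., a_n) is encoded as a word of pairs
   (label, a_k), two positions being in the same block iff their labels are
   equal. The block of the letter at position l is an interval starting at l
   iff the test below succeeds. *)
Definition interval_at (L : eqType) (s : seq L) (l : nat) : bool :=
  if drop l s is c :: _ then
    (index c s == l) && all (pred1 c) (take (count_mem c s) (drop l s))
  else false.

(* (a_1, ..., a_l v, a_{l+r+1}, ..., a_n), or (v a_{r+1}, ..., a_n) if l = 0 *)
Definition insert_value (L : Type) (left : seq (L * A)) (v : B)
    (right : seq (L * A)) : seq (L * A) :=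
  match left, right with
  | x :: left', _ =>
      rcons (belast x left')
        ((last x left').1, (last x left').2 * emb A v) ++ right
  | [::], x :: right' => (x.1, emb A v * x.2) :: right'
  | [::], [::] => [::]
  end.

(* rho^(P)(a_1, ..., a_n), where rho^(n) is rho on lists of length n. The
   interval block removed at each step is the first one; for a noncrossing
   partition there is always one. The argument fuel bounds the number of
   blocks. *)
Fixpoint word_eval (L : eqType) (rho : seq A -> B) (fuel : nat)
    (w : seq (L * A)) : B :=
  if constant (unzip1 w) then rho (unzip2 w) else
  if fuel is fuel'.+1 then
    let l := find (interval_at (unzip1 w)) (iota 0 (size w)) in
    if drop l w is x :: _ then
      let r := count_mem x.1 (unzip1 w) in
      word_eval rho fuel'
        (insert_value (take l w) (rho (take r (drop l (unzip2 w))))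
                      (drop (l + r) w))
    else 0
  else 0.

Definition noncrossing (n : nat) (P : {set {set 'I_n}}) : bool :=
  finset.partition P [set: 'I_n]%SET &&
  [forall i : 'I_n, forall j : 'I_n, forall k : 'I_n, forall l : 'I_n,
    [&& (i < j < k)%N, (k < l)%N,
        finset.pblock P i == finset.pblock P k & finset.pblock P j == finset.pblock P l] ==>
    (finset.pblock P i == finset.pblock P j)].

Definition part_eval (rho : seq A -> B) (s : seq A)
    (P : {set {set 'I_(size s)}}) : B :=
  word_eval rho (size s) (zip [seq finset.pblock P i | i <- enum 'I_(size s)] s).

(* The free cumulants of orders 1, ..., N: kappa^(P) for P <> {[n]} only
   involves cumulants of orders < n (see cumulantE below). *)
Fixpoint cumulant_rec (N : nat) (s : seq A) : B :=
  if N is N'.+1 then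
    E (\prod_(x <- s) x) -
    \sum_(P : {set {set 'I_(size s)}} |
        noncrossing P && (P != [set [set: 'I_(size s)]]%SET))
      part_eval (cumulant_rec N') P
  else 0.

Definition cumulant (s : seq A) : B := cumulant_rec (size s) s.

Definition pair_partition (n : nat) (P : {set {set 'I_n}}) : bool :=
  [forall V in P, #|V| == 2].

(* (b_1 Y, b_2 Y, ..., b_m Y b_{m+1}) with m = m'.+1 and b_{k+1} = b k *)
Definition semicircular_args (Y : A) (m' : nat) (b : nat -> B) : seq A :=
  rcons [seq emb A (b k) * Y | k <- iota 0 m']
        (emb A (b m') * Y * emb A (b m'.+1)).

Definition semicircular (Y : A) (eta : B -> B) :=
  [/\ star Y = Y,
      forall (m' : nat) (b : nat -> B)
          (P : {set {set 'I_(size (semicircular_args Y m' b))}}),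
        noncrossing P -> ~~ pair_partition P -> part_eval cumulant P = 0 &
      forall b : B, E (Y * emb A b * Y) = eta b].

End Independence.
End BAlgTheory.

Section CumulantRecursion.
Variables (R : realType) (B : cstarType R) (A : balg B) (E : A -> B).

Lemma size_insert_value (L : Type) (left : seq (L * A)) v right :
  size (insert_value left v right) = (size left + size right)%N.
Proof.
by case: left => [|x l] /=; [case: right|rewrite size_cat size_rcons size_belast].
Qed.

Lemma word_eval_ext (L : eqType) (N : nat) (rho rho' : seq A -> B) fuel
    (w : seq (L * A)) :
  (forall s, (0 < size s < N)%N -> rho s = rho' s) -> (0 < size w)%N ->
  (size w < N + ~~ constant (unzip1 w))%N ->
  word_eval rho fuel w = word_eval rho' fuel w.
Proof.
move=> eq_rho; elim: fuel w => [|fuel IH] w /= w0; case: ifPn => // cw ltw.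
- by rewrite eq_rho // size_map w0; move: ltw; rewrite addn0.
- by rewrite eq_rho // size_map w0; move: ltw; rewrite addn0.
case def_d: (drop _ w) => [|x d] //; set l := find _ _ in def_d *.
set r := count_mem _ _.
have r0 : (0 < r)%N.
  rewrite -has_count has_pred1; apply/mapP; exists x => //.
  by apply: (@mem_drop l); rewrite def_d mem_head.
have ltr : (r < size w)%N.
  rewrite -(size_map fst) ltn_neqAle count_size andbT; apply: contra cw.
  by rewrite -all_count; case: (unzip1 w) => //= y s /andP[/eqP->].
rewrite addn1 ltnS in ltw.
have ltl : (l < size w)%N.
  by rewrite ltnNge; apply/negP => /drop_oversize; rewrite def_d.
have sz_take : (0 < size (take r (drop l (unzip2 w))) < N)%N.
  rewrite size_take_min size_drop size_map leq_min r0 subn_gt0 ltl /=.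
  by rewrite (leq_ltn_trans (geq_minl _ _)) // (leq_trans ltr).
have sz_ins v : size (insert_value (take l w) v (drop (l + r) w)) =
    (l + (size w - (l + r)))%N.
  by rewrite size_insert_value size_take ltl size_drop.
rewrite eq_rho //; apply: IH; rewrite sz_ins; first by lia.
by rewrite ltn_addr //; lia.
Qed.

Lemma constant_pblock (n : nat) (P : {set {set 'I_n.+1}}) :
  noncrossing P -> constant [seq finset.pblock P i | i <- enum 'I_n.+1] ->
  P = [set [set: 'I_n.+1]]%SET.
Proof.
move=> /andP[Ppart _] /constantP-/(_ finset.set0)[V eV].
have eP i : finset.pblock P i = V.
  have : finset.pblock P i \in [seq finset.pblock P i | i <- enum 'I_n.+1].
    by apply: map_f; rewrite mem_enum.
  by rewrite eV => /nseqP[].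
have cP : finset.cover P = [set: 'I_n.+1]%SET by exact: cover_partition.
have inV i : i \in V.
  by rewrite -(eP i) finset.mem_pblock cP finset.in_setT.
have VT : V = [set: 'I_n.+1]%SET.
  by apply/finset.setP => i; rewrite inV finset.in_setT.
apply/finset.setP => W; rewrite finset.in_set1 -VT.
apply/idP/eqP => [PW|->]; last first.
  by rewrite -(eP ord0) finset.pblock_mem // cP finset.in_setT.
have [_ tP P0] := and3P Ppart.
have [i iW] : exists i, i \in W.
  by apply/set0Pn; apply: contraNneq P0 => <-.
by rewrite -(eP i); symmetry; apply: def_pblock.
Qed.

Lemma part_eval_ext (rho rho' : seq A -> B) (s : seq A)
    (P : {set {set 'I_(size s)}}) :
  (forall t, (0 < size t < size s)%N -> rho t = rho' t) -> (0 < size s)%N ->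
  noncrossing P -> P != [set [set: 'I_(size s)]]%SET ->
  part_eval rho P = part_eval rho' P.
Proof.
move=> eq_rho s_gt0 ncP nP; 
have sz : size [seq finset.pblock P i | i <- enum 'I_(size s)] = size s.
  by rewrite size_map size_enum_ord.
rewrite /part_eval; apply: (word_eval_ext _ eq_rho).
  by rewrite size_zip sz minnn.
rewrite size_zip sz minnn unzip1_zip ?sz //.
suff -> : ~~ constant [seq finset.pblock P i | i <- enum 'I_(size s)].
  by rewrite addn1.
case: s P {eq_rho sz} s_gt0 ncP nP => // x s P _ ncP.
by apply: contraNN => /(constant_pblock ncP)->.
Qed.

Lemma cumulant_rec_fuel (N M : nat) (s : seq A) :
  (0 < size s)%N -> (size s <= N)%N -> (size s <= M)%N ->
  cumulant_rec E N s = cumulant_rec E M s.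
Proof.
elim: N M s => [|N IH] [|M] s s0 leN leM //=; try lia.
congr (_ - _); apply: eq_bigr => P /andP[ncP nP].
by apply: part_eval_ext => // t /andP[t0 t_lt]; apply: IH => //; lia.
Qed.

(* The recursion defining the free cumulants. *)
Lemma cumulantE (s : seq A) : (0 < size s)%N ->
  cumulant E s = E (\prod_(x <- s) x) -
    \sum_(P : {set {set 'I_(size s)}} |
        noncrossing P && (P != [set [set: 'I_(size s)]]%SET))
      part_eval (cumulant E) P.
Proof.
move=> s0; have -> : cumulant E s = cumulant_rec E (size s).-1.+1 s.
  by rewrite prednK.
rewrite /=.
congr (_ - _); apply: eq_bigr => P /andP[ncP nP].
apply: part_eval_ext => // t /andP[t0 t_lt].
by apply: cumulant_rec_fuel => //; lia.
Qed.

End CumulantRecursion.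

Section Families.
Variables (R : realType) (B : cstarType R).

Definition sumfam (A S T : Type) (x : S -> A) (y : T -> A) (k : S + T) : A :=
  match k with inl s => x s | inr t => y t end.

(* The singletons {Y_s}, s in S, together with the set {D_t : t in T}. *)
Definition free_blocks (A S T : Type) (Y : S -> A) (D : T -> A)
    (k : option S) : set A :=
  match k with Some s => [set Y s] | None => range D end.

Definition mat_Y (A : balg B) (n : nat) (a : 'I_n.+1 -> 'I_n.+1 -> A) :
    mat_balg A n :=
  \matrix_(i, j) a i j.

Definition mat_D (n : nat) (b : 'I_n.+1 -> B) : matalg B n :=
  diag_mx (\row_i b i).

Definition mat_incl (A : balg B) (n : nat) (M : matalg B n) : mat_balg A n :=
  \matrix_(i, j) emb A (M i j).

End Families.

Arguments expect {R B} P : rename.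
Arguments mat_expect {R B A} n E.

(* Main.v *)
Require Import Defs.
From HB Require Import structures.
From mathcomp Require Import all_boot all_order all_algebra.
From mathcomp Require Import all_classical all_reals all_analysis.
From mathcomp Require Import complex zify ring lra.
Import Order.TTheory GRing.Theory Num.Theory.
Import numFieldNormedType.Exports.
Set Implicit Arguments.
Unset Strict Implicit.
Unset Printing Implicit Defensive.
Local Open Scope classical_set_scope.
Local Open Scope ring_scope.

(** The proof rests on Schwinger-Dyson equations. Expand the normalized trace
    E_n[d_0 Y_{s_1} d_1 ... Y_{s_m} d_m], with diagonal d_k, as a sum over closed
    walks of length m on the index set. By conditional independence and centering,
    a walk that uses some edge only once contributes nothing (single_edge). A walk
    has an expectation of order n^(-m/2), there are of the order of n^v walks on v
    vertices (count_words), and the trace carries a factor 1/n: only walks on at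
    least m/2 + 1 vertices matter. If all their edges are doubled, such walks
    explore a tree and use each edge exactly twice (tight_walk). Hence the first
    step is retraced by exactly one other step k, with s_k = s_1, and the part of
    the walk in between has no edge in common with the rest. Conditioning on this
    part and then on the first edge (tight_expect) yields, up to O(n^(-1/2))
    (sd_bound), that the trace is the sum over the k with s_k = s_1 of

      E_n[d_0 eta_{s_1}(E_n[d_1 Y_{s_2} ... d_{k-1}]) d_k Y_{s_{k+1}} ... d_m].

    The moment condition on the entries of the D(t,n) makes all powers of their
    maximal norm negligible with respect to n^(1/2), and keeps traces bounded. By
    induction on m, all mixed moments therefore converge (lim_trace_cvg), and their
    limits satisfy the equations exactly (lim_trace_sd).

    The limit space is the algebra of all sequences (p(Y(.,n), D(.,n)))_n, for p a
    B-polynomial, with the norm limit of the E_n as expectation (limit_bprob). Its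
    positivity requires that the positive elements of a C*-algebra form a closed
    convex cone. For selfadjoint x of norm at most r, positivity amounts to
    ||r - x|| <= r (positive_norm_le, norm_le_positive), because the norm of a
    selfadjoint element is its spectral radius (selfadjoint_spectral_radius).

    The exact equations imply the rest. In an alternating product of centered
    elements, apply them to the first letter Y_s: pairings inside its own factor
    are cancelled by the centering of this factor, and a pairing with a letter of a
    later factor encloses an alternating product with fewer letters Y
    (alternating_step); hence freeness (free_of_schwinger_dyson). For a single Y_s,
    they are the recursion satisfied by the sums over noncrossing pair partitions
    (nc2_sum), when these are sorted by the partner of the first point. So the
    moments of Y_s are such sums, and the recursion defining the free cumulants
    leaves only those of order 2 (cumulant_sandwich). *)

(** * The norm of a C*-algebra *)

Section RealSequences.
Variable R : realType.
Implicit Types f g : nat -> R.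

Lemma cvg0_squeeze f g : (forall n, 0 <= f n <= g n) ->
  g n @[n --> \oo] --> 0 -> f n @[n --> \oo] --> 0.
Proof.
move=> fg g0; apply: (@squeeze_cvgr _ _ _ _ (fun=> 0) g) => //; last exact: cvg_cst.
by near=> n; exact: fg.
Unshelve. all: by end_near. Qed.

Lemma cvg0D f g : f n @[n --> \oo] --> 0 -> g n @[n --> \oo] --> 0 ->
  (f n + g n) @[n --> \oo] --> 0.
Proof. by move=> f0 g0; rewrite -[0]addr0; apply: cvgD. Qed.

Lemma cvg0Ml (c : R) f : f n @[n --> \oo] --> 0 -> (c * f n) @[n --> \oo] --> 0.
Proof. by move=> f0; rewrite -[0](mulr0 c); apply: cvgM => //; exact: cvg_cst. Qed.

Lemma le_lim0 (c : R) f : (forall n, c <= f n) -> f n @[n --> \oo] --> 0 -> c <= 0.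
Proof.
move=> cf f0; rewrite -(cvg_lim _ f0) //.
apply: limr_ge; first by apply/cvg_ex; exists 0.
by near=> n; exact: cf.
Unshelve. all: by end_near. Qed.

Lemma cvg0_small f (e : R) : 0 < e -> f n @[n --> \oo] --> 0 ->
  exists N, forall n, (N <= n)%N -> `|f n| < e.
Proof.
move=> e0 /cvgrPdist_lt /(_ e e0) [N _ hN]; exists N => n Nn.
by have := hN n Nn; rewrite /= sub0r normrN.
Qed.

Lemma sumr_cvg0 (I : Type) (r : seq I) (F : I -> nat -> R) :
  (forall i, F i n @[n --> \oo] --> (0 : R)) ->
  \sum_(i <- r) F i n @[n --> \oo] --> (0 : R).
Proof.
move=> h; elim: r => [|i r IH].
  by under eq_cvg do rewrite big_nil; exact: cvg_cst.
by under eq_cvg do rewrite big_cons; exact: cvg0D.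
Qed.

Lemma cvg0_bounded (f : nat -> R) : f n @[n --> \oo] --> (0 : R) ->
  exists C, forall n, f n <= C.
Proof.
move=> f0; have [M hM] := cvg0_small ltr01 f0.
exists (\sum_(n < M) `|f n| + 1) => n; have [nM|Mn] := ltnP n M.
  rewrite (bigD1 (Ordinal nM)) //= -addrA; apply: le_trans (ler_norm _) _.
  by rewrite lerDl addr_ge0 // sumr_ge0.
rewrite ler_wpDl //; first exact: sumr_ge0.
exact: le_trans (ler_norm _) (ltW (hM n Mn)).
Qed.

End RealSequences.

Section CStarNorm.
Variables (R : realType) (B : cstarType R).
Local Notation N := (@cnorm R B).
Implicit Types x y z : B.

Lemma star1 (A : starAlgType R) : star (1 : A) = 1.
Proof. by rewrite -[LHS]mulr1 -{2}[1]starK -starM mulr1 starK. Qed.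

Lemma starN (A : starAlgType R) (x : A) : star (- x) = - star x.
Proof. by apply: (addrI (star x)); rewrite -starD !subrr star0. Qed.

Lemma starB (A : starAlgType R) (x y : A) : star (x - y) = star x - star y.
Proof. by rewrite starD starN. Qed.

Lemma star_sum (A : starAlgType R) I (r : seq I) (P : pred I) (F : I -> A) :
  star (\sum_(i <- r | P i) F i) = \sum_(i <- r | P i) star (F i).
Proof. exact: (big_morph _ (@starD R A) (@star0 R A)). Qed.

Lemma cnorm_ge0 x : 0 <= N x. Proof. exact: (cstar_norm_ge0 cnorm_cstar). Qed.
Lemma cnormD x y : N (x + y) <= N x + N y.
Proof. exact: (cstar_normD cnorm_cstar). Qed.
Lemma cnormM x y : N (x * y) <= N x * N y.
Proof. exact: (cstar_normM cnorm_cstar). Qed.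
Lemma cnormZ (c : R[i]) x : N (c *: x) = complex.Re `|c| * N x.
Proof. exact: (cstar_normZ cnorm_cstar). Qed.
Lemma cnorm_starM x : N (star x * x) = N x ^+ 2.
Proof. exact: (cstar_identity cnorm_cstar). Qed.
Lemma cnorm_eq0 x : N x = 0 -> x = 0.
Proof. exact: (cstar_norm_eq0 cnorm_cstar). Qed.

Lemma cnorm0 : N 0 = 0.
Proof. by rewrite -(scale0r (0 : B)) cnormZ normr0 /= mul0r. Qed.

Lemma cnormN x : N (- x) = N x.
Proof. by rewrite -scaleN1r cnormZ normrN1 /= mul1r. Qed.

Lemma cnormB x y : N (x - y) <= N x + N y.
Proof. by rewrite -(cnormN y) cnormD. Qed.

Lemma cnorm_distC x y : N (x - y) = N (y - x).
Proof. by rewrite -opprB cnormN. Qed.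

Lemma cnorm_sum I (r : seq I) (P : pred I) (F : I -> B) :
  N (\sum_(i <- r | P i) F i) <= \sum_(i <- r | P i) N (F i).
Proof.
apply: (big_ind2 (fun x c => N x <= c)) => //; first by rewrite cnorm0.
by move=> x c y d hx hy; apply: (le_trans (cnormD _ _)); apply: lerD.
Qed.

(** The C*-identity gives ||x||^2 <= ||x^*|| ||x||, and exchanging x and x^* the
    converse inequality. *)
Lemma cnorm_star x : N (star x) = N x.
Proof.
suff h y : N y <= N (star y) by apply/eqP; rewrite eq_le h -{2}(starK x) h.
have := cnormM (star y) y; rewrite cnorm_starM expr2.
have [->|y0 ] := eqVneq (N y) 0; first by rewrite cnorm_ge0.
by rewrite ler_pM2r // lt_neqAle eq_sym y0 cnorm_ge0.
Qed.

Lemma cnorm1 : N 1 = 1.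
Proof.
have := cnorm_starM 1; rewrite star1 mulr1 expr2 => h.
have n0 : N 1 != 0 by apply/eqP => /cnorm_eq0/eqP; rewrite oner_eq0.
by apply: (mulfI n0); rewrite mulr1 -h.
Qed.

Lemma cnormZr (c : R) x : 0 <= c -> N (c%:C%C *: x) = c * N x.
Proof. by move=> c0; rewrite cnormZ ger0_norm ?ler0c. Qed.

Lemma cnormX_le x n : N (x ^+ n) <= N x ^+ n.
Proof.
elim: n => [|n IH]; first by rewrite !expr0 cnorm1.
by rewrite !exprS (le_trans (cnormM _ _)) // ler_wpM2l ?cnorm_ge0.
Qed.

Lemma invSn_real n : n.+1%:R^-1 = (n.+1%:R^-1)%:C%C :> R[i].
Proof. by rewrite fmorphV rmorph_nat. Qed.

Lemma cnorm_invSn n x : N (n.+1%:R^-1 *: x) = n.+1%:R^-1 * N x.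
Proof. by rewrite invSn_real cnormZr // invr_ge0 ler0n. Qed.

Section NormLimits.
Implicit Types u v : nat -> B.

Lemma norm_cvg_unique u x y : norm_cvg_to u x -> norm_cvg_to u y -> x = y.
Proof.
move=> ux uy; apply/eqP; rewrite -subr_eq0; apply/eqP/cnorm_eq0/eqP.
rewrite eq_le cnorm_ge0 andbT.
apply: (@le_lim0 _ _ (fun n => N (u n - x) + N (u n - y))); last exact: cvg0D.
move=> n; rewrite -(cnormN (u n - x)) opprB.
by apply: le_trans (cnormD _ _); rewrite addrA subrK.
Qed.

Lemma norm_cvg_cst x : norm_cvg_to (fun=> x) x.
Proof. rewrite /norm_cvg_to subrr cnorm0; exact: cvg_cst. Qed.

Lemma norm_cvg_le u x f : (forall n, N (u n - x) <= f n) ->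
  f n @[n --> \oo] --> (0 : R) -> norm_cvg_to u x.
Proof. by move=> h; apply: cvg0_squeeze => n; rewrite cnorm_ge0 h. Qed.

Lemma norm_cvgD u v x y : norm_cvg_to u x -> norm_cvg_to v y ->
  norm_cvg_to (fun n => u n + v n) (x + y).
Proof.
move=> ux vy; apply: (@norm_cvg_le _ _ (fun n => N (u n - x) + N (v n - y))).
  by move=> n; rewrite opprD addrACA cnormD.
exact: cvg0D.
Qed.

Lemma norm_cvgZ (c : R[i]) u x : norm_cvg_to u x ->
  norm_cvg_to (fun n => c *: u n) (c *: x).
Proof.
move=> ux; apply: (@norm_cvg_le _ _ (fun n => complex.Re `|c| * N (u n - x))).
  by move=> n; rewrite -scalerBr cnormZ.
exact: cvg0Ml.
Qed.

Lemma norm_cvgM2 a b u x : norm_cvg_to u x ->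
  norm_cvg_to (fun n => a * u n * b) (a * x * b).
Proof.
move=> ux; apply: (@norm_cvg_le _ _ (fun n => (N a * N b) * N (u n - x))).
  move=> n; rewrite -mulrBl -mulrBr (le_trans (cnormM _ _)) // mulrAC.
  by rewrite ler_wpM2r ?cnorm_ge0 ?cnormM.
exact: cvg0Ml.
Qed.

Lemma norm_cvg_sum I (r : seq I) (F : I -> nat -> B) (x : I -> B) :
  (forall i, norm_cvg_to (F i) (x i)) ->
  norm_cvg_to (fun n => \sum_(i <- r) F i n) (\sum_(i <- r) x i).
Proof.
move=> h; elim: r => [|i r IH].
  rewrite big_nil (_ : (fun n => _) = fun=> 0) ?boolp.funeqE; first exact: norm_cvg_cst.
  by move=> n; rewrite big_nil.
rewrite big_cons (_ : (fun n => _) = fun n => F i n + \sum_(i <- r) F i n).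
  exact: norm_cvgD.
by rewrite boolp.funeqE => n; rewrite big_cons.
Qed.

Lemma norm_cvg_bounded u x : norm_cvg_to u x -> exists C, forall n, N (u n) <= C.
Proof.
move=> /cvg0_bounded[C hC]; exists (C + N x) => n.
by rewrite -{1}(subrK x (u n)); apply: le_trans (cnormD _ _) _; rewrite lerD2r.
Qed.

Lemma norm_cvg_close (u v : nat -> B) x : N (u n - v n) @[n --> \oo] --> (0 : R) ->
  norm_cvg_to v x -> norm_cvg_to u x.
Proof.
move=> uv vx; apply: (@norm_cvg_le _ _ (fun n => N (u n - v n) + N (v n - x))).
  by move=> n; apply: le_trans (cnormD _ _); rewrite addrA subrK.
exact: cvg0D.
Qed.

End NormLimits.

End CStarNorm.

(** * Spectra and positive elements *)

Section ComplexModulus.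
Variable R : realType.
Implicit Types z w : R[i].

Definition cmod z : R := complex.Re `|z|.

Lemma cmodE z : `|z| = (cmod z)%:C%C.
Proof. by rewrite /cmod RRe_real // normr_real. Qed.

Lemma cmod_ge0 z : 0 <= cmod z.
Proof. by rewrite -ler0c -cmodE. Qed.

Lemma cmodM z w : cmod (z * w) = cmod z * cmod w.
Proof. by apply: complexI; rewrite rmorphM /= -!cmodE normrM. Qed.

Lemma cmodV z : cmod z^-1 = (cmod z)^-1.
Proof. by apply: complexI; rewrite fmorphV /= -!cmodE normfV. Qed.

Lemma cmod_eq0 z : (cmod z == 0) = (z == 0).
Proof. by rewrite -(inj_eq (@complexI R)) -cmodE normr_eq0. Qed.

Lemma cmod_sq a b : cmod (a +i* b)%C ^+ 2 = a ^+ 2 + b ^+ 2.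
Proof. by rewrite /cmod normc_def /= sqr_sqrtr // addr_ge0 // sqr_ge0. Qed.

Lemma cmodr (c : R) : 0 <= c -> cmod c%:C%C = c.
Proof. by move=> c0; rewrite /cmod ger0_norm ?ler0c. Qed.

Lemma cmodN z : cmod (- z) = cmod z. Proof. by rewrite /cmod normrN. Qed.

Lemma cmod1 : cmod 1 = 1. Proof. by rewrite /cmod normr1. Qed.

End ComplexModulus.

Section Spectral.
Variables (R : realType) (B : cstarType R).
Local Notation N := (@cnorm R B).
Implicit Types (x y z g h : B) (t : R[i]).

Definition is_inv x g := x * g = 1 /\ g * x = 1.

Lemma is_invN x g : is_inv x g -> is_inv (- x) (- g).
Proof. by move=> [h1 h2]; split; rewrite mulrNN. Qed.

Lemma is_invZ t x g : t != 0 -> is_inv x g -> is_inv (t *: x) (t^-1 *: g).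
Proof.
move=> t0 [h1 h2]; split; rewrite -scalerAl -scalerAr scalerA.
  by rewrite mulfV // h1 scale1r.
by rewrite mulVf // h2 scale1r.
Qed.

Lemma invertible_inv x : invertible x <-> exists g, is_inv x g.
Proof. by split=> -[g hg]; exists g. Qed.

(** The geometric series is Cauchy, hence converges by completeness. *)
Lemma neumann z : N z < 1 -> exists g, is_inv (1 - z) g.
Proof.
move=> z1; set q := N z in z1; have q0 : 0 <= q := cnorm_ge0 z.
pose u n := \sum_(k < n) z ^+ k.
have uE n : (1 - z) * u n = 1 - z ^+ n.
  rewrite -opprB mulNr -subrX1 opprB //.
have uE' n : u n * (1 - z) = 1 - z ^+ n.
  rewrite -uE /u mulr_suml mulr_sumr; apply: eq_bigr => i _.
  by rewrite mulrBl mulrBr mul1r mulr1 -exprS -exprSr.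
have q1 : `|q| < 1 by rewrite ger0_norm.
have qn := cvg_expr q1.
have tail m n : (n <= m)%N -> N (u m - u n) <= q ^+ n / (1 - q).
  move=> nm; rewrite -(subnKC nm) /u big_split_ord /= addrAC subrr add0r.
  apply: (le_trans (cnorm_sum _ _ _)).
  apply: (@le_trans _ _ (\sum_(i < m - n) q ^+ n * q ^+ i)).
    by apply: ler_sum => i _; rewrite -exprD cnormX_le.
  rewrite -mulr_sumr ler_wpM2l ?exprn_ge0 // -[leRHS]div1r ler_pdivlMr ?subr_gt0 //.
  rewrite mulrC -opprB mulNr -subrX1 opprB lerBlDr lerDl exprn_ge0 //.
have cau (e : R) : 0 < e -> exists M, forall m n : nat,
    (M <= m)%N -> (M <= n)%N -> N (u m - u n) < e.
  move=> e0; have e0' : 0 < e * (1 - q) by rewrite mulr_gt0 // subr_gt0.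
  have [M hM] := cvg0_small e0' qn; exists M => m n Mm Mn.
  wlog nm : m n Mm Mn / (n <= m)%N.
    move=> W; have [nm|/ltnW mn] := leqP n m; first exact: W.
    by rewrite cnorm_distC; exact: W.
  apply: le_lt_trans (tail _ _ nm) _; rewrite ltr_pdivrMr ?subr_gt0 //.
  by apply: le_lt_trans (ler_norm _) (hM _ Mn).
have [l hl] := cnorm_complete u cau.
exists l; split; apply/eqP; rewrite -subr_eq0; apply/eqP/cnorm_eq0/eqP;
  rewrite eq_le cnorm_ge0 andbT.
  apply: (@le_lim0 _ _ (fun n => N (1 - z) * N (u n - l) + q ^+ n)).
    move=> n; have -> : (1 - z) * l - 1 = - ((1 - z) * (u n - l)) - z ^+ n.
      by rewrite mulrBr uE opprB -addrA; congr (_ + _); rewrite opprB addrAC subrr add0r.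
    apply: (le_trans (cnormB _ _)); rewrite cnormN lerD ?cnormM ?cnormX_le //.
  by apply: cvg0D => //; exact: cvg0Ml.
apply: (@le_lim0 _ _ (fun n => N (1 - z) * N (u n - l) + q ^+ n)).
  move=> n; have -> : l * (1 - z) - 1 = - ((u n - l) * (1 - z)) - z ^+ n.
    by rewrite mulrBl uE' opprB -addrA; congr (_ + _); rewrite opprB addrAC subrr add0r.
  apply: (le_trans (cnormB _ _)); rewrite cnormN mulrC lerD ?cnormM ?cnormX_le //.
by apply: cvg0D => //; exact: cvg0Ml.
Qed.

Lemma inv_bound t y g (q : R) : N y <= q -> q < cmod t -> is_inv (t%:A - y) g ->
  N g <= (cmod t - q)^-1.
Proof.
move=> yq qt [hg _]; rewrite -[leRHS]mul1r ler_pdivlMr ?subr_gt0 //.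
have : t *: g = 1 + y * g.
  by rewrite -hg mulrBl -scalerAl mul1r subrK.
move=> /(congr1 N); rewrite cnormZ -/(cmod t) => e.
have := cnormD 1 (y * g); rewrite -e cnorm1 => e1.
have e2 : N (y * g) <= q * N g.
  by apply: (le_trans (cnormM _ _)); rewrite ler_wpM2r // cnorm_ge0.
rewrite mulrBr mulrC (mulrC _ q) lerBlDr; lra.
Qed.

Lemma inv_shift t y (q : R) : N y <= q -> q < cmod t ->
  exists2 g, is_inv (t%:A - y) g & N g <= (cmod t - q)^-1.
Proof.
move=> yq qt; have q0 : 0 <= q := le_trans (cnorm_ge0 _) yq.
have t0 : t != 0 by rewrite -cmod_eq0 gt_eqF // (le_lt_trans q0).
have [|g hg] := @neumann (t^-1 *: y).
  rewrite cnormZ -/(cmod _) cmodV mulrC ltr_pdivrMr ?mul1r.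
    exact: le_lt_trans yq qt.
  exact: le_lt_trans q0 qt.
have hg2 : is_inv (t%:A - y) (t^-1 *: g).
  have := is_invZ t0 hg; rewrite scalerBr scalerA mulfV // scale1r.
  by [].
by exists (t^-1 *: g) => //; exact: inv_bound hg2.
Qed.

(** Factor x - y = x (1 - g y), where g y has norm at most 1/2. *)
Lemma inv_near x y g : is_inv x g -> N y * N g <= 2^-1 ->
  exists2 h, is_inv (x - y) h & N h <= 2 * N g.
Proof.
move=> [xg gx] yg; have h1 : N (g * y) <= 2^-1.
  by apply: le_trans (cnormM _ _) _; rewrite mulrC.
have [|k [k1 k2] kb] := @inv_shift 1 (g * y) _ h1.
  by rewrite cmod1; lra.
rewrite scale1r in k1 k2.
exists (k * g).
  split.
    rewrite mulrA [(x - y) * k](_ : _ = x) ?xg //.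
    by rewrite -[y]mul1r -xg -mulrA -{1}[x]mulr1 -mulrBr -mulrA k1 mulr1.
  by rewrite -mulrA mulrBr gx k2.
apply: (le_trans (cnormM _ _)); rewrite ler_wpM2r ?cnorm_ge0 //.
apply: le_trans kb _; rewrite cmod1.
have -> : 1 - 2^-1 = 2^-1 :> R by lra.
by rewrite invrK.
Qed.

Lemma spectrum_le x t : spectrum x t -> cmod t <= N x.
Proof.
rewrite /spectrum /= leNgt => h; apply/negP => lt; apply: h.
by have [g hg _] := inv_shift (lexx (N x)) lt; exists g.
Qed.

Lemma scale_alg_comm (t : R[i]) y : t%:A * y = y * t%:A.
Proof. by rewrite -scalerAl -scalerAr mul1r mulr1. Qed.

Lemma conj_real (a : R) : Num.conj (a%:C%C : R[i]) = a%:C%C.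
Proof. by apply: CrealP; apply/complex_realP; exists a. Qed.

Lemma conj_imag (a : R) : Num.conj (0 +i* a)%C = - (0 +i* a)%C :> R[i].
Proof.
have -> : (0 +i* a)%C = 'i%C * a%:C%C :> R[i].
  by simpc.
by rewrite rmorphM /= conj_real complexiE conjCi mulNr.
Qed.

Lemma star_alg (t : R[i]) : star (t%:A : B) = (Num.conj t)%:A.
Proof. by rewrite starZ star1. Qed.

(** Shift trick: write a + i b - y = i (b + mu) - w with w = (y - a) + i mu.
    Since w^* w = (y - a)^2 + mu^2, the norm of w is about mu for mu large and of
    the sign of b, thus smaller than |b + mu| by nearly |b|. *)
Lemma selfadjoint_resolvent y (a b : R) : star y = y -> b != 0 ->
  exists2 g, is_inv ((a +i* b)%C%:A - y) g & N g <= 2 / `|b|.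
Proof.
move=> sy b0; set y' := y - (a%:C%C)%:A; set c := N y'.
have sy' : star y' = y' by rewrite starB sy star_alg conj_real.
(* the choice mu = s b makes ||w|| <= |b| (s + 1/2), while |b + mu| = |b| (s + 1) *)
pose s := c ^+ 2 / b ^+ 2 + 1.
have b2 : 0 < b ^+ 2 by rewrite exprn_even_gt0.
have s0 : 0 < s.
  by have : 0 <= c ^+ 2 / b ^+ 2 by [rewrite divr_ge0 // sqr_ge0]; rewrite /s; lra.
pose mu := s * b; pose w := y' + ((0 +i* mu)%C)%:A.
have bn : 0 < `|b| by rewrite normr_gt0.
have Nw : N w <= `|b| * (s + 2^-1).
  rewrite -(@ler_pXn2r _ 2) ?nnegrE ?cnorm_ge0 //; last by rewrite mulr_ge0 //; lra.
  rewrite -cnorm_starM /w starD sy' star_alg conj_imag.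
  set i := (0 +i* mu)%C.
  have -> : (y' + (- i)%:A) * (y' + i%:A) = y' * y' + ((mu ^+ 2)%:C%C)%:A.
    move: (y') => v; rewrite mulrDl !mulrDr scaleNr !mulNr (scale_alg_comm i v) addrA.
    rewrite addrK -scalerAl mul1r scalerA -scaleNr; congr (_ + _%:A).
    apply/eqP; rewrite eq_complex /= !(mul0r, mulr0, subr0, addr0, mul1r, add0r, sub0r, oppr0).
    by rewrite opprK expr2 !eqxx.
  apply: le_trans (cnormD _ _) _; rewrite cnormZr ?sqr_ge0 // cnorm1 mulr1.
  have h1 := cnormM y' y'; rewrite -/c -expr2 in h1.
  have e1 : c ^+ 2 <= s * b ^+ 2.
    by rewrite /s mulrDl mul1r divfK ?gt_eqF // lerDl ltW.
  apply: (le_trans (lerD (le_trans h1 e1) (lexx _))).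
  have -> : (`|b| * (s + 2^-1)) ^+ 2 = b ^+ 2 * (s + 2^-1) ^+ 2.
    by rewrite exprMn real_normK ?num_real.
  rewrite /mu exprMn -mulrDl mulrC.
  by rewrite ler_pM2l //; nra.
have hk : cmod (0 +i* (b + mu))%C = `|b| * (s + 1).
  rewrite -[LHS]ger0_norm ?cmod_ge0 // -sqrtr_sqr cmod_sq expr0n /= add0r.
  rewrite /mu -{1}[b]mul1r -mulrDl sqrtr_sqr normrM mulrC addrC.
  by congr (_ * _); rewrite ger0_norm //; lra.
have [|g hg gb] := @inv_shift (0 +i* (b + mu))%C w _ Nw.
  by rewrite hk ltr_pM2l //; lra.
exists g.
  suff -> : (a +i* b)%C%:A - y = ((0 +i* (b + mu))%C)%:A - w by [].
  rewrite /w /y' opprD opprB (addrAC (a%:C%C)%:A) [RHS]addrA; congr (_ - _).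
  rewrite -scalerBl -scalerDl; congr (_%:A).
  apply/eqP; rewrite eq_complex /=; apply/andP; split; apply/eqP; ring.
apply: le_trans gb _; rewrite hk -mulrBr.
have -> : s + 1 - (s + 2^-1) = 2^-1 by lra.
by rewrite invfM invrK mulrC.
Qed.

Lemma selfadjoint_spectrum_real y t : star y = y -> spectrum y t -> complex.Im t = 0.
Proof.
case: t => a b sy /= h; apply/eqP/negPn/negP => b0; apply: h.
by have [g hg _] := selfadjoint_resolvent a sy b0; exists g.
Qed.

(** Partial fractions: 1 / (1 - x^2) is the mean of 1 / (1 - x) and 1 / (1 + x). *)
Lemma is_inv_sq x g h : is_inv (1 - x) g -> is_inv (1 + x) h ->
  is_inv (1 - x * x) (2^-1 *: (g + h)).
Proof.
move=> [g1 g2] [h1 h2].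
have e1 : 1 - x * x = (1 - x) * (1 + x).
  by rewrite mulrBl mul1r mulrDr mulr1 opprD addrA addrK.
have e2 : 1 - x * x = (1 + x) * (1 - x).
  by rewrite mulrDl mul1r mulrBr mulr1 addrA subrK.
have two : 2^-1 *: (1 + x + (1 - x)) = 1.
  by rewrite addrACA subrr addr0 -mulr2n -[X in _ *: X]scaler_nat scalerA mulVf ?pnatr_eq0 // scale1r.
split.
  by rewrite -scalerAr mulrDr {1}e2 e1 -!mulrA g1 h1 !mulr1.
by rewrite -scalerAl mulrDl {1}e1 e2 !mulrA g2 h2 !mul1r.
Qed.

(** The quantifier over the whole circle makes the condition stable under
    squaring of y and s, which replaces the contour integrals of the usual proof
    of the spectral radius formula. *)
Definition close_resolvents y (s : R) := forall t, cmod t = 1 -> exists g h,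
  [/\ is_inv (1 - t *: y) g, is_inv (1 - (s%:C%C * t) *: y) h & N (g - h) <= 4^-1].

(** Every unimodular t is a square r^2, and the resolvents at t are the means of
    those at r and - r. *)
Lemma close_resolvents_sq y s :
  close_resolvents y s -> close_resolvents (y * y) (s ^+ 2).
Proof.
move=> P t t1; pose r := sqrtc t; have r2 : r * r = t by rewrite -expr2 sqr_sqrtc.
have r1 : cmod r = 1.
  apply/eqP; rewrite -(@eqrXn2 _ 2) ?cmod_ge0 // expr1n.
  by rewrite expr2 -cmodM r2 t1.
have [g [h [hg hh gh]]] := P r r1.
have [|g' [h' [hg' hh' gh']]] := P (- r); first by rewrite cmodN.
rewrite mulrN !scaleNr !opprK in hg' hh'.
exists (2^-1 *: (g + g')), (2^-1 *: (h + h')); split.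
- by have := is_inv_sq hg hg'; rewrite -scalerAl -scalerAr scalerA r2.
- have := is_inv_sq hh hh'; rewrite -scalerAl -scalerAr scalerA.
  by rewrite mulrACA r2 rmorphXn /= expr2.
- rewrite -scalerBr opprD addrACA cnormZ -/(cmod _) cmodV.
  have -> : cmod (2 : R[i]) = 2.
    by rewrite -(rmorph_nat (real_complex R)) cmodr.
  rewrite mulrC ler_pdivrMr //; apply: le_trans (cnormD _ _) _; lra.
Qed.

(** Near t = 1 and t = -1 the inverse is a perturbation of the one at 1 or -1; the
    rest of the circle stays away from the real line, where
    selfadjoint_resolvent gives a bound. *)
Lemma circle_bound y : star y = y ->
  (forall t, cmod t = 1 -> exists g, is_inv (1 - t *: y) g) ->
  exists2 K : R, 0 < K & forall t, cmod t = 1 ->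
    exists2 g, is_inv (1 - t *: y) g & N g <= K.
Proof.
move=> sy ex.
have [g1 hg1] := ex 1 (cmod1 R).
have [|g2 hg2] := ex (-1); first by rewrite cmodN cmod1.
have := (cnorm_ge0 g1, cnorm_ge0 g2, cnorm_ge0 y) => -[[p1 p2] p3].
set D := 2 * (1 + N y) * (1 + N g1 + N g2); pose d := D^-1.
have D1 : 1 <= D by rewrite /D; nra.
have d0 : 0 < d by rewrite invr_gt0; lra.
have d1 : d <= 1 by rewrite invf_le1; lra.
have near (s : R[i]) t g : cmod (t - s) <= d -> is_inv (1 - s *: y) g ->
    N g <= N g1 + N g2 -> exists2 g, is_inv (1 - t *: y) g & N g <= 2 * (N g1 + N g2).
  move=> ts hg gb; have [|h hh hb] := @inv_near _ ((t - s) *: y) g hg.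
    rewrite cnormZ -/(cmod _); have g0 := cnorm_ge0 g.
    have : cmod (t - s) * N y * N g <= d * (N y * (N g1 + N g2)).
      rewrite -mulrA ler_pM ?cmod_ge0 ?mulr_ge0 // ler_wpM2l //.
    move=> /le_trans; apply; rewrite /d mulrC ler_pdivrMr; last lra.
    by rewrite /D; nra.
  exists h; last by apply: le_trans hb _; lra.
  by move: hh; rewrite scalerBl opprB addrA subrK.
exists (4 / d + 2 * (N g1 + N g2)); first by rewrite ltr_wpDr ?divr_gt0 //; lra.
move=> t t1; have d4 : 0 < 4 / d by rewrite divr_gt0.
have [h|ht] := leP (cmod (t - 1)) d.
  by have [|g hg gb] := near _ _ _ h hg1; [lra|exists g => //; lra].
have [h|ht'] := leP (cmod (t - (-1))) d.
  by have [|g hg gb] := near _ _ _ h hg2; [lra|exists g => //; lra].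
have t0 : t != 0 by rewrite -cmod_eq0 t1 oner_eq0.
have ti : cmod t^-1 = 1 by rewrite cmodV t1 invr1.
case: t t1 ht ht' t0 ti => a b t1 ht ht' t0 ti.
have e : a ^+ 2 + b ^+ 2 = 1 by rewrite -cmod_sq t1 expr1n.
have l1 : d ^+ 2 < (a - 1) ^+ 2 + b ^+ 2.
  rewrite -(subr0 b) -cmod_sq ltr_pXn2r ?nnegrE ?cmod_ge0 //; last exact: ltW.
have l2 : d ^+ 2 < (a + 1) ^+ 2 + b ^+ 2.
  rewrite -(subr0 b) -cmod_sq ltr_pXn2r ?nnegrE ?cmod_ge0 //; last exact: ltW.
  by move: ht'; rewrite opprK subr0; congr (_ < cmod _); apply/eqP; rewrite eq_complex /= addr0 !eqxx.
have b2 : (d / 2) ^+ 2 <= `|b| ^+ 2 by rewrite real_normK ?num_real //; nra.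
have bd : d / 2 <= `|b|.
  by move: b2; rewrite ler_pXn2r ?nnegrE //; lra.
have b0 : - b != 0 by rewrite oppr_eq0 -normr_gt0; lra.
have [g hg gb] := selfadjoint_resolvent a sy b0.
have tE : (a +i* b)%C^-1 = (a +i* - b)%C.
  by apply/eqP; rewrite eq_complex /= e !divr1 !eqxx.
exists ((a +i* b)%C^-1 *: g).
  have := is_invZ t0 hg; rewrite scalerBr scalerA -tE mulfV // scale1r.
  by [].
rewrite cnormZ -/(cmod _) ti mul1r; apply: le_trans gb _; rewrite normrN.
have : 2 / `|b| <= 4 / d.
  rewrite ler_pdivrMr; last lra.
  by rewrite mulrAC ler_pdivlMr //; lra.
lra.
Qed.

Lemma cnorm_selfadjoint_sq y : star y = y -> N (y * y) = N y ^+ 2.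
Proof. by move=> sy; rewrite -cnorm_starM sy. Qed.

(** Suppose that x = y / ||y|| is such that 1 - t x is invertible for |t| <= 1. By
    circle_bound the resolvents of x at t and s t are close, uniformly on the
    circle, for some s < 1. Squaring k times, so are those of x^(2^k) at 1 and at
    s^(2^k). The latter tends to 1, so that 1 - x^(2^k) has an inverse near 1 and
    x^(2^k) has norm less than 1. But its norm is 1 by the C*-identity. *)
Lemma selfadjoint_spectral_radius y (r : R) : star y = y -> 0 <= r ->
  (forall t, spectrum y t -> cmod t <= r) -> N y <= r.
Proof.
move=> sy r0 sp; rewrite leNgt; apply/negP => ry.
have y0 : 0 < N y by exact: le_lt_trans ry.
pose x := ((N y)^-1)%:C%C *: y.
have xy : (N y)%:C%C *: x = y.
  by rewrite scalerA -rmorphM /= mulfV ?gt_eqF // scale1r.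
have Nx : N x = 1 by rewrite cnormZr ?invr_ge0 ?ltW // mulVf ?gt_eqF.
have sx : star x = x by rewrite starZ sy conj_real.
have ex t : cmod t = 1 -> exists g, is_inv (1 - t *: x) g.
  move=> t1; have t0 : t != 0 by rewrite -cmod_eq0 t1 oner_eq0.
  pose c : R[i] := (N y)%:C%C / t.
  have c0 : c != 0.
    by rewrite -cmod_eq0 cmodM cmodV t1 invr1 mulr1 cmodr ?ltW // gt_eqF.
  have : ~ spectrum y c.
    by move=> /sp; rewrite cmodM cmodV t1 invr1 mulr1 (cmodr (ltW y0)) leNgt ry.
  rewrite /spectrum /= => /contrapT/invertible_inv[g hg].
  exists (c^-1^-1 *: g).
  have -> : 1 - t *: x = c^-1 *: (c%:A - y).
    rewrite [RHS]scalerBr [c^-1 *: (_ *: 1)]scalerA mulVf // scale1r -[in RHS]xy [X in _ = _ - X]scalerA; congr (_ - _ *: _).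
    by rewrite /c invfM invrK mulrAC mulVf ?mul1r // -cmod_eq0 cmodr ?gt_eqF // ltW.
  by apply: is_invZ hg; rewrite invr_eq0.
have [K K0 hK] := circle_bound sx ex.
(* 1 - s is so small that the resolvents at t and s t differ by at most 1/4 *)
pose s : R := 1 - (2 * K + 8 * K * K + 1)^-1.
pose d := (2 * K + 8 * K * K + 1)^-1.
have Dp : 1 < 2 * K + 8 * K * K + 1 by nra.
have d0 : 0 < d by rewrite invr_gt0; lra.
have d1 : d < 1 by rewrite invf_lt1; lra.
have dK : d * (2 * K + 8 * K * K) <= 1.
  by rewrite /d mulrC ler_pdivrMr; lra.
have P0 : close_resolvents x s.
  move=> t t1; have [g hg gK] := hK t t1; have g0 := cnorm_ge0 g.
  have nd : N (- ((d%:C%C * t) *: x)) <= d.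
    by rewrite cnormN cnormZ -/(cmod _) cmodM t1 (cmodr (ltW d0)) mulr1 Nx mulr1.
  have [|h hh hb] := @inv_near _ (- ((d%:C%C * t) *: x)) g hg.
    apply: le_trans (ler_pM _ _ nd gK) _ => //; first exact: cnorm_ge0.
    nra.
  have hh' : is_inv (1 - (s%:C%C * t) *: x) h.
    rewrite (_ : 1 - _ = 1 - t *: x - - ((d%:C%C * t) *: x)) // opprK -addrA.
    congr (_ + _); apply: oppr_inj; rewrite opprD !opprK -scalerBl; congr (_ *: _).
    rewrite /s rmorphB /= rmorph1 -/d; ring.
  exists g, h; split => //.
  have -> : g - h = g * (- ((d%:C%C * t) *: x)) * h * -1.
    have [hg1 hg2] := hg; have [hh1 hh2] := hh.
    set w := - ((d%:C%C * t) *: x) in hh1 hh2 *.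
    rewrite (_ : g * w * h = g * ((1 - t *: x) - (1 - t *: x - w)) * h); last first.
      by rewrite opprB addrCA subrr addr0.
    by rewrite mulrBr hg2 mulrBl mul1r -mulrA hh1 mulr1 mulrN1 opprB.
  rewrite mulrN1 cnormN; apply: le_trans (cnormM _ _) _.
  apply: (@le_trans _ _ (K * d * (2 * K))).
    apply: ler_pM; rewrite ?cnorm_ge0 //; last by apply: le_trans hb _; lra.
    by apply: le_trans (cnormM _ _) _; apply: ler_pM; rewrite ?cnorm_ge0.
  nra.
have s0 : 0 <= s by rewrite /s -/d; lra.
have s1 : s < 1 by rewrite /s -/d; lra.
have iter k : exists z, [/\ star z = z, N z = 1 & close_resolvents z (s ^+ (2 ^ k))].
  elim: k => [|k [z [sz nz Pz]]]; first by exists x; rewrite expn0 expr1.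
  exists (z * z); split; first by rewrite starM sz.
    by rewrite cnorm_selfadjoint_sq // nz expr1n.
  by rewrite expnS mulnC exprM; exact: close_resolvents_sq.
have e8 : 0 < 8^-1 :> R by rewrite invr_gt0.
have s1' : `|s| < 1 by rewrite ger0_norm.
have [M hM] := cvg0_small e8 (cvg_expr s1').
have {}hM := hM (2 ^ M)%N (ltnW (ltn_expl M (ltnSn 1))).
have {}hM : s ^+ (2 ^ M) < 8^-1.
  exact: le_lt_trans (ler_norm _) hM.
have [z [sz nz Pz]] := iter M.
have [g [h [[g1 g2] [h1 h2] gh]]] := Pz 1 (cmod1 R).
rewrite scale1r in g1 g2; rewrite mulr1 in h1 h2.
set c := s ^+ _ in hM h1 h2; have c0 : 0 <= c by rewrite exprn_ge0.
have hE : h - 1 = c%:C%C *: z * h.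
  by rewrite -h1 mulrBl mul1r opprB addrCA subrr addr0.
have b1 : N (h - 1) <= 8^-1 * N h.
  rewrite hE; apply: le_trans (cnormM _ _) _; rewrite cnormZr // nz mulr1.
  by rewrite ler_wpM2r ?cnorm_ge0 // ltW.
have b2 := cnormD (h - 1) 1; rewrite subrK cnorm1 in b2.
have b3 := cnormD (g - h) (h - 1); rewrite addrA subrK in b3.
(* the identity below gives ||z|| <= 2 ||g - 1|| < 1 *)
have zE : z = (g - 1) - z * (g - 1).
  have gE : g - 1 = z * g by rewrite -g1 mulrBl mul1r opprB addrCA subrr addr0.
  by rewrite {1}gE mulrBr mulr1 opprB addrCA subrr addr0.
have b4 := cnormB (g - 1) (z * (g - 1)); rewrite -zE nz in b4.
have b5 := cnormM z (g - 1); rewrite nz in b5.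
clear -gh b1 b2 b3 b4 b5; lra.
Qed.

(** The spectrum of r - x lies in [0, r], and its norm is its spectral radius. *)
Lemma positive_norm_le x (r : R) : positive x -> N x <= r -> N ((r%:C%C)%:A - x) <= r.
Proof.
move=> [sx px] xr; have r0 := le_trans (cnorm_ge0 _) xr.
apply: selfadjoint_spectral_radius => //; first by rewrite starB star_alg conj_real sx.
move=> t ht.
have ht' : spectrum x (r%:C%C - t).
  move=> [g hg]; apply: ht; exists (- g).
  have -> : t%:A - ((r%:C%C)%:A - x) = - ((r%:C%C - t)%:A - x).
    by rewrite scalerBl !opprB addrCA.
  by have := is_invN hg.
have := px _ ht'; have := spectrum_le ht'.
case: t {ht ht'} => a b /= h1; rewrite lecE /= add0r oppr_eq0 => /andP[/eqP b0 ra].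
move: h1; rewrite b0.
have -> : (r%:C - a +i* 0 = (r - a)%:C)%C.
  by apply/eqP; rewrite eq_complex /= oppr0 addr0 !eqxx.
rewrite cmodr // => h.
have a0 : 0 <= a by lra.
by rewrite cmodr //; lra.
Qed.

(** The spectrum of x is real and lies in the disc of center r and radius r. *)
Lemma norm_le_positive x (r : R) : star x = x -> N ((r%:C%C)%:A - x) <= r -> positive x.
Proof.
move=> sx h; split => // t ht.
have ht' : spectrum ((r%:C%C)%:A - x) (r%:C%C - t).
  move=> [g hg]; apply: ht; exists (- g).
  have -> : t%:A - x = - ((r%:C%C - t)%:A - ((r%:C%C)%:A - x)).
    by rewrite scalerBl !opprB [RHS]addrC addrA subrK.
  by have := is_invN hg.
have b0 := selfadjoint_spectrum_real sx ht.
have := le_trans (spectrum_le ht') h.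
case: t b0 {ht ht'} => a b /= ->.
have -> : (r%:C - a +i* 0 = (r - a) +i* 0)%C.
  by apply/eqP; rewrite eq_complex /= oppr0 addr0 !eqxx.
move=> h1; have r0 := le_trans (cmod_ge0 _) h1.
have : cmod ((r - a) +i* 0)%C ^+ 2 <= r ^+ 2 by rewrite ler_pXn2r ?nnegrE ?cmod_ge0.
rewrite cmod_sq expr0n /= addr0 => h2.
have : `|r - a| <= `|r| by rewrite -ler_sqr ?nnegrE // !real_normK ?num_real.
rewrite lecE /= eqxx (ger0_norm r0) ler_norml => /andP[]; lra.
Qed.

(** In the form ||r - x|| <= r, positivity is compatible with the triangle
    inequality. *)
Lemma positiveD x y : positive x -> positive y -> positive (x + y).
Proof.
move=> px py; apply: (@norm_le_positive _ (N x + N y)).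
  by rewrite starD (proj1 px) (proj1 py).
rewrite rmorphD /= scalerDl opprD addrACA; apply: le_trans (cnormD _ _) _.
by apply: lerD; exact: positive_norm_le.
Qed.

Lemma positiveZ (c : R) x : 0 <= c -> positive x -> positive (c%:C%C *: x).
Proof.
move=> c0 px; apply: (@norm_le_positive _ (c * N x)).
  by rewrite starZ conj_real (proj1 px).
rewrite rmorphM /= -scalerA -scalerBr cnormZr // ler_wpM2l //.
exact: positive_norm_le.
Qed.

Lemma positive0 : positive (0 : B).
Proof. by apply: (@norm_le_positive _ 0); rewrite ?star0 // subr0 scale0r cnorm0. Qed.

Lemma positive_sum I (r : seq I) (P : pred I) (F : I -> B) :
  (forall i, P i -> positive (F i)) -> positive (\sum_(i <- r | P i) F i).
Proof.
by move=> h; elim/big_rec: _ => [|i x Pi px]; [exact: positive0|exact: positiveD (h _ Pi) px].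
Qed.

(** For C bounding the norms, ||C - u n|| <= C is preserved by norm limits. *)
Lemma positive_lim (u : nat -> B) x : (forall n, positive (u n)) ->
  norm_cvg_to u x -> positive x.
Proof.
move=> pu ux; have [C hC] := norm_cvg_bounded ux.
apply: (@norm_le_positive _ C).
  apply: (norm_cvg_unique _ ux).
  apply: norm_cvg_le ux => n; rewrite -{1}(proj1 (pu n)) -starB cnorm_star.
  exact: lexx.
rewrite -subr_le0.
apply: (@le_lim0 _ _ (fun n => N (u n - x))) => // n.
have h := positive_norm_le (pu n) (hC n).
have := cnormD ((C%:C%C)%:A - u n) (u n - x); rewrite addrA subrK; lra.
Qed.

End Spectral.

(** * Closed walks with doubled edges *)

Section Walks.
Variable V : finType.
Implicit Types (x y : V) (p : seq V) (W : {set V}) (E : {set {set V}}).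
Local Open Scope nat_scope.

Fixpoint edges x p : seq {set V} :=
  if p is y :: p' then [set x; y]%SET :: edges y p' else [::].

Lemma size_edges x p : size (edges x p) = size p.
Proof. by elim: p x => //= y p IH x; rewrite IH. Qed.

Lemma edges_cat x p q : edges x (p ++ q) = edges x p ++ edges (last x p) q.
Proof. by elim: p x => //= y p IH x; rewrite IH. Qed.

Lemma edges_sub x p e : e \in edges x p -> forall y, y \in e -> y \in x :: p.
Proof.
elim: p x => //= z p IH x; rewrite inE => /predU1P[->|/IH h] y.
  by rewrite finset.in_set2 !inE => /orP[]->; rewrite ?orbT.
by move/h; rewrite !inE => /orP[]->; rewrite ?orbT.
Qed.

Lemma edge_nonempty x p e : e \in edges x p -> exists y, y \in e.
Proof.
elim: p x => //= z p IH x; rewrite inE => /predU1P[->|/IH //].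
by exists x; rewrite finset.in_set2 eqxx.
Qed.

Definition sset (T : finType) (s : seq T) : {set T} := [set y in s]%SET.

Lemma in_sset (T : finType) (s : seq T) (y : T) : (y \in sset s) = (y \in s).
Proof. by rewrite finset.in_set. Qed.
(* unification would otherwise match arbitrary sets with sset *)
Opaque sset.

Lemma sset_nil (T : finType) : sset [::] = finset.set0 :> {set T}.
Proof. by apply/finset.setP => y; rewrite in_sset inE. Qed.

Lemma sset_cons (T : finType) (a : T) (s : seq T) : sset (a :: s) = (a |: sset s)%SET.
Proof. by apply/finset.setP => y; rewrite finset.in_setU1 !in_sset inE. Qed.

Lemma sset_cat (T : finType) (s t : seq T) : sset (s ++ t) = (sset s :|: sset t)%SET.
Proof. by apply/finset.setP => y; rewrite finset.in_setU !in_sset mem_cat. Qed.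

Lemma eq_sset (T : finType) (s t : seq T) : s =i t -> sset s = sset t.
Proof. by move=> h; apply/finset.setP => y; rewrite !in_sset h. Qed.

(** A step to a vertex outside W uses an edge outside E, as the endpoints of the
    edges in E belong to W. *)
Lemma walk_card W E x p : x \in W -> (forall e, e \in E -> e \subset W) ->
  #|sset p :|: W|%SET + #|E| <= #|W| + #|sset (edges x p) :|: E|%SET.
Proof.
elim: p x W E => [|y p IH] x W E xW EW.
  by rewrite /= !sset_nil !finset.set0U.
have := IH y (y |: W)%SET ([set x; y] |: E)%SET.
rewrite finset.setU11 => /(_ isT) h.
have {h} : #|sset p :|: (y |: W)|%SET + #|[set x; y] |: E|%SET <=
           #|y |: W|%SET + #|sset (edges y p) :|: ([set x; y] |: E)|%SET.
  apply: h => e; rewrite finset.in_setU1 => /predU1P[->|/EW h].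
    apply/fintype.subsetP => z; rewrite finset.in_set2 finset.in_setU1.
    by case/orP => /eqP->; rewrite ?xW ?eqxx ?orbT.
  exact: fintype.subset_trans h (finset.subsetUr _ _).
rewrite /= !sset_cons !finset.setUA (finset.setUC _ [set y]%SET) (finset.setUC _ [set [set x; y]]%SET).
rewrite !cardsU1.
have : (y \notin W) <= ([set x; y]%SET \notin E).
  case: (boolP (y \in W)) => //= yW; case: (boolP (_ \in E)) => // /EW /fintype.subsetP /(_ y).
  by rewrite finset.set22 => /(_ isT); rewrite (negbTE yW).
have arith (b1 b2 : bool) (m n u v : nat) : b1 <= b2 -> m + (b2 + n) <= b1 + u + v -> m + n <= u + v.
  by case: b1; case: b2 => //= _; rewrite /nat_of_bool; lia.
exact: arith.
Qed.

Lemma sum_count_sset (T : finType) (s : seq T) :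
  \sum_(e in sset s) count_mem e s = size s.
Proof.
rewrite -sum1_size (eq_bigr (fun e => \sum_(x <- s) (x == e))); last first.
  by move=> e _; rewrite -sum1_count big_mkcond /=; apply: eq_bigr => x _; case: eqP.
rewrite exchange_big /= big_seq [RHS]big_seq; apply: eq_bigr => x xs.
rewrite (bigD1 x) ?in_sset //= eqxx big1 // => e /andP[_ /negbTE].
by rewrite eq_sym => ->.
Qed.

Lemma double_count (T : finType) (s : seq T) :
  (forall e, e \in s -> 2 <= count_mem e s) -> 2 * #|sset s| <= size s.
Proof.
move=> h; rewrite -sum_count_sset mulnC -sum_nat_const.
by apply: leq_sum => e; rewrite in_sset => /h.
Qed.

Lemma double_count_strict (T : finType) (s : seq T) e0 :
  (forall e, e \in s -> 2 <= count_mem e s) -> 3 <= count_mem e0 s ->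
  2 * #|sset s| < size s.
Proof.
move=> h h0; rewrite -sum_count_sset mulnC -sum_nat_const.
have e0s : e0 \in sset s by rewrite in_sset -has_pred1 has_count; lia.
rewrite (bigD1 e0) //= [ltnRHS](bigD1 e0) //= -addSn leq_add //.
by apply: leq_sum => e /andP[]; rewrite in_sset => /h.
Qed.

Lemma set2_eq (x y a b : V) : [set x; y]%SET = [set a; b]%SET ->
  (x = a /\ y = b) \/ (x = b /\ y = a).
Proof.
move=> h.
have := finset.set21 x y; have := finset.set22 x y; rewrite h !finset.in_set2.
have := finset.set21 a b; have := finset.set22 a b; rewrite -h !finset.in_set2.
do 4![case/orP => /eqP ?]; subst; auto.
Qed.

(** A closed walk may be started at any of its vertices. *)
Lemma rotate_walk i p x : last i p = i -> x \in i :: p ->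
  exists q, (x :: q =i i :: p) /\ (edges x q =i edges i p).
Proof.
move=> li; rewrite inE => /predU1P[->|]; first by exists p.
move=> xp; case/splitPr: xp li => p1 p2; rewrite last_cat /= => li.
exists (p2 ++ rcons p1 x); split=> [y|y].
  rewrite !inE !mem_cat mem_rcons !inE.
  have : i \in x :: p2 by rewrite -li mem_last.
  rewrite inE; case: (y =P i) => [->|_] //=; last first.
    by case: (y == x); case: (y \in p2); case: (y \in p1).
  by move=> /orP[]->; rewrite ?orbT.
rewrite (edges_cat x p2) li -cats1 !edges_cat /= !mem_cat !inE.
by case: (y \in edges i p1); case: (y \in edges x p2); rewrite ?orbT ?orbF.
Qed.

Lemma first_edge x p e : e \in edges x p -> exists p1 j p2,
  [/\ p = p1 ++ j :: p2, e = [set last x p1; j]%SET & e \notin edges x p1].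
Proof.
elim: p x => //= y p IH x; rewrite inE.
have [-> _|ne /= /IH[p1 [j [p2 [-> ee nn]]]]] := eqVneq e [set x; y]%SET.
  by exists [::], y, p.
by exists (y :: p1), j, p2; split=> //=; rewrite inE negb_or ne.
Qed.

(** Let m = size p + 1 be the length of the walk. Connectedness gives
    #V <= #E + 1 and doubling gives 2 #E <= m, so that 2 #V >= m + 2 forces
    equalities: every edge is used exactly twice, and the walk explores a tree. In
    each configuration to be excluded, either an edge is used three times, or the
    remaining steps still connect all the vertices without the edge {i0, i1},
    whence #V <= #E. *)
Lemma tight_walk i0 i1 p : last i1 p = i0 ->
  (forall e, e \in edges i0 (i1 :: p) -> 2 <= count_mem e (edges i0 (i1 :: p))) ->
  (size p).+3 <= 2 * #|sset (i1 :: p)| ->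
  exists p1 p2, [/\ p = p1 ++ i0 :: p2, last i1 p1 = i1,
    [set i0; i1]%SET \notin edges i1 p1, [set i0; i1]%SET \notin edges i0 p2 &
    forall e, e \in edges i1 p1 -> e \notin edges i0 p2].
Proof.
move=> lp dbl big; set e1 := [set i0; i1]%SET.
have szE : size (edges i0 (i1 :: p)) = (size p).+1 by rewrite size_edges.
have cE := double_count dbl; rewrite szE in cE.
have i0p : i0 \in i1 :: p by rewrite -lp mem_last.
have cV : #|sset (i1 :: p)| <= 1 + #|sset (edges i0 (i1 :: p))|.
  have := @walk_card [set i0]%SET finset.set0 i0 (i1 :: p).
  rewrite finset.set11 finset.cards1 cards0 addn0 finset.setU0.
  move=> /(_ isT) h; apply: leq_trans (h _); last by move=> e; rewrite finset.in_set0.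
  by apply/subset_leq_card/finset.subsetUl.
have e1p : e1 \in edges i1 p.
  have := dbl e1; rewrite /= mem_head eqxx => /(_ isT).
  by rewrite add1n ltnS -has_count has_pred1.
(* p1 stops just before the first return to the edge {i0, i1} *)
have [p1 [j [p2 [pE eE nU]]]] := first_edge e1p.
set U := edges i1 p1 in nU; set T := edges j p2.
have esE : edges i0 (i1 :: p) = e1 :: U ++ e1 :: T by rewrite pE /= edges_cat /= -eE.
have nT : e1 \notin T.
  apply/negP => eT; suff /double_count_strict : 3 <= count_mem e1 (edges i0 (i1 :: p)).
    by move=> /(_ dbl); rewrite szE; lia.
  move: eT; rewrite esE /= count_cat /= eqxx -has_pred1 has_count => eT.
  by rewrite !add1n addnS !ltnS; apply: leq_trans eT (leq_addl _ _).
have cUT : #|sset (U ++ T)| < #|sset (edges i0 (i1 :: p))|.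
  rewrite (_ : sset (edges i0 (i1 :: p)) = (e1 |: sset (U ++ T))%SET).
    by rewrite cardsU1 in_sset mem_cat negb_or nU nT.
  rewrite esE sset_cons !sset_cat sset_cons (finset.setUCA (sset U)) finset.setUA.
  by rewrite finset.setUid.
have ne01 : i0 != i1.
  apply/eqP => e01.
  have := @walk_card [set i1]%SET [set e1]%SET i1 p; rewrite finset.set11 !finset.cards1.
  move=> /(_ isT) h.
  have /h : forall e, e \in [set e1]%SET -> e \subset [set i1]%SET.
    by move=> e /finset.set1P->; rewrite /e1 e01 finset.setUid.
  have -> : (sset p :|: [set i1])%SET = sset (i1 :: p) by rewrite sset_cons finset.setUC.
  have -> : (sset (edges i1 p) :|: [set e1])%SET = sset (edges i0 (i1 :: p)).
    by rewrite [in RHS]/= sset_cons finset.setUC.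
  lia.
case: (set2_eq eE) => -[ij jj].
  (* the edge is traversed twice in the same direction *)
  exfalso.
  have h1 := @walk_card [set i1]%SET finset.set0 i1 p1.
  rewrite finset.set11 finset.cards1 cards0 addn0 finset.setU0 in h1.
  have /(h1 isT){}h1 : forall e : {set V}, e \in finset.set0 -> e \subset [set i1]%SET.
    by move=> e; rewrite finset.in_set0.
  have h2 := @walk_card (sset p1 :|: [set i1])%SET (sset U) i1 p2.
  rewrite finset.in_setU finset.set11 orbT -/U in h2.
  have /(h2 isT){}h2 : forall e, e \in sset U -> e \subset (sset p1 :|: [set i1])%SET.
    move=> e; rewrite in_sset => eU; apply/fintype.subsetP => z /(edges_sub eU).
    by rewrite finset.in_setU finset.in_set1 in_sset inE orbC.
  have i0p1 : i0 \in i1 :: p1 by rewrite ij mem_last.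
  have E1 : (sset p2 :|: (sset p1 :|: [set i1]))%SET = sset (i1 :: p).
    apply/finset.setP => z; rewrite !finset.in_setU finset.in_set1 !in_sset pE !inE !mem_cat inE -jj.
    by case: (z == i1); case: (z \in p1); case: (z \in p2).
  have E2 : (sset (edges i1 p2) :|: sset U)%SET = sset (U ++ T).
    by rewrite sset_cat finset.setUC /T -jj.
  rewrite E1 E2 in h2; rewrite -/U in h1.
  have arith a u v w e m : a <= 1 + u -> v + u <= a + w -> m.+2 < 2 * v -> w < e ->
    2 * e <= m.+1 -> False by lia.
  exact: arith h1 h2 big cUT cE.
rewrite -ij in T nT esE cUT pE *; exists p1, p2; split=> // e eU; apply/negP => eT.
exfalso; have [x xe] := edge_nonempty eU.
have [q [qV qE]] := rotate_walk (esym jj) (edges_sub eU xe).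
have h1 := @walk_card [set i0]%SET finset.set0 i0 p2.
rewrite finset.set11 finset.cards1 cards0 addn0 finset.setU0 in h1.
have /(h1 isT){}h1 : forall e : {set V}, e \in finset.set0 -> e \subset [set i0]%SET.
  by move=> e'; rewrite finset.in_set0.
have W2 : (sset p2 :|: [set i0])%SET = sset (i0 :: p2) by rewrite sset_cons finset.setUC.
have h2 := @walk_card (sset (i0 :: p2)) (sset T) x q.
rewrite in_sset (edges_sub eT xe) in h2.
have /(h2 isT){}h2 : forall e, e \in sset T -> e \subset sset (i0 :: p2).
  move=> e'; rewrite in_sset => e'T; apply/fintype.subsetP => z /(edges_sub e'T).
  by rewrite in_sset.
have E1 : (sset q :|: sset (i0 :: p2))%SET = sset (i1 :: p).
  have xi := edges_sub eT xe.
  apply/finset.setP => z; rewrite finset.in_setU !in_sset pE.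
  have := qV z; rewrite !inE !mem_cat !inE => zq.
  have -> : (z \in q) || ((z == i0) || (z \in p2)) =
            ((z == x) || (z \in q)) || ((z == i0) || (z \in p2)).
    case: (z =P x) => [->|] //=; move: xi; rewrite inE => ->; exact: orbT.
  rewrite zq; by case: (z == i1); case: (z \in p1).
have E2 : (sset (edges x q) :|: sset T)%SET = sset (U ++ T).
  by rewrite sset_cat (eq_sset qE).
rewrite W2 in h1; rewrite E1 E2 in h2.
rewrite -/T in h1.
have arith a u v w d m : a <= 1 + u -> v + u <= a + w -> m.+2 < 2 * v -> w < d ->
  2 * d <= m.+1 -> False by lia.
exact: arith h1 h2 big cUT cE.
Qed.

Fixpoint words (m : nat) : seq (seq V) :=
  if m is m'.+1 then [seq x :: p | x <- enum V, p <- words m'] else [:: [::]].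

Lemma size_words m p : p \in words m -> size p = m.
Proof.
elim: m p => [|m IH] p /=; first by rewrite inE => /eqP->.
by move=> /allpairsP[[x q] /= [_ /IH sq ->]] /=; rewrite sq.
Qed.

Lemma big_words (T : Type) (idx : T) (op : Monoid.com_law idx) m (F : seq V -> T) :
  \big[op/idx]_(p <- words m.+1) F p =
  \big[op/idx]_(x : V) \big[op/idx]_(p <- words m) F (x :: p).
Proof.
by rewrite /= big_allpairs_dep big_enum.
Qed.

Lemma big_words_cat (T : Type) (idx : T) (op : Monoid.com_law idx) m n (F : seq V -> T) :
  \big[op/idx]_(p <- words (m + n)) F p =
  \big[op/idx]_(p <- words m) \big[op/idx]_(q <- words n) F (p ++ q).
Proof.
elim: m F => [|m IH] F; first by rewrite big_seq1.
by rewrite addSn !big_words; apply: eq_bigr => x _; rewrite IH.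
Qed.

(** Induction on the length: the first letter is one of the at most m letters of
    the rest, or one of the #|V| letters that increase the number of distinct
    ones. *)
Lemma count_words m v : 0 < #|V| ->
  \sum_(p <- words m) (#|sset p| <= v)%N <= m`! * #|V| ^ v.
Proof.
move=> V0; elim: m v => [|m IH] v; first by rewrite big_seq1 sset_nil cards0 fact0 mul1n expn_gt0 V0.
rewrite big_words exchange_big /=.
have step p : p \in words m -> \sum_(x : V) (#|sset (x :: p)| <= v)%N <=
    m * (#|sset p| <= v)%N + (if v is v'.+1 then #|V| * (#|sset p| <= v')%N else 0).
  move=> /size_words sp.
  have -> : m * (#|sset p| <= v) + (if v is v'.+1 then #|V| * (#|sset p| <= v') else 0) =
     m * (#|sset p| <= v) + \sum_(x : V) (if v is v'.+1 then (#|sset p| <= v') : nat else 0).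
    by rewrite sum_nat_const; case: v; rewrite ?muln0.
  apply: (@leq_trans (\sum_(x : V) ((x \in p) * (#|sset p| <= v) + (if v is v'.+1 then (#|sset p| <= v') : nat else 0)))).
    apply: leq_sum => x _; rewrite sset_cons cardsU1 in_sset.
    case: (x \in p) => /=; first by rewrite add0n mul1n leq_addr.
    by rewrite add1n mul0n add0n; case: v.
  rewrite big_split /= leq_add2r -big_distrl /= leq_mul2r; apply/orP; right.
  rewrite -sp; apply: (leq_trans _ (card_size p)).
  by rewrite -sum1_card [leqRHS]big_mkcond /=; apply: leq_sum => x _; case: (x \in p).
rewrite big_seq; apply: (leq_trans (leq_sum _ step)); rewrite -big_seq big_split /=.
rewrite -big_distrr /= factS mulSn mulnDl addnC leq_add //.
  case: v {step} => [|v]; first by rewrite big1.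
  rewrite -big_distrr /= expnS mulnCA leq_mul2l; apply/orP; right; exact: IH.
by rewrite -mulnA leq_mul2l IH orbT.
Qed.
End Walks.

(** * Limits of probability spaces *)

Section Expectation.
Variables (R : realType) (B : cstarType R) (P : bprob B).
Local Notation E := (expect P).
Local Notation em := (emb P).

Lemma expect_embl b (x : P) : E (em b * x) = b * E x.
Proof. by have := expect_bimod b 1 x; rewrite rmorph1 !mulr1. Qed.

Lemma expect_embr b (x : P) : E (x * em b) = E x * b.
Proof. by have := expect_bimod 1 b x; rewrite rmorph1 !mul1r. Qed.

Lemma expect1 : E 1 = 1.
Proof. by rewrite -(rmorph1 em) expect_emb. Qed.

Lemma star_subalg1 (C : set P) : is_star_subalg C -> C 1.
Proof. by case=> h _ _ _; have := h 1; rewrite rmorph1. Qed.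

Lemma star_gen_subalg (G : set P) : is_star_subalg (star_gen G).
Proof.
split=> [b C [[h _ _ _] _]|x y hx hy C hC|x y hx hy C hC|x hx C hC]; first exact: h.
- by case: (hC) => -[_ hadd _ _] _; apply: hadd; [exact: hx|exact: hy].
- by case: (hC) => -[_ _ hmul _] _; apply: hmul; [exact: hx|exact: hy].
- by case: (hC) => -[_ _ _ hst] _; apply: hst; exact: hx.
Qed.

Lemma sub_star_gen (G : set P) x : G x -> star_gen G x.
Proof. by move=> Gx C [_]; apply. Qed.

End Expectation.

Section PolynomialStar.
Variables (R : realType) (B : cstarType R) (I : Type).

Fixpoint bpoly_star (p : @bpoly R B I) : @bpoly R B I :=
  match p with
  | PConst b => PConst I (star b)
  | PVar i => PVarStar B i
  | PVarStar i => PVar B i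
  | PAdd p q => PAdd (bpoly_star p) (bpoly_star q)
  | PMul p q => PMul (bpoly_star q) (bpoly_star p)
  end.

Lemma bpoly_eval_star (A : balg B) (x : I -> A) p :
  bpoly_eval x (bpoly_star p) = star (bpoly_eval x p).
Proof.
elim: p => [b|i|i|p IHp q IHq|p IHp q IHq] /=.
- exact: emb_star.
- by [].
- by rewrite starK.
- by rewrite IHp IHq starD.
- by rewrite IHp IHq starM.
Qed.

End PolynomialStar.

Section PolynomialSequences.
Variables (R : realType) (B : cstarType R) (A : nat -> bprob B) (I : Type).
Variable x : forall n, I -> A n.
Arguments x : clear implicits.

(** The random variables of the limit space. Sequences are compared at every n
    rather than up to null elements, so that identities between polynomials which
    hold along the sequence hold in the limit space. *)
Record polyseq := PolySeq {
  seq_of_poly :> forall n, A n;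
  seq_of_polyP : exists p, forall n, seq_of_poly n = bpoly_eval (x n) p }.

Implicit Types u v w : polyseq.

HB.instance Definition _ := gen_eqMixin polyseq.
HB.instance Definition _ := gen_choiceMixin polyseq.

Lemma polyseq_eq u v : (forall n, u n = v n) -> u = v.
Proof.
case: u v => [u up] [v vp] /= uv.
have e : u = v by apply: functional_extensionality_dep.
by case: _ / e vp => vp; congr PolySeq; exact: Prop_irrelevance.
Qed.

Lemma polyseq_const_subproof b : exists p, forall n, emb (A n) b = bpoly_eval (x n) p.
Proof. by exists (PConst I b). Qed.
Definition polyseq_const b := PolySeq (polyseq_const_subproof b).

Lemma polyseq_var_subproof i : exists p, forall n, x n i = bpoly_eval (x n) p.
Proof. by exists (PVar B i). Qed.
Definition polyseq_var i := PolySeq (polyseq_var_subproof i).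

Lemma polyseq_add_subproof u v :
  exists p, forall n, u n + v n = bpoly_eval (x n) p.
Proof.
have [p hp] := seq_of_polyP u; have [q hq] := seq_of_polyP v.
by exists (PAdd p q) => n; rewrite hp hq.
Qed.
Definition polyseq_add u v := PolySeq (polyseq_add_subproof u v).

Lemma polyseq_mul_subproof u v :
  exists p, forall n, u n * v n = bpoly_eval (x n) p.
Proof.
have [p hp] := seq_of_polyP u; have [q hq] := seq_of_polyP v.
by exists (PMul p q) => n; rewrite hp hq.
Qed.
Definition polyseq_mul u v := PolySeq (polyseq_mul_subproof u v).

Lemma polyseq_scale_subproof (c : R[i]) u :
  exists p, forall n, c *: u n = bpoly_eval (x n) p.
Proof.
have [p hp] := seq_of_polyP u; exists (PMul (PConst I (c%:A)) p) => n.
by rewrite hp /= linearZ /= rmorph1 -scalerAl mul1r.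
Qed.
Definition polyseq_scale c u := PolySeq (polyseq_scale_subproof c u).

Lemma polyseq_opp_subproof u : exists p, forall n, - u n = bpoly_eval (x n) p.
Proof.
have [p hp] := polyseq_scale_subproof (-1) u.
by exists p => n; rewrite -hp scaleN1r.
Qed.
Definition polyseq_opp u := PolySeq (polyseq_opp_subproof u).

Lemma polyseq_star_subproof u : exists p, forall n, star (u n) = bpoly_eval (x n) p.
Proof.
have [p hp] := seq_of_polyP u; exists (bpoly_star p) => n.
by rewrite bpoly_eval_star hp.
Qed.
Definition polyseq_star u := PolySeq (polyseq_star_subproof u).

Local Notation P0 := (polyseq_const 0).
Local Notation P1 := (polyseq_const 1).

Fact polyseq_addA : associative polyseq_add.
Proof. by move=> u v w; apply: polyseq_eq => n /=; rewrite addrA. Qed.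
Fact polyseq_addC : commutative polyseq_add.
Proof. by move=> u v; apply: polyseq_eq => n /=; rewrite addrC. Qed.
Fact polyseq_add0 : left_id P0 polyseq_add.
Proof. by move=> u; apply: polyseq_eq => n /=; rewrite rmorph0 add0r. Qed.
Fact polyseq_addN : left_inverse P0 polyseq_opp polyseq_add.
Proof. by move=> u; apply: polyseq_eq => n /=; rewrite rmorph0 addNr. Qed.

HB.instance Definition _ := GRing.isZmodule.Build polyseq
  polyseq_addA polyseq_addC polyseq_add0 polyseq_addN.

Fact polyseq_mulA : associative polyseq_mul.
Proof. by move=> u v w; apply: polyseq_eq => n /=; rewrite mulrA. Qed.
Fact polyseq_mul1 : left_id P1 polyseq_mul.
Proof. by move=> u; apply: polyseq_eq => n /=; rewrite rmorph1 mul1r. Qed.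
Fact polyseq_mulr1 : right_id P1 polyseq_mul.
Proof. by move=> u; apply: polyseq_eq => n /=; rewrite rmorph1 mulr1. Qed.
Fact polyseq_mulDl : left_distributive polyseq_mul polyseq_add.
Proof. by move=> u v w; apply: polyseq_eq => n /=; rewrite mulrDl. Qed.
Fact polyseq_mulDr : right_distributive polyseq_mul polyseq_add.
Proof. by move=> u v w; apply: polyseq_eq => n /=; rewrite mulrDr. Qed.
Fact polyseq_1_neq0 : P1 != P0.
Proof.
apply/eqP => /(congr1 (fun u => seq_of_poly u 0)) /= /eqP.
by rewrite rmorph1 rmorph0 oner_eq0.
Qed.

HB.instance Definition _ := GRing.Zmodule_isNzRing.Build polyseq
  polyseq_mulA polyseq_mul1 polyseq_mulr1 polyseq_mulDl polyseq_mulDr polyseq_1_neq0.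

Fact polyseq_scaleA c d u : polyseq_scale c (polyseq_scale d u) = polyseq_scale (c * d) u.
Proof. by apply: polyseq_eq => n /=; rewrite scalerA. Qed.
Fact polyseq_scale1 : left_id 1 polyseq_scale.
Proof. by move=> u; apply: polyseq_eq => n /=; rewrite scale1r. Qed.
Fact polyseq_scaleDr : right_distributive polyseq_scale +%R.
Proof. by move=> c u v; apply: polyseq_eq => n /=; rewrite scalerDr. Qed.
Fact polyseq_scaleDl u : {morph polyseq_scale^~ u : c d / c + d}.
Proof. by move=> c d; apply: polyseq_eq => n /=; rewrite scalerDl. Qed.

HB.instance Definition _ := GRing.Zmodule_isLmodule.Build R[i] polyseq
  polyseq_scaleA polyseq_scale1 polyseq_scaleDr polyseq_scaleDl.

Fact polyseq_scaleAl (c : R[i]) u v : c *: (u * v) = (c *: u) * v.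
Proof. by apply: polyseq_eq => n /=; rewrite scalerAl. Qed.
HB.instance Definition _ :=
  GRing.Lmodule_isLalgebra.Build R[i] polyseq polyseq_scaleAl.
Fact polyseq_scaleAr (c : R[i]) u v : c *: (u * v) = u * (c *: v).
Proof. by apply: polyseq_eq => n /=; rewrite scalerAr. Qed.
HB.instance Definition _ :=
  GRing.Lalgebra_isAlgebra.Build R[i] polyseq polyseq_scaleAr.

Fact polyseq_starK : involutive polyseq_star.
Proof. by move=> u; apply: polyseq_eq => n /=; rewrite starK. Qed.
Fact polyseq_starD u v : polyseq_star (u + v) = polyseq_star u + polyseq_star v.
Proof. by apply: polyseq_eq => n /=; rewrite starD. Qed.
Fact polyseq_starZ (c : R[i]) u : polyseq_star (c *: u) = Num.conj c *: polyseq_star u.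
Proof. by apply: polyseq_eq => n /=; rewrite starZ. Qed.
Fact polyseq_starM u v : polyseq_star (u * v) = polyseq_star v * polyseq_star u.
Proof. by apply: polyseq_eq => n /=; rewrite starM. Qed.

HB.instance Definition _ := Algebra_hasStar.Build R polyseq
  polyseq_starK polyseq_starD polyseq_starZ polyseq_starM.

Fact polyseq_const_linear : linear polyseq_const.
Proof. by move=> c u v; apply: polyseq_eq => n /=; rewrite linearP. Qed.
Fact polyseq_const_monoid : monoid_morphism polyseq_const.
Proof. by split=> // u v; apply: polyseq_eq => n /=; rewrite rmorphM. Qed.
HB.instance Definition _ :=
  GRing.isLinear.Build R[i] B polyseq *:%R polyseq_const polyseq_const_linear.
HB.instance Definition _ :=
  GRing.isMonoidMorphism.Build B polyseq polyseq_const polyseq_const_monoid.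
Fact polyseq_const_star b : polyseq_const (star b) = star (polyseq_const b).
Proof. by apply: polyseq_eq => n /=; rewrite emb_star. Qed.

Definition polyseq_balg : balg B := @BAlg R B polyseq polyseq_const polyseq_const_star.

Hypothesis cvg_x : forall p, norm_cvg (fun n => expect (A n) (bpoly_eval (x n) p)).

Definition lim_expect u : B :=
  xget 0 [set L | norm_cvg_to (fun n => expect (A n) (u n)) L].

Lemma lim_expect_cvg u : norm_cvg_to (fun n => expect (A n) (u n)) (lim_expect u).
Proof.
rewrite /lim_expect; case: xgetP => [y _ //|no].
have [p hp] := seq_of_polyP u; have [L hL] := cvg_x p.
by case: (no L); rewrite /= (_ : (fun n => _) = fun n => expect (A n) (bpoly_eval (x n) p)) //
  boolp.funeqE => n; rewrite hp.
Qed.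

Lemma lim_expectE u L : norm_cvg_to (fun n => expect (A n) (u n)) L -> lim_expect u = L.
Proof. exact: norm_cvg_unique (lim_expect_cvg u). Qed.

Fact lim_expect_linear : linear (lim_expect : polyseq -> B).
Proof.
move=> c u v; apply: lim_expectE.
rewrite (_ : (fun n => _) = fun n => c *: expect (A n) (u n) + expect (A n) (v n)).
  by apply: norm_cvgD; [apply: norm_cvgZ|]; exact: lim_expect_cvg.
by rewrite boolp.funeqE => n; rewrite linearP.
Qed.

HB.instance Definition _ :=
  GRing.isLinear.Build R[i] polyseq B *:%R lim_expect lim_expect_linear.

Fact lim_expect_bimod (b1 b2 : B) (u : polyseq_balg) :
  lim_expect (emb polyseq_balg b1 * u * emb polyseq_balg b2) = b1 * lim_expect u * b2.
Proof.
apply: lim_expectE.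
rewrite (_ : (fun n => _) = fun n => b1 * expect (A n) (u n) * b2).
  by apply: norm_cvgM2; exact: lim_expect_cvg.
by rewrite boolp.funeqE => n; rewrite /= expect_bimod.
Qed.

Fact lim_expect_emb (b : B) : lim_expect (emb polyseq_balg b) = b.
Proof.
apply: lim_expectE; rewrite (_ : (fun n => _) = fun=> b); first exact: norm_cvg_cst.
by rewrite boolp.funeqE => n; rewrite /= expect_emb.
Qed.

Fact lim_expect_pos (u : polyseq_balg) : positive (lim_expect (u * star u)).
Proof.
by apply: (positive_lim _ (lim_expect_cvg _)) => n /=; exact: expect_pos.
Qed.

Definition polyseq_bprob : bprob B :=
  @BProb R B polyseq_balg lim_expect lim_expect_bimod lim_expect_emb lim_expect_pos.

Lemma polyseq_eval p n :
  seq_of_poly (bpoly_eval (polyseq_var : I -> polyseq_balg) p) n = bpoly_eval (x n) p.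
Proof. by elim: p => //= p -> q ->. Qed.

(** The expectation of a sequence of polynomials is the norm limit of the
    expectations. It is positive because positive elements form a closed set. *)
Lemma limit_bprob : exists (Q : bprob B) (y : I -> Q),
  (forall p, norm_cvg_to (fun n => expect (A n) (bpoly_eval (x n) p))
     (expect Q (bpoly_eval y p))) /\
  (forall p q, (forall n, bpoly_eval (x n) p = bpoly_eval (x n) q) ->
     bpoly_eval y p = bpoly_eval y q).
Proof.
exists polyseq_bprob, (polyseq_var : I -> polyseq_balg); split=> [p|p q pq].
  rewrite (_ : (fun n => _) = fun n => expect (A n)
     (seq_of_poly (bpoly_eval (polyseq_var : I -> polyseq_balg) p) n)).
    exact: lim_expect_cvg.
  by rewrite boolp.funeqE => n; rewrite polyseq_eval.
by apply: polyseq_eq => n; rewrite !polyseq_eval.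
Qed.

End PolynomialSequences.

(** * Matrices and words *)

Section MatrixProbability.
Variables (R : realType) (B : cstarType R) (P : bprob B) (n : nat).

Fact mat_expect_linear : linear (mat_expect n (expect P)).
Proof.
move=> c M M'; rewrite /mat_expect scalerA mulrC -scalerA -scalerDr; congr (_ *: _).
by rewrite scaler_sumr -big_split; apply: eq_bigr => i _; rewrite !mxE linearP.
Qed.

HB.instance Definition _ := GRing.isLinear.Build R[i] (mat_balg P n) B *:%R
  (mat_expect n (expect P)) mat_expect_linear.

Lemma mat_embE (c : B) i j : (emb (mat_balg P n) c) i j = emb P c *+ (i == j).
Proof. by rewrite mxE. Qed.

Fact mat_expect_bimod (b1 b2 : B) (M : mat_balg P n) :
  mat_expect n (expect P) (emb (mat_balg P n) b1 * M * emb (mat_balg P n) b2) =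
  b1 * mat_expect n (expect P) M * b2.
Proof.
rewrite /mat_expect -scalerAr -scalerAl mulr_sumr mulr_suml; congr (_ *: _).
apply: eq_bigr => i _; rewrite -expect_bimod; congr (expect P _).
rewrite [LHS]mxE (bigD1 i) //= big1 ?addr0; last first.
  by move=> k /negbTE ki; rewrite mat_embE ki mulr0.
rewrite mat_embE eqxx mulr1n; congr (_ * _).
rewrite mxE (bigD1 i) //= big1 ?addr0; last first.
  by move=> k; rewrite eq_sym => /negbTE ki; rewrite mat_embE ki mul0r.
by rewrite mat_embE eqxx mulr1n.
Qed.

Lemma mean_cst (c : B) : n.+1%:R^-1 *: (\sum_(i < n.+1) c) = c.
Proof.
by rewrite sumr_const card_ord -[c *+ _]scaler_nat scalerA mulVf ?pnatr_eq0 // scale1r.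
Qed.

Fact mat_expect_emb (c : B) : mat_expect n (expect P) (emb (mat_balg P n) c) = c.
Proof.
rewrite /mat_expect -[RHS]mean_cst; congr (_ *: _); apply: eq_bigr => i _.
by rewrite mat_embE eqxx mulr1n expect_emb.
Qed.

Fact mat_expect_pos (M : mat_balg P n) : positive (mat_expect n (expect P) (M * star M)).
Proof.
rewrite /mat_expect invSn_real; apply: positiveZ; first by rewrite invr_ge0 ler0n.
apply: positive_sum => i _; rewrite mxE linear_sum; apply: positive_sum => k _.
rewrite (_ : (star M) k i = star (M i k)); first exact: expect_pos.
by rewrite [LHS]mxE.
Qed.

Definition mat_bprob : bprob B := @BProb R B (mat_balg P n) (mat_expect n (expect P))
  mat_expect_bimod mat_expect_emb mat_expect_pos.

End MatrixProbability.

Section Words.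
Variables (R : realType) (B : cstarType R) (S : eqType) (T : Type).
Local Notation bpolyT := (@bpoly R B T).
Local Notation letter := (bpolyT + S)%type.
Implicit Types (w : seq letter) (p : bpolyT).

Definition letter_eval (A : balg B) (Y : S -> A) (D : T -> A) (x : letter) : A :=
  match x with inl p => bpoly_eval D p | inr s => Y s end.

Definition word_val (A : balg B) (Y : S -> A) (D : T -> A) w : A :=
  \prod_(x <- w) letter_eval Y D x.

Fixpoint splits (s : S) w : seq (seq letter * seq letter) :=
  match w with
  | [::] => [::]
  | x :: w' =>
    (if x is inr s' then (if s' == s then [:: ([::], w')] else [::]) else [::]) ++
    [seq (x :: uv.1, uv.2) | uv <- splits s w']
  end.

Fixpoint lift_poly p : @bpoly R B (S + T) :=
  match p with
  | PConst c => PConst _ c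
  | PVar t => PVar B (inr t)
  | PVarStar t => PVarStar B (inr t)
  | PAdd p q => PAdd (lift_poly p) (lift_poly q)
  | PMul p q => PMul (lift_poly p) (lift_poly q)
  end.

Lemma lift_poly_eval (A : balg B) (Y : S -> A) (D : T -> A) p :
  bpoly_eval (sumfam Y D) (lift_poly p) = bpoly_eval D p.
Proof. by elim: p => //= p -> q ->. Qed.

Fixpoint word_poly w : @bpoly R B (S + T) :=
  match w with
  | [::] => PConst _ 1
  | x :: w' => PMul (match x with inl p => lift_poly p | inr s => PVar B (inl s) end)
                 (word_poly w')
  end.

Lemma word_poly_eval (A : balg B) (Y : S -> A) (D : T -> A) w :
  bpoly_eval (sumfam Y D) (word_poly w) = word_val Y D w.
Proof.
rewrite /word_val; elim: w => [|x w IH] /=; first by rewrite big_nil rmorph1.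
by rewrite big_cons IH; case: x => [p|s] //=; rewrite lift_poly_eval.
Qed.

Fixpoint poly_words (q : @bpoly R B (S + T)) : seq (seq letter) :=
  match q with
  | PConst c => [:: [:: inl (PConst T c)]]
  | PVar (inl s) | PVarStar (inl s) => [:: [:: inr s]]
  | PVar (inr t) => [:: [:: inl (PVar B t)]]
  | PVarStar (inr t) => [:: [:: inl (PVarStar B t)]]
  | PAdd q q' => poly_words q ++ poly_words q'
  | PMul q q' => [seq u ++ v | u <- poly_words q, v <- poly_words q']
  end.

Lemma word_val_cat (A : balg B) (Y : S -> A) (D : T -> A) u v :
  word_val Y D (u ++ v) = word_val Y D u * word_val Y D v.
Proof. by rewrite /word_val big_cat. Qed.

Lemma poly_words_eval (A : balg B) (Y : S -> A) (D : T -> A) q :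
  (forall s, star (Y s) = Y s) ->
  bpoly_eval (sumfam Y D) q = \sum_(w <- poly_words q) word_val Y D w.
Proof.
move=> sY; elim: q => [c|[s|t]|[s|t]|q IH q' IH'|q IH q' IH'] /=;
  rewrite ?big_seq1 /word_val ?big_seq1 //=.
  by rewrite big_cat IH IH'.
rewrite IH IH' mulr_suml big_allpairs_dep; apply: eq_bigr => u _.
by rewrite mulr_sumr; apply: eq_bigr => v _; rewrite -word_val_cat.
Qed.

(** The word p_0 Y_{s_1} p_1 ... Y_{s_m} p_m is encoded by p_0 and the list of
    the pairs (s_k, p_k). *)
Fixpoint normal_form w : bpolyT * seq (S * bpolyT) :=
  match w with
  | [::] => (PConst T 1, [::])
  | inl p :: w' => (PMul p (normal_form w').1, (normal_form w').2)
  | inr s :: w' => (PConst T 1, (s, (normal_form w').1) :: (normal_form w').2)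
  end.

Lemma splits_normal_form (V : zmodType) s w x0
    (G : bpolyT * seq (S * bpolyT) -> bpolyT * seq (S * bpolyT) -> V) :
  \sum_(uv <- splits s w) G (normal_form uv.1) (normal_form uv.2) =
  \sum_(k < size (normal_form w).2) if (nth x0 (normal_form w).2 k).1 == s then
     G ((normal_form w).1, take k (normal_form w).2)
       ((nth x0 (normal_form w).2 k).2, drop k.+1 (normal_form w).2) else 0.
Proof.
elim: w G => [|x w IH] G /=; first by rewrite big_nil big_ord0.
rewrite big_cat big_map; case: x => [p|s'] /=.
  by rewrite big_nil add0r (IH (fun x y => G (PMul p x.1, x.2) y)).
rewrite big_ord_recl /= drop0; congr (_ + _).
  by case: eqP => _; rewrite ?big_seq1 ?big_nil //=; case: (normal_form w).
by rewrite (IH (fun x y => G (PConst T 1, (s', x.1) :: x.2) y)).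
Qed.

End Words.

(** * Conditional independence along a walk *)

Section Walk.
Variables (R : realType) (B : cstarType R) (P : bprob B) (S : eqType) (n : nat).
Local Notation E := (expect P).
Local Notation em := (emb P).
Local Notation V := 'I_n.+1.
Variable a : S -> V -> V -> P.
Variable eta : S -> {linear B -> B}.
Implicit Types (i j : V) (p : seq V) (l : seq (S * (V -> B))) (d : V -> B).

Fixpoint walk_term i l p : P :=
  match l, p with
  | x :: l', j :: p' => a x.1 i j * em (x.2 j) * walk_term j l' p'
  | _, _ => 1
  end.

Lemma walk_term_cat i l1 l2 p1 p2 : size p1 = size l1 ->
  walk_term i (l1 ++ l2) (p1 ++ p2) =
  walk_term i l1 p1 * walk_term (last i p1) l2 p2.
Proof.
elim: l1 i p1 => [|x l1 IH] i [|j p1] //=; first by rewrite mul1r.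
by move=> [sz]; rewrite IH // !mulrA.
Qed.

Definition ledges i l p : seq (S * {set V}) := zip (unzip1 l) (edges i p).

Lemma ledges_cat i l1 l2 p1 p2 : size p1 = size l1 ->
  ledges i (l1 ++ l2) (p1 ++ p2) = ledges i l1 p1 ++ ledges (last i p1) l2 p2.
Proof.
by move=> sz; rewrite /ledges edges_cat /unzip1 map_cat zip_cat // size_map size_edges.
Qed.

Lemma unzip2_ledges i l p : size p = size l -> unzip2 (ledges i l p) = edges i p.
Proof. by move=> sz; rewrite unzip2_zip // size_map size_edges sz. Qed.

Hypothesis a_star : forall s i j, a s i j = star (a s j i).
Hypothesis a_mean : forall s i j, E (a s i j) = 0.
Hypothesis a_var : forall s i j x,
  E (a s i j * em x * a s j i) = n.+1%:R^-1 *: eta s x.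
Hypothesis a_indep : cond_indep_rv E
  (fun k : S * {ij : V * V | (ij.1 <= ij.2)%N} => a k.1 (val k.2).1 (val k.2).2).

Definition entry_alg (Q : S -> {set V} -> Prop) : set P := star_gen
  (\bigcup_(k in [set k : S * {ij : V * V | (ij.1 <= ij.2)%N} |
        Q k.1 [set (val k.2).1; (val k.2).2]%SET])
    star_gen [set a k.1 (val k.2).1 (val k.2).2]).

Lemma entry_alg_emb Q b : entry_alg Q (em b).
Proof. exact: (star_subalg_emb (star_gen_subalg _)). Qed.

Lemma entry_alg1 Q : entry_alg Q 1.
Proof. exact: star_subalg1 (star_gen_subalg _). Qed.

Lemma entry_algM Q x y : entry_alg Q x -> entry_alg Q y -> entry_alg Q (x * y).
Proof. exact: (star_subalg_mul (star_gen_subalg _)). Qed.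

Lemma entry_alg_entry (Q : S -> {set V} -> Prop) s i j : Q s [set i; j]%SET -> entry_alg Q (a s i j).
Proof.
wlog ij : i j / (i <= j)%N => [W Qs|Qs].
  have [ij|/ltnW ji] := leqP i j; first exact: W.
  rewrite a_star; apply: (star_subalg_star (star_gen_subalg _)).
  by apply: W => //; rewrite finset.setUC.
apply: sub_star_gen; exists (s, exist _ (i, j) ij) => //.
exact: sub_star_gen.
Qed.

Lemma entry_alg_walk Q i l p : size p = size l ->
  (forall x, x \in ledges i l p -> Q x.1 x.2) -> entry_alg Q (walk_term i l p).
Proof.
elim: l i p => [|x l IH] i [|j p] //=; first by move=> _ _; exact: entry_alg1.
move=> [sz] h; apply: entry_algM; last first.
  by apply: IH => // y yl; apply: h; rewrite inE yl orbT.
apply: entry_algM; last exact: entry_alg_emb.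
by apply: entry_alg_entry; apply: (h (_, _)); rewrite mem_head.
Qed.

Lemma cond_expect (Q1 Q2 : S -> {set V} -> Prop) x y z :
  (forall s e, Q1 s e -> Q2 s e -> False) ->
  entry_alg Q1 x -> entry_alg Q2 y -> entry_alg Q1 z -> E (x * y * z) = E (x * em (E y) * z).
Proof.
move=> h gx gy gz; apply: a_indep gx gy gz.
by rewrite -subset0 => k [/= /h].
Qed.

Lemma ledges_split x i l p : size p = size l -> x \in ledges i l p ->
  exists l1 d l2 p1 j p2, [/\ l = l1 ++ (x.1, d) :: l2, p = p1 ++ j :: p2,
    size p1 = size l1 & x.2 = [set last i p1; j]%SET].
Proof.
elim: l i p => [|y l IH] i [|j p] //= [sz]; rewrite inE => /predU1P[->|].
  by exists [::], y.2, l, [::], j, p; case: y.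
move=> /(IH _ _ sz)[l1 [d [l2 [p1 [k [p2 [-> -> s1 e]]]]]]].
by exists (y :: l1), d, l2, (j :: p1), k, p2; rewrite /= s1.
Qed.

(** Condition on all the other entries: the one at this edge has mean 0. *)
Lemma single_edge i l p x : size p = size l ->
  count_mem x (ledges i l p) = 1 -> E (walk_term i l p) = 0.
Proof.
move=> sz c1; have xl : x \in ledges i l p by rewrite -has_pred1 has_count c1.
have [l1 [d [l2 [p1 [j [p2 [lE pE s1 e]]]]]]] := ledges_split sz xl.
have s2 : size p2 = size l2.
  by move: sz; rewrite lE pE !size_cat s1 => /addnI[].
move: c1; rewrite lE pE ledges_cat // count_cat /= -e -surjective_pairing eqxx => c1.
have {}c1 : count_mem x (ledges i l1 p1) = 0 /\ count_mem x (ledges j l2 p2) = 0.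
  have arith (u v : nat) : (u + (true + v))%N = 1 -> u = 0 /\ v = 0.
    by rewrite /nat_of_bool; lia.
  exact: arith c1.
rewrite walk_term_cat //= mulrA.
rewrite (@cond_expect (fun s f => (s, f) <> x) (fun s f => (s, f) = x)) //.
- by rewrite expect_embr a_mean mul0r rmorph0 mulr0 mul0r linear0.
- apply: entry_alg_walk => // y yl; rewrite -surjective_pairing => yx.
  by case: c1 => /count_memPn + _; rewrite -yx yl.
- apply: entry_algM; last exact: entry_alg_emb.
  by apply: entry_alg_entry; rewrite -e -surjective_pairing.
- apply: entry_alg_walk => // y yl; rewrite -surjective_pairing => yx.
  by case: c1 => _ /count_memPn; rewrite -yx yl.
Qed.

(** The contribution of the closed walk i0, i1, p when its first step is retraced
    by the step number k of p, everything in between being independent of the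
    rest. *)
Definition pairing_term i0 i1 s1 d1 l p k : B :=
  let x := nth (s1, d1) l k in
  if [&& x.1 == s1, last i1 (take k p) == i1 & nth i0 p k == i0] then
    n.+1%:R^-1 *: (eta s1 (d1 i1 * E (walk_term i1 (take k l) (take k p))) *
      (x.2 i0 * E (walk_term i0 (drop k.+1 l) (drop k.+1 p))))
  else 0.

Lemma split_nth (T : Type) (x0 : T) (s : seq T) k : (k < size s)%N ->
  s = take k s ++ nth x0 s k :: drop k.+1 s.
Proof. by move=> ks; rewrite -drop_nth // cat_take_drop. Qed.

Lemma ledges_pairing i0 i1 s1 d1 l p k : (k < size l)%N -> size p = size l ->
  let x := nth (s1, d1) l k in
  x.1 = s1 -> last i1 (take k p) = i1 -> nth i0 p k = i0 ->
  ledges i0 ((s1, d1) :: l) (i1 :: p) =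
    (s1, [set i0; i1]%SET) :: ledges i1 (take k l) (take k p) ++
    (s1, [set i0; i1]%SET) :: ledges i0 (drop k.+1 l) (drop k.+1 p).
Proof.
move=> kl sz x xs la ni; rewrite [LHS]/=; congr cons.
have kp : (k < size p)%N by rewrite sz.
rewrite -[LHS]/(ledges i1 l p) {1}(split_nth (s1, d1) kl) -/x.
rewrite {1}(split_nth i0 kp) ni ledges_cat; last first.
  by rewrite !size_take sz.
by rewrite la /ledges /= xs (finset.setUC [set i1]%SET).
Qed.

(** If some edge is used only once, then both sides vanish. Otherwise tight_walk
    applies: a single k gives a nonzero pairing term, and the expectation is
    computed by conditioning first on the closed walk from i1 under the pair, then
    on the two entries of the pair. *)
Lemma tight_expect i0 i1 s1 d1 l p : size p = size l -> last i1 p = i0 ->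
  ((size l).+3 <= 2 * #|sset (i1 :: p)|)%N ->
  E (walk_term i0 ((s1, d1) :: l) (i1 :: p)) =
  \sum_(k < size l) pairing_term i0 i1 s1 d1 l p k.
Proof.
move=> sz lp big; set le := ledges i0 ((s1, d1) :: l) (i1 :: p).
have [dbl|/existsNP[x /not_implyP[xle c1]]] :=
    pselect (forall x, x \in le -> (2 <= count_mem x le)%N); last first.
  have {}c1 : count_mem x le = 1.
    by move: xle c1; rewrite -has_pred1 has_count; lia.
  rewrite (@single_edge _ _ _ x) ?big1 //=; last by rewrite sz.
  move=> k _; rewrite /pairing_term; case: ifP => // /and3P[/eqP xs /eqP la /eqP ni].
  move: c1; rewrite /le (ledges_pairing _ _ xs la ni) //= count_cat /=.
  case: eqP => /= [ex|_]; first by rewrite /nat_of_bool; lia.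
  rewrite !add0n => c1.
  have arith (u v : nat) : (u + v)%N = 1 -> u = 1 \/ v = 1 by lia.
  have sz1 : size (take k p) = size (take k l) by rewrite !size_take sz.
  have sz2 : size (drop k.+1 p) = size (drop k.+1 l) by rewrite !size_drop sz.
  have [c2|c2] : count_mem x (ledges i1 (take k l) (take k p)) = 1 \/
         count_mem x (ledges i0 (drop k.+1 l) (drop k.+1 p)) = 1 by exact: arith c1.
    by rewrite (single_edge sz1 c2) mulr0 linear0 mul0r scaler0.
  by rewrite (single_edge sz2 c2) !mulr0 scaler0.
have [||p1 [p2 [pE lp1 nU nT dis]]] := @tight_walk _ i0 i1 p lp.
- move=> e; have <- : unzip2 le = edges i0 (i1 :: p) by rewrite unzip2_ledges //= sz.
  move=> /mapP[x xle ->]; apply: leq_trans (dbl _ xle) _.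
  rewrite /unzip2 count_map; apply: sub_count => y /= /eqP->; exact: eqxx.
- by rewrite sz.
set e1 := [set i0; i1]%SET in nU nT.
have kl : (size p1 < size l)%N by rewrite -sz pE size_cat /= addnS ltnS leq_addr.
set k0 := Ordinal kl; set x := nth (s1, d1) l k0.
have lE := split_nth (s1, d1) kl; rewrite -/x in lE.
set l1 := take _ l in lE; set l2 := drop _ l in lE.
have sz1 : size p1 = size l1 by rewrite size_take kl.
have sz2 : size p2 = size l2 by move: sz; rewrite lE pE !size_cat /= sz1 => /addnI[].
have tp : take k0 p = p1 by rewrite pE take_size_cat.
have dp : drop k0.+1 p = p2.
  by rewrite pE -cat_rcons drop_size_cat // size_rcons.
have np : nth i0 p k0 = i0 by rewrite pE nth_cat ltnn subnn.
have nU' s : (s, e1) \notin ledges i1 l1 p1.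
  by apply: contra nU => /(map_f snd); rewrite -/(unzip2 _) unzip2_ledges.
have nT' s : (s, e1) \notin ledges i0 l2 p2.
  by apply: contra nT => /(map_f snd); rewrite -/(unzip2 _) unzip2_ledges.
have leE : le = (s1, e1) :: ledges i1 l1 p1 ++ (x.1, e1) :: ledges i0 l2 p2.
  rewrite /le [LHS]/=; congr cons; rewrite -[LHS]/(ledges i1 l p) {1}lE {1}pE.
  by rewrite ledges_cat // lp1 /ledges /= /e1 (finset.setUC [set i0]%SET).
have xs : x.1 = s1.
  have := dbl (s1, e1); rewrite leE mem_head => /(_ isT).
  rewrite /= eqxx count_cat /= (count_memPn (nU' s1)) (count_memPn (nT' s1)).
  by case: eqP => // -[].
rewrite (bigD1 k0) //= big1 ?addr0; last first.
  move=> k kk0; rewrite /pairing_term; case: ifP => // /and3P[_ /eqP la /eqP ni].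
  exfalso; case/negP: kk0; apply/eqP/val_inj => /=.
  have kp : (k < size p)%N by rewrite sz.
  have pE' := split_nth i0 kp; rewrite ni in pE'.
  have eE1 : edges i1 p = edges i1 p1 ++ e1 :: edges i0 p2.
    by rewrite pE edges_cat /= lp1 /e1 finset.setUC.
  have eE2 : edges i1 p = edges i1 (take k p) ++ e1 :: edges i0 (drop k.+1 p).
    by rewrite {1}pE' edges_cat /= la /e1 finset.setUC.
  have sk : size (edges i1 (take k p)) = k by rewrite size_edges size_takel // ltnW.
  have := congr1 (index e1) eE1; rewrite index_cat (negbTE nU) /= eqxx addn0 size_edges => i1E.
  have nk : nth finset.set0 (edges i1 p) k = e1 by rewrite eE2 nth_cat sk ltnn subnn.
  have [lt|gt|//] := ltngtP k (size p1).
    case/negP: nU; rewrite -nk eE1 nth_cat size_edges lt mem_nth // size_edges //.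
  case/negP: nT; rewrite -nk eE1 nth_cat size_edges ltnNge (ltnW gt) /=.
  rewrite -[(k - size p1)%N]prednK ?subn_gt0 //= mem_nth // size_edges.
  have kp' : (k < size p1 + (size p2).+1)%N by rewrite -(size_cat p1 (i0 :: p2)) -pE.
  have arith (u v w : nat) : (v < u)%N -> (u < v + w.+1)%N -> ((u - v).-1 < w)%N by lia.
  exact: arith gt kp'.
rewrite /pairing_term -/x xs eqxx tp lp1 eqxx np eqxx /= -/l1 -/l2.
have -> : (size p1).+1 = k0.+1 by [].
rewrite dp -/l2 {1}lE {1}pE walk_term_cat // lp1 /= xs.
set U := walk_term i1 l1 p1; set T := walk_term i0 l2 p2.
pose Qu s e := (s, e) \in ledges i1 l1 p1.
have eT : forall s e, (s, e) \in ledges i0 l2 p2 -> ~ Qu s e.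
  move=> s e /(map_f snd); rewrite -/(unzip2 _) unzip2_ledges //= => h1.
  move=> /(map_f snd); rewrite -/(unzip2 _) unzip2_ledges //= => /dis.
  by rewrite h1.
have -> : a s1 i0 i1 * em (d1 i1) * (U * (a s1 i1 i0 * em (x.2 i0) * T)) =
   a s1 i0 i1 * (em (d1 i1) * U) * (a s1 i1 i0 * em (x.2 i0) * T) by rewrite !mulrA.
rewrite (@cond_expect (fun s e => ~ Qu s e) Qu) //; last 3 first.
- by apply: entry_alg_entry => /=; apply/negP/nU'.
- apply: entry_algM; first exact: entry_alg_emb.
  by apply: entry_alg_walk => // -[].
- apply: entry_algM; last by apply: entry_alg_walk => // -[s e] /= /eT.
  apply: entry_algM; last exact: entry_alg_emb.
  by apply: entry_alg_entry => /=; rewrite finset.setUC; apply/negP/nU'.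
rewrite expect_embl.
set w := d1 i1 * E U.
have -> : a s1 i0 i1 * em w * (a s1 i1 i0 * em (x.2 i0) * T) =
   1 * (a s1 i0 i1 * em w * a s1 i1 i0) * (em (x.2 i0) * T) by rewrite mul1r !mulrA.
rewrite (@cond_expect (fun s e => e <> e1) (fun s e => e = e1)) //; last 3 first.
- exact: entry_alg1.
- apply: entry_algM; last by apply: entry_alg_entry; rewrite finset.setUC.
  by apply: entry_algM; [exact: entry_alg_entry|exact: entry_alg_emb].
- apply: entry_algM; first exact: entry_alg_emb.
  apply: entry_alg_walk => // -[s e] /= h ee; move: (nT' s).
  by rewrite -ee h.
by rewrite mul1r a_var !expect_embl scalerAl.
Qed.

(** The normalized trace of d Y_{s_1} d_1 ... Y_{s_m} d_m, expanded over closed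
    walks. *)
Definition trace d l : B := n.+1%:R^-1 *: \sum_(i : V) \sum_(p <- words V (size l))
  (if last i p == i then d i * E (walk_term i l p) else 0).

Definition sd_coef s1 d0 d1 l k : V -> B := fun i =>
  d0 i * eta s1 (trace d1 (take k l)) * (nth (s1, d1) l k).2 i.

(** At its step number k the closed walk splits into one from i1 and one from i0,
    over which the summation is independent. *)
Lemma pairing_sum s1 d0 d1 l k : (k < size l)%N ->
  n.+1%:R^-1 *: (\sum_(i0 : V) \sum_(i1 : V) \sum_(p <- words V (size l))
    (if last i1 p == i0 then d0 i0 * pairing_term i0 i1 s1 d1 l p k else 0)) =
  if (nth (s1, d1) l k).1 == s1 then
    trace (sd_coef s1 d0 d1 l k) (drop k.+1 l) else 0.
Proof.
move=> kl; rewrite /pairing_term; set x := nth _ l k; case: (x.1 == s1) => /=; last first.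
  rewrite big1 ?scaler0 // => i0 _; rewrite big1 // => i1 _; rewrite big1 // => p _.
  by case: ifP => // _; rewrite mulr0.
rewrite /trace; congr (_ *: _); apply: eq_bigr => i0 _.
have szl : size l = (k + (size (drop k.+1 l)).+1)%N by rewrite size_drop; lia.
have szt : size (take k l) = k by rewrite size_takel // ltnW.
rewrite {1}szl; under eq_bigr => i1 _ do rewrite big_words_cat.
transitivity (\sum_(i1 : V) \sum_(p1 <- words V k) \sum_(p2 <- words V (size (drop k.+1 l)))
   (if (last i1 p1 == i1) && (last i0 p2 == i0) then
     d0 i0 * (n.+1%:R^-1 *: (eta s1 (d1 i1 * E (walk_term i1 (take k l) p1)) *
      (x.2 i0 * E (walk_term i0 (drop k.+1 l) p2)))) else 0)).
  apply: eq_bigr => i1 _; rewrite !big_seq; apply: eq_bigr => p1 /size_words sp1.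
  rewrite big_words (bigD1 i0) //= [X in _ + X]big1 ?addr0; last first.
    move=> j ji; rewrite big1 // => p2 _; rewrite nth_cat sp1 ltnn subnn /=.
    by rewrite (negbTE ji) andbF mulr0; case: ifP.
  apply: eq_bigr => p2 _; rewrite nth_cat sp1 ltnn subnn /= eqxx andbT.
  rewrite take_size_cat // -cat_rcons drop_size_cat ?size_rcons ?sp1 // cat_rcons last_cat /=.
  by case: (last i0 p2 == i0); case: (last i1 p1 == i1); rewrite ?mulr0.
have eta_trace : eta s1 (trace d1 (take k l)) = \sum_(i1 : V) \sum_(p1 <- words V k)
    n.+1%:R^-1 *: eta s1 (if last i1 p1 == i1 then d1 i1 * E (walk_term i1 (take k l) p1) else 0).
  rewrite /trace szt linearZ /= linear_sum scaler_sumr; apply: eq_bigr => i1 _.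
  by rewrite linear_sum scaler_sumr.
under eq_bigr => i1 _ do rewrite exchange_big /=.
rewrite exchange_big /=; apply: eq_bigr => p2 _.
case: (last i0 p2 == i0); last first.
  by rewrite big1 // => i1 _; rewrite big1 // => p1 _; rewrite andbF.
rewrite /sd_coef eta_trace -/x mulr_sumr !mulr_suml; apply: eq_bigr => i1 _.
rewrite mulr_sumr !mulr_suml; apply: eq_bigr => p1 _.
rewrite andbT; case: ifP => _; last by rewrite linear0 scaler0 mulr0 !mul0r.
by rewrite -!scalerAr -!scalerAl !mulrA.
Qed.

End Walk.

(** * Growth of diagonal matrices *)

Section Tempered.
Variable R : realType.
Implicit Types g h : forall n, 'I_n.+1 -> R.

Definition avg n (g : 'I_n.+1 -> R) : R := n.+1%:R^-1 * \sum_(i < n.+1) g i.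

(** This class contains the norms of the entries of the given diagonal matrices
    and is closed under sums and products, hence contains those of polynomials. *)
Definition tempered g := (forall n i, 0 <= g n i) /\
  forall k, exists C : R, forall n, avg (fun i => g n i ^+ k) <= C.

Lemma avg_le n (g h : 'I_n.+1 -> R) : (forall i, g i <= h i) -> avg g <= avg h.
Proof.
by move=> gh; rewrite ler_wpM2l ?invr_ge0 ?ler0n //; apply: ler_sum => i _; exact: gh.
Qed.

Lemma avg_cst n (c : R) : avg (fun _ : 'I_n.+1 => c) = c.
Proof.
by rewrite /avg sumr_const card_ord -[c *+ _]mulr_natl mulrA mulVf ?mul1r.
Qed.

Lemma avgD n (g h : 'I_n.+1 -> R) : avg (fun i => g i + h i) = avg g + avg h.
Proof. by rewrite /avg big_split mulrDr. Qed.

Lemma avgZ n c (g : 'I_n.+1 -> R) : avg (fun i => c * g i) = c * avg g.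
Proof. by rewrite /avg -mulr_sumr mulrCA. Qed.

Lemma avg_ge0 n (g : 'I_n.+1 -> R) : (forall i, 0 <= g i) -> 0 <= avg g.
Proof. by move=> g0; rewrite mulr_ge0 ?invr_ge0 ?ler0n // sumr_ge0. Qed.

Lemma tempered_cst (c : R) : 0 <= c -> tempered (fun n _ => c).
Proof. by move=> c0; split=> // k; exists (c ^+ k) => n; rewrite avg_cst. Qed.

Lemma exprD_le (x y : R) k : 0 <= x -> 0 <= y ->
  (x + y) ^+ k <= 2 ^+ k * x ^+ k + 2 ^+ k * y ^+ k.
Proof.
move=> x0 y0; wlog xy : x y x0 y0 / x <= y.
  move=> W; have [|/ltW] := leP x y; first exact: W.
  by move=> /W h; rewrite addrC [leRHS]addrC h.
apply: (@le_trans _ _ ((2 * y) ^+ k)).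
  by rewrite lerXn2r ?nnegrE ?addr_ge0 ?mulr_ge0 //; lra.
by rewrite exprMn lerDr mulr_ge0 ?exprn_ge0.
Qed.

Lemma temperedD g h : tempered g -> tempered h -> tempered (fun n i => g n i + h n i).
Proof.
move=> [g0 gb] [h0 hb]; split=> [n i|k]; first by rewrite addr_ge0.
have [C hC] := gb k; have [D hD] := hb k; exists (2 ^+ k * C + 2 ^+ k * D) => n.
apply: (@le_trans _ _ (avg (fun i => 2 ^+ k * g n i ^+ k + 2 ^+ k * h n i ^+ k))).
  by apply: avg_le => i; exact: exprD_le.
by rewrite avgD !avgZ lerD // ler_wpM2l ?exprn_ge0.
Qed.

Lemma temperedM g h : tempered g -> tempered h -> tempered (fun n i => g n i * h n i).
Proof.
move=> [g0 gb] [h0 hb]; split=> [n i|k]; first by rewrite mulr_ge0.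
have [C hC] := gb (k * 2)%N; have [D hD] := hb (k * 2)%N; exists (C + D) => n.
apply: (@le_trans _ _ (avg (fun i => g n i ^+ (k * 2) + h n i ^+ (k * 2)))).
  apply: avg_le => i; rewrite exprMn !exprM.
  have := exprn_ge0 k (g0 n i); have := exprn_ge0 k (h0 n i).
  by move: (g n i ^+ k) (h n i ^+ k) => u v; nra.
by rewrite avgD lerD.
Qed.

(** A single term is at most the sum; thus the maximum grows more slowly than any
    power of n. *)
Lemma tempered_max g k : tempered g ->
  exists2 C, 0 <= C & forall n i, g n i ^+ k <= C * n.+1%:R.
Proof.
move=> [g0 gb]; have [C hC] := gb k; exists C.
  by apply: le_trans (hC 0); apply: avg_ge0 => i; rewrite exprn_ge0.
move=> n i; rewrite -ler_pdivrMr ?ltr0n //; apply: le_trans (hC n).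
rewrite mulrC ler_wpM2l ?invr_ge0 ?ler0n // (bigD1 i) //= lerDl sumr_ge0 // => j _.
by rewrite exprn_ge0.
Qed.

Lemma cvg0_expr (f : nat -> R) k : (forall n, 0 <= f n) ->
  f n ^+ k.+1 @[n --> \oo] --> 0 -> f n @[n --> \oo] --> 0.
Proof.
move=> f0 h; apply/cvgrPdist_lt => e e0; near=> n.
rewrite sub0r normrN ger0_norm //.
rewrite -(@ltr_pXn2r _ k.+1) ?nnegrE ?(ltW e0) //.
near: n; have ek : 0 < e ^+ k.+1 by rewrite exprn_gt0.
have [N hN] := cvg0_small ek h; exists N => // n /= Nn.
exact: le_lt_trans (ler_norm _) (hN _ Nn).
Unshelve. all: by end_near. Qed.

(** The order of magnitude of the matrix entries. *)
Definition rho n : R := n.+1%:R `^ (- 2^-1).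

Lemma rho_gt0 n : 0 < rho n. Proof. by rewrite powR_gt0. Qed.

Lemma rho_powR n m : n.+1%:R `^ (- (m%:R / 2)) = rho n ^+ m.
Proof.
by rewrite -powR_mulrn ?powR_ge0 // -powRrM; congr (_ `^ _); rewrite mulNr mulrC.
Qed.

Lemma rho_sq n : rho n ^+ 2 = n.+1%:R^-1.
Proof.
by rewrite -rho_powR divff // -(@powR_inv1 _ n.+1%:R).
Qed.

Lemma rho_le1 n : rho n <= 1.
Proof.
rewrite -(@ler_pXn2r _ 2) ?nnegrE ?(ltW (rho_gt0 _)) // rho_sq expr1n.
by rewrite invf_le1 ?ltr0n // ler1n.
Qed.

Lemma rho_count n v m : (2 * v <= m)%N -> n.+1%:R ^+ v * rho n ^+ m <= 1.
Proof.
move=> vm; rewrite -(subnKC vm) exprD mulrA exprM rho_sq -exprMn.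
rewrite mulfV ?pnatr_eq0 // expr1n mul1r exprn_ile1 ?rho_le1 //.
exact: ltW (rho_gt0 _).
Qed.

Lemma rho_sq_cvg0 : rho n ^+ 2 @[n --> \oo] --> 0.
Proof.
rewrite (_ : (fun n => _) = @harmonic R); first exact: cvg_harmonic.
by rewrite boolp.funeqE => n; rewrite rho_sq.
Qed.

Lemma exists_ord_max (n : nat) (g : 'I_n.+1 -> R) : exists i, forall j, g j <= g i.
Proof.
case: (@Order.TotalTheory.arg_maxP _ _ _ ord0 predT g isT) => i _ h.
by exists i => j; exact: h.
Qed.

End Tempered.

Section Dominated.
Variables (R : realType) (B : cstarType R).
Local Notation N := (@cnorm R B).
Local Notation dseq := (forall n, 'I_n.+1 -> B).
Implicit Types d : dseq.

Definition dominated d :=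
  exists2 g, tempered g & forall n i, N (d n i) <= g n i.

(** The vanishing factor e is kept apart from the tempered one, so that products
    with dominated sequences are immediately null. *)
Definition null d := exists e : nat -> R, exists2 g, tempered g &
  [/\ forall n, 0 <= e n, e n @[n --> \oo] --> (0 : R)
    & forall n i, N (d n i) <= e n * g n i].

Lemma dominatedM d d' : dominated d -> dominated d' ->
  dominated (fun n i => d n i * d' n i).
Proof.
move=> [g gb dg] [h hb dh]; exists (fun n i => g n i * h n i); first exact: temperedM.
by move=> n i; apply: le_trans (cnormM _ _) _; rewrite ler_pM ?cnorm_ge0.
Qed.

Lemma dominatedD d d' : dominated d -> dominated d' ->
  dominated (fun n i => d n i + d' n i).
Proof.
move=> [g gb dg] [h hb dh]; exists (fun n i => g n i + h n i); first exact: temperedD.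
by move=> n i; apply: le_trans (cnormD _ _) _; rewrite lerD.
Qed.

Lemma dominated_bounded (u : nat -> B) C : (forall n, N (u n) <= C) ->
  dominated (fun n _ => u n).
Proof.
move=> uC; exists (fun n _ => C) => //.
by apply: tempered_cst; apply: le_trans (cnorm_ge0 _) (uC 0).
Qed.

Lemma nullMr d d' : null d -> dominated d' -> null (fun n i => d n i * d' n i).
Proof.
move=> [e [g gb [e0 ec dg]]] [h hb dh]; exists e, (fun n i => g n i * h n i).
  exact: temperedM.
split=> // n i; apply: le_trans (cnormM _ _) _; rewrite mulrA.
by rewrite ler_pM ?cnorm_ge0.
Qed.

Lemma nullMl d d' : dominated d -> null d' -> null (fun n i => d n i * d' n i).
Proof.
move=> [h hb dh] [e [g gb [e0 ec dg]]]; exists e, (fun n i => h n i * g n i).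
  exact: temperedM.
split=> // n i; apply: le_trans (cnormM _ _) _; rewrite mulrCA.
by rewrite ler_pM ?cnorm_ge0.
Qed.

Lemma null_cvg (u : nat -> B) : N (u n) @[n --> \oo] --> (0 : R) ->
  null (fun n _ => u n).
Proof.
move=> u0; exists (fun n => N (u n)), (fun n _ => 1); first exact: tempered_cst.
by split=> [n||n i]; rewrite ?cnorm_ge0 ?mulr1.
Qed.

Lemma null_dominated d : null d -> dominated d.
Proof.
move=> [e [g gb [e0 ec dg]]].
have [C hC] := cvg0_bounded ec.
have C0 : 0 <= C := le_trans (e0 0) (hC 0).
exists (fun n i => C * g n i); first by apply: temperedM => //; exact: tempered_cst.
move=> n i; apply: le_trans (dg n i) _; rewrite ler_wpM2r //.
by have [g0 _] := gb.
Qed.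

End Dominated.

(** * Asymptotic Schwinger-Dyson equations *)

Section MatrixModel.
Variables (R : realType) (B : cstarType R) (P : bprob B) (S : eqType).
Local Notation E := (expect P).
Local Notation em := (emb P).
Local Notation N := (@cnorm R B).
Variable a : forall n, S -> 'I_n.+1 -> 'I_n.+1 -> P.
Arguments a : clear implicits.
Variable eta : S -> {linear B -> B}.
Hypothesis a_star : forall n s i j, a n s i j = star (a n s j i).
Hypothesis a_mean : forall n s i j, E (a n s i j) = 0.
Hypothesis a_var : forall n s i j x,
  E (a n s i j * em x * a n s j i) = n.+1%:R^-1 *: eta s x.
Hypothesis a_bound : forall m : nat, exists2 M : R, 0 < M &
  forall (n : nat) (x : 'I_m -> B) (s : 'I_m.+1 -> S) (i j : 'I_m.+1 -> 'I_n.+1),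
    N (E (a n (s ord0) (i ord0) (j ord0) *
          \prod_(k < m) (em (x k) *
            a n (s (lift ord0 k)) (i (lift ord0 k)) (j (lift ord0 k)))))
    <= M * n.+1%:R `^ (- (m.+1%:R / 2)) * \prod_(k < m) N (x k).
Hypothesis a_indep : forall n, cond_indep_rv E
  (fun k : S * {ij : 'I_n.+1 * 'I_n.+1 | (ij.1 <= ij.2)%N} =>
     a n k.1 (val k.2).1 (val k.2).2).

Fixpoint lbound (T : Type) (D : Type) (Q : D -> Prop) (l : seq (T * D)) : Prop :=
  if l is x :: l' then Q x.2 /\ lbound Q l' else True.

Lemma lbound_take T D (Q : D -> Prop) (l : seq (T * D)) k :
  lbound Q l -> lbound Q (take k l).
Proof. by elim: l k => //= x l IH [|k] //= [Qx /IH]. Qed.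

Lemma lbound_drop T D (Q : D -> Prop) (l : seq (T * D)) k :
  lbound Q l -> lbound Q (drop k l).
Proof. by elim: l k => //= x l IH [|k] //= [Qx /IH]. Qed.

Lemma lbound_nth T D (Q : D -> Prop) (l : seq (T * D)) x0 k :
  lbound Q l -> (k < size l)%N -> Q (nth x0 l k).2.
Proof. by elim: l k => //= x l IH [|k] //= [Qx /IH]; auto. Qed.

Lemma lbound_imp T D (Q Q' : D -> Prop) (l : seq (T * D)) :
  (forall d, Q d -> Q' d) -> lbound Q l -> lbound Q' l.
Proof. by move=> QQ; elim: l => //= x l IH [/QQ ? /IH]. Qed.

(** The variance is an expectation of a product of two entries. *)
Lemma eta_bound : exists2 M : R, 0 <= M & forall s x, N (eta s x) <= M * N x.
Proof.
have [M M0 hM] := a_bound 1; exists M; first exact: ltW.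
move=> s x; have := hM 0 (fun _ => x) (fun _ => s) (fun _ => ord0) (fun _ => ord0).
by rewrite !big_ord1 mulrA a_var invr1 scale1r powR1 mulr1.
Qed.

Section Expand.
Variable n : nat.
Local Notation V := 'I_n.+1.
Implicit Types (l : seq (S * (V -> B))) (p : seq V).

Lemma walk_term_expand s i j d l p x0 : size p = size l ->
  walk_term (a n) i ((s, d) :: l) (j :: p) =
  a n s i j * \prod_(k < size l) (em ((nth x0 ((s, d) :: l) k).2 (nth i (j :: p) k)) *
     a n (nth x0 l k).1 (nth i (j :: p) k) (nth i p k)) *
  em ((last (s, d) l).2 (last j p)).
Proof.
elim: l s i j d p => [|[s' d'] l IH] s i j d [|j' p] //=.
  by rewrite big_ord0 !mulr1.
move=> [sz]; have /= := IH s' j j' d' p sz; rewrite /= => ->.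
rewrite big_ord_recl /= !mulrA; congr (_ * _ * _).
apply: eq_bigr => k _; congr (em ((nth x0 _ k).2 _) * a n _ _ _);
  apply: set_nth_default; rewrite /= ?sz; have := ltn_ord k; lia.
Qed.

End Expand.

Lemma walk_bound m : exists2 K : R, 0 <= K & forall n (G : R)
    (i : 'I_n.+1) (l : seq (S * ('I_n.+1 -> B))) p,
  size l = m -> size p = m -> 0 <= G ->
  lbound (fun d : 'I_n.+1 -> B => forall j, N (d j) <= G) l ->
  N (E (walk_term (a n) i l p)) <= K * rho R n ^+ m * G ^+ m.
Proof.
case: m => [|m].
  exists 1 => // n G i [] // [] // _ _ _ _ /=.
  by rewrite expect1 cnorm1 !expr0 !mulr1.
have [M M0 hM] := a_bound m; exists M; first exact: ltW.
move=> n G i [|[s d] l] // [|j p] // [sl] [sp] G0 lb.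
rewrite (@walk_term_expand _ _ _ _ _ _ _ (s, d)) ?sl //.
rewrite expect_embr; apply: le_trans (cnormM _ _) _.
have la : N ((last (s, d) l).2 (last j p)) <= G.
  by have := @lbound_nth _ _ _ ((s, d) :: l) (s, d) (size l) lb; rewrite -last_nth; apply.
rewrite [G ^+ _]exprSr mulrA ler_pM ?cnorm_ge0 //.
have := hM n (fun k : 'I_m => (nth (s, d) ((s, d) :: l) k).2 (nth i (j :: p) k))
  (fun k => (nth (s, d) ((s, d) :: l) k).1) (fun k => nth i (i :: j :: p) k)
  (fun k => nth i (j :: p) k).
rewrite /= rho_powR => /le_trans; apply.
rewrite ler_wpM2l //; first by rewrite mulr_ge0 ?exprn_ge0 // ltW // rho_gt0.
rewrite -[X in G ^+ X](card_ord m) -prodr_const; apply: ler_prod => k _.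
rewrite cnorm_ge0 /=; apply: (@lbound_nth _ _ _ ((s, d) :: l) (s, d) k lb).
by rewrite /= sl ltnW // ltnS.
Qed.

Definition sd_sum n s1 (d0 d1 : 'I_n.+1 -> B) l : B :=
  \sum_(k < size l) if (nth (s1, d1) l k).1 == s1 then
    trace (a n) (sd_coef (a n) eta s1 d0 d1 l k) (drop k.+1 l) else 0.

Lemma trace_cons n s1 (d0 d1 : 'I_n.+1 -> B) l :
  trace (a n) d0 ((s1, d1) :: l) = n.+1%:R^-1 *: \sum_i0 \sum_i1
    \sum_(p <- words 'I_n.+1 (size l)) (if last i1 p == i0 then
      d0 i0 * E (walk_term (a n) i0 ((s1, d1) :: l) (i1 :: p)) else 0).
Proof.
by rewrite /trace; congr (_ *: _); apply: eq_bigr => i0 _; rewrite big_words.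
Qed.

Lemma trace_sd_diff n s1 (d0 d1 : 'I_n.+1 -> B) l :
  trace (a n) d0 ((s1, d1) :: l) - sd_sum s1 d0 d1 l =
  n.+1%:R^-1 *: \sum_i0 \sum_i1 \sum_(p <- words 'I_n.+1 (size l))
   (if last i1 p == i0 then
     d0 i0 * (E (walk_term (a n) i0 ((s1, d1) :: l) (i1 :: p)) -
       \sum_(k < size l) pairing_term (a n) eta i0 i1 s1 d1 l p k) else 0).
Proof.
have -> : sd_sum s1 d0 d1 l = n.+1%:R^-1 *: \sum_i0 \sum_i1
    \sum_(p <- words 'I_n.+1 (size l)) \sum_(k < size l) (if last i1 p == i0 then
      d0 i0 * pairing_term (a n) eta i0 i1 s1 d1 l p k else 0).
  rewrite /sd_sum; under eq_bigr => k _ do rewrite -(pairing_sum (a n) eta s1 d0 d1 (ltn_ord k)).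
  rewrite -scaler_sumr exchange_big; congr (_ *: _); apply: eq_bigr => i0 _ /=.
  by rewrite exchange_big; apply: eq_bigr => i1 _ /=; rewrite exchange_big.
rewrite trace_cons -scalerBr -sumrB; congr (_ *: _); apply: eq_bigr => i0 _.
rewrite -sumrB; apply: eq_bigr => i1 _; rewrite -sumrB; apply: eq_bigr => p _.
case: ifP => _; first by rewrite mulrBr mulr_sumr.
by rewrite big1 ?subr0.
Qed.

Lemma pairing_bound m k : (k < m)%N -> exists2 K : R, 0 <= K & forall n (G : R)
   (i0 i1 : 'I_n.+1) s1 d1 l p, size l = m -> size p = m -> 0 <= G ->
   lbound (fun d : 'I_n.+1 -> B => forall j, N (d j) <= G) ((s1, d1) :: l) ->
   N (pairing_term (a n) eta i0 i1 s1 d1 l p k) <= K * rho R n ^+ m.+1 * G ^+ m.+1.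
Proof.
move=> km; have [C C0 hC] := eta_bound.
have [K1 K10 h1] := walk_bound k.
have [K2 K20 h2] := walk_bound (m - k.+1).
exists (C * K1 * K2); first by rewrite !mulr_ge0.
move=> n G i0 i1 s1 d1 l p sl sp G0 lb; rewrite /pairing_term.
have r0 : 0 <= rho R n := ltW (rho_gt0 R n).
case: ifP => _; last by rewrite cnorm0 !mulr_ge0 ?exprn_ge0.
rewrite cnorm_invSn -rho_sq.
have b1 : N (eta s1 (d1 i1 * E (walk_term (a n) i1 (take k l) (take k p)))) <=
    C * (G * (K1 * rho R n ^+ k * G ^+ k)).
  apply: le_trans (hC _ _) _; rewrite ler_wpM2l //.
  apply: le_trans (cnormM _ _) _; rewrite ler_pM ?cnorm_ge0 //; first by case: lb.
  apply: h1; rewrite ?size_takel ?sl ?sp ?(ltnW km) //.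
  by apply: lbound_take; case: lb.
have b2 : N ((nth (s1, d1) l k).2 i0 * E (walk_term (a n) i0 (drop k.+1 l) (drop k.+1 p))) <=
    G * (K2 * rho R n ^+ (m - k.+1) * G ^+ (m - k.+1)).
  apply: le_trans (cnormM _ _) _; rewrite ler_pM ?cnorm_ge0 //.
    by apply: (@lbound_nth _ _ (fun d : 'I_n.+1 -> B => forall j, N (d j) <= G)); rewrite ?sl //; case: lb.
  apply: h2; rewrite ?size_drop ?sl ?sp //.
  by apply: lbound_drop; case: lb.
have b3 := ler_pM (cnorm_ge0 _) (cnorm_ge0 _) b1 b2.
have := le_trans (cnormM _ _) b3.
move=> /(ler_wpM2l (sqr_ge0 (rho R n))) /le_trans; apply.
have -> : m.+1 = (k + (m - k.+1) + 2)%N by lia.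
by rewrite !exprD le_eqVlt; apply/orP; left; apply/eqP; ring.
Qed.

(** A closed walk of m + 1 steps on more than m/2 + 1 vertices does not contribute
    to the difference, by tight_expect. The others are O(n^(m/2 + 1)) in number
    with contributions O(n^(-(m+1)/2)), and the trace is divided by n. *)
Lemma sd_bound m : exists2 C : R, 0 <= C & forall n (G : R)
   s1 (d0 d1 : 'I_n.+1 -> B) l, size l = m -> 0 <= G -> (forall j, N (d0 j) <= G) ->
   lbound (fun d : 'I_n.+1 -> B => forall j, N (d j) <= G) ((s1, d1) :: l) ->
   N (trace (a n) d0 ((s1, d1) :: l) - sd_sum s1 d0 d1 l) <=
   C * (G ^+ m.+2 * rho R n).
Proof.
have [K K0 hK] := walk_bound m.+1.
have /choice[L hL] : forall k : 'I_m, exists L : R, 0 <= L /\ forall n (G : R)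
   (i0 i1 : 'I_n.+1) s1 d1 l p, size l = m -> size p = m -> 0 <= G ->
   lbound (fun d : 'I_n.+1 -> B => forall j, N (d j) <= G) ((s1, d1) :: l) ->
   N (pairing_term (a n) eta i0 i1 s1 d1 l p k) <= L * rho R n ^+ m.+1 * G ^+ m.+1.
  by move=> k; have [L L0 hL] := pairing_bound (ltn_ord k); exists L.
pose X := K + \sum_k L k.
have X0 : 0 <= X by rewrite addr_ge0 ?sumr_ge0 // => k _; case: (hL k).
exists ((m.+1)`!%:R * X); first by rewrite mulr_ge0.
move=> n G s1 d0 d1 l sl G0 b0 lb; rewrite trace_sd_diff cnorm_invSn.
have r0 : 0 <= rho R n := ltW (rho_gt0 R n).
pose Z := X * rho R n ^+ m.+1 * G ^+ m.+2.
have Z0 : 0 <= Z.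
  by apply: mulr_ge0; [apply: mulr_ge0 => //; exact: exprn_ge0|exact: exprn_ge0].
have tb i0 i1 (p : seq 'I_n.+1) : p \in words 'I_n.+1 m ->
   N (if last i1 p == i0 then
     d0 i0 * (E (walk_term (a n) i0 ((s1, d1) :: l) (i1 :: p)) -
       \sum_(k < size l) pairing_term (a n) eta i0 i1 s1 d1 l p k) else 0) <=
   if last i1 p == i0 then Z * (#|sset (i1 :: p)| <= m.+2./2)%N%:R else 0.
  move=> /size_words sp; case: ifP => [/eqP lp|_]; last by rewrite cnorm0.
  case: (leqP #|sset (i1 :: p)| m.+2./2) => [small|big]; last first.
    rewrite (tight_expect (@a_star n) (@a_mean n) (@a_var n) (@a_indep n)) ?sp ?sl //; first by rewrite subrr mulr0 cnorm0 mulr0.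
    by move: big; lia.
  rewrite mulr1; apply: le_trans (cnormM _ _) _.
  apply: (@le_trans _ _ (G * (X * rho R n ^+ m.+1 * G ^+ m.+1))); last first.
    by rewrite /Z [G ^+ m.+2]exprS le_eqVlt; apply/orP; left; apply/eqP; ring.
  rewrite ler_pM ?cnorm_ge0 //; apply: le_trans (cnormB _ _) _.
  rewrite /X !mulrDl lerD //; first by apply: hK; rewrite /= ?sl ?sp.
  apply: le_trans (cnorm_sum _ _ _) _; rewrite !mulr_suml sl; apply: ler_sum => k _.
  by case: (hL k) => _; apply.
have cnt : \sum_i0 \sum_i1 \sum_(p <- words 'I_n.+1 m) (if last i1 p == i0 then
    Z * (#|sset (i1 :: p)| <= m.+2./2)%N%:R else 0) <=
    Z * ((m.+1)`!%:R * n.+1%:R ^+ m.+2./2).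
  have -> : \sum_i0 \sum_i1 \sum_(p <- words 'I_n.+1 m) (if last i1 p == i0 then
    Z * (#|sset (i1 :: p)| <= m.+2./2)%N%:R else 0) =
    Z * (\sum_(q <- words 'I_n.+1 m.+1) (#|sset q| <= m.+2./2))%N%:R.
    rewrite big_words natr_sum mulr_sumr exchange_big; apply: eq_bigr => i1 _ /=.
    rewrite natr_sum mulr_sumr exchange_big; apply: eq_bigr => p _ /=.
    rewrite (bigD1 (last i1 p)) //= eqxx big1 ?addr0 // => j /negbTE.
    by rewrite eq_sym => ->.
  rewrite ler_wpM2l //; have := @count_words 'I_n.+1 m.+1 m.+2./2.
  by rewrite card_ord -natrX -natrM ler_nat; apply.
rewrite -rho_sq; apply: (@le_trans _ _ (rho R n ^+ 2 * (Z * ((m.+1)`!%:R * n.+1%:R ^+ m.+2./2)))).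
  rewrite ler_wpM2l ?sqr_ge0 //; apply: le_trans cnt.
  apply: le_trans (cnorm_sum _ _ _) _; apply: ler_sum => i0 _.
  apply: le_trans (cnorm_sum _ _ _) _; apply: ler_sum => i1 _.
  apply: le_trans (cnorm_sum _ _ _) _; rewrite sl big_seq [leRHS]big_seq.
  by apply: ler_sum => p pw; have := tb i0 i1 p pw; rewrite sl.
have := @rho_count R n m.+2./2 m.+2; 
have /[swap]/[apply] h : (2 * m.+2./2 <= m.+2)%N by lia.
rewrite (_ : _ * (Z * _) = (m.+1)`!%:R * X * (G ^+ m.+2 * rho R n) * (n.+1%:R ^+ m.+2./2 * rho R n ^+ m.+2)); last first.
  by rewrite /Z [rho R n ^+ m.+2]exprS; ring.
rewrite ler_piMr //; apply: mulr_ge0; first exact: mulr_ge0.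
by apply: mulr_ge0 => //; exact: exprn_ge0.
Qed.

Lemma trace_nil n (d : 'I_n.+1 -> B) : trace (a n) d [::] = n.+1%:R^-1 *: \sum_i d i.
Proof.
by rewrite /trace; congr (_ *: _); apply: eq_bigr => i _; rewrite big_seq1 /= eqxx expect1 mulr1.
Qed.

Lemma trace_ext n (d d' : 'I_n.+1 -> B) l : d =1 d' -> trace (a n) d l = trace (a n) d' l.
Proof.
move=> dd; rewrite /trace; congr (_ *: _); apply: eq_bigr => i _.
by apply: eq_bigr => p _; rewrite dd.
Qed.

Lemma traceB n (d d' : 'I_n.+1 -> B) l :
  trace (a n) d l - trace (a n) d' l = trace (a n) (fun i => d i - d' i) l.
Proof.
rewrite /trace -scalerBr -sumrB; congr (_ *: _); apply: eq_bigr => i _.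
rewrite -sumrB; apply: eq_bigr => p _.
by case: ifP => _; rewrite ?subr0 // mulrBl.
Qed.

Local Notation dseq := (forall n, 'I_n.+1 -> B).
Implicit Types (d : dseq) (l : seq (S * dseq)).

Definition at_size n l : seq (S * ('I_n.+1 -> B)) := [seq (x.1, x.2 n) | x <- l].

Definition trace_seq d l n : B := trace (a n) (d n) (at_size n l).

Lemma common_bound l : lbound (@dominated R B) l ->
  exists2 g : forall n, 'I_n.+1 -> R, tempered g &
    lbound (fun d => forall n i, N (d n i) <= g n i) l.
Proof.
elim: l => [_|x l IH /= [[h hb dh] /IH[g gb dg]]].
  by exists (fun n _ => 0) => //; apply: tempered_cst.
exists (fun n i => h n i + g n i); first exact: temperedD.
have [[h0 _] [g0 _]] := (hb, gb); split; first by move=> n i; rewrite ler_wpDr.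
by apply: lbound_imp dg => d hd n i; rewrite ler_wpDl.
Qed.

Lemma lbound_at_size (Q : forall n, ('I_n.+1 -> B) -> Prop) n l :
  lbound (fun d => Q n (d n)) l -> lbound (Q n) (at_size n l).
Proof. by elim: l => //= x l IH [? /IH]. Qed.

(** The factor n^(-1/2) in sd_bound absorbs any power of the maximum of a tempered
    sequence. *)
Lemma sd_vanish s1 d0 d1 l : dominated d0 -> dominated d1 ->
  lbound (@dominated R B) l ->
  N (trace_seq d0 ((s1, d1) :: l) n - sd_sum s1 (d0 n) (d1 n) (at_size n l))
    @[n --> \oo] --> (0 : R).
Proof.
move=> b0 b1 bl.
have [g gb /= [g0 gl]] : exists2 g : forall n, 'I_n.+1 -> R, tempered g &
    lbound (fun d => forall n i, N (d n i) <= g n i) ((s1, d0) :: (s1, d1) :: l).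
  exact: common_bound.
have /choice[G hG] : forall n, exists G, (exists i, G = g n i) /\ forall j, g n j <= G.
  by move=> n; have [i hi] := exists_ord_max (g n); exists (g n i); split => //; exists i.
have G0 n : 0 <= G n by have [[i ->] _] := hG n; case: gb.
have [C C0 hC] := sd_bound (size l).
have [D D0 hD] := tempered_max ((size l).+2 * 4) gb.
apply: (@cvg0_squeeze _ _ (fun n => C * (G n ^+ (size l).+2 * rho R n))).
  move=> n; rewrite cnorm_ge0 /=; apply: hC => //.
  - by rewrite size_map.
  - by move=> j; apply: le_trans (g0 n j) _; case: (hG n).
  - case: gl => gl1 gl; split; first by move=> j; apply: le_trans (gl1 n j) _; case: (hG n).
    apply: (@lbound_at_size (fun n (d : 'I_n.+1 -> B) => forall j, N (d j) <= G n)).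
    by apply: lbound_imp gl => d hd j; apply: le_trans (hd n j) _; case: (hG n).
(* the fourth power is O(1/n), since (G n)^(4 (m + 2)) = O(n) *)
apply: cvg0Ml; apply: (@cvg0_expr _ _ 3).
  by move=> n; apply: mulr_ge0; [exact: exprn_ge0|exact: ltW (rho_gt0 _ _)].
apply: (@cvg0_squeeze _ _ (fun n => D * rho R n ^+ 2)); last first.
  by apply: cvg0Ml; exact: rho_sq_cvg0.
move=> n; have r0 : 0 <= rho R n := ltW (rho_gt0 R n).
apply/andP; split; first by apply: exprn_ge0; apply: mulr_ge0 => //; exact: exprn_ge0.
rewrite exprMn -exprM; have [[i ->] _] := hG n.
apply: (le_trans (ler_wpM2r _ (hD n i))); first exact: exprn_ge0.
have -> : rho R n ^+ 4 = rho R n ^+ 2 * rho R n ^+ 2 by rewrite -exprD.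
by rewrite {1}rho_sq mulrA mulfK ?pnatr_eq0.
Qed.

Lemma sd_sum_at_size n s1 d0 d1 l :
  sd_sum s1 (d0 n) (d1 n) (at_size n l) = \sum_(k < size l)
    if (nth (s1, d1) l k).1 == s1 then
      trace_seq (fun n i => d0 n i * eta s1 (trace_seq d1 (take k l) n) *
        (nth (s1, d1) l k).2 n i) (drop k.+1 l) n else 0.
Proof.
rewrite /sd_sum size_map; apply: eq_bigr => k _.
have -> : nth (s1, d1 n) (at_size n l) k = ((nth (s1, d1) l k).1, (nth (s1, d1) l k).2 n).
  by rewrite (nth_map (s1, d1)).
rewrite /=; case: ifP => // _; rewrite /trace_seq /at_size map_drop.
apply: trace_ext => i; rewrite /sd_coef -map_take.
by rewrite (nth_map (s1, d1)).
Qed.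

(** Induction on the number of factors Y. By sd_vanish the trace is close to a sum
    of shorter ones, whose first diagonal factors are dominated because the inner
    traces are bounded, and null when d is. *)
Lemma trace_asymptotics m l : size l = m -> lbound (@dominated R B) l ->
  (forall d, dominated d -> exists C, forall n, N (trace_seq d l n) <= C) /\
  (forall d, null d -> N (trace_seq d l n) @[n --> \oo] --> (0 : R)).
Proof.
elim/ltn_ind: m l => m IH [|[s1 d1] l] sl bl.
  split=> [d [g [g0 gb] dg]|d [e [g [g0 gb] [e0 ec dg]]]].
    have [C hC] := gb 1; exists C => n; rewrite /trace_seq trace_nil cnorm_invSn.
    apply: le_trans (hC n); rewrite ler_wpM2l ?invr_ge0 ?ler0n //.
    by apply: le_trans (cnorm_sum _ _ _) _; apply: ler_sum => i _; exact: dg.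
  have [C hC] := gb 1; apply: (@cvg0_squeeze _ _ (fun n => C * e n)); last exact: cvg0Ml.
  move=> n; rewrite cnorm_ge0 /trace_seq trace_nil cnorm_invSn /=.
  rewrite [C * _]mulrC; apply: le_trans (ler_wpM2l (e0 n) (hC n)).
  rewrite -avgZ /avg ler_wpM2l ?invr_ge0 ?ler0n //.
  by apply: le_trans (cnorm_sum _ _ _) _; apply: ler_sum => i _; exact: dg.
have [b1 bl'] := bl.
have [C1 C10 hC1] := eta_bound.
have term d (k : 'I_(size l)) : dominated d -> dominated
    (fun n i => d n i * eta s1 (trace_seq d1 (take k l) n) * (nth (s1, d1) l k).2 n i).
  move=> bd; apply: dominatedM; last exact: lbound_nth.
  apply: dominatedM => //.
  have [|hb _] := IH (size (take k l)) _ (take k l) erefl (lbound_take k bl').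
    by rewrite -sl size_take ltn_ord /= ltnS ltnW.
  have [C hC] := hb _ b1; apply: (@dominated_bounded _ _ _ (C1 * C)) => n.
  by apply: le_trans (hC1 _ _) _; rewrite ler_wpM2l.
have small (k : 'I_(size l)) : (size (drop k.+1 l) < m)%N.
  by rewrite -sl size_drop /=; have := ltn_ord k; lia.
have split_le d n : N (trace_seq d ((s1, d1) :: l) n) <=
   N (trace_seq d ((s1, d1) :: l) n - sd_sum s1 (d n) (d1 n) (at_size n l)) +
   \sum_(k < size l) N (if (nth (s1, d1) l k).1 == s1 then
      trace_seq (fun n i => d n i * eta s1 (trace_seq d1 (take k l) n) *
        (nth (s1, d1) l k).2 n i) (drop k.+1 l) n else 0).
  rewrite -{1}(subrK (sd_sum s1 (d n) (d1 n) (at_size n l)) (trace_seq d _ n)).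
  apply: le_trans (cnormD _ _) _; rewrite lerD2l sd_sum_at_size; exact: cnorm_sum.
split=> d bd.
  have [D hD] := cvg0_bounded (sd_vanish s1 bd b1 bl').
  have /choice[F hF] : forall k : 'I_(size l), exists C, forall n,
      N (if (nth (s1, d1) l k).1 == s1 then
      trace_seq (fun n i => d n i * eta s1 (trace_seq d1 (take k l) n) *
        (nth (s1, d1) l k).2 n i) (drop k.+1 l) n else 0) <= C.
    move=> k; case: (_ == s1); last by exists 0 => n; rewrite cnorm0.
    have [hb _] := IH _ (small k) (drop k.+1 l) erefl (lbound_drop _ bl').
    exact: hb (term _ k bd).
  exists (D + \sum_k F k) => n; apply: le_trans (split_le d n) _.
  by rewrite lerD ?hD //; apply: ler_sum => k _; exact: hF.
apply: (cvg0_squeeze (fun n => andb_true_intro (conj (cnorm_ge0 _) (split_le d n)))).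
apply: cvg0D; first exact: sd_vanish (null_dominated bd) b1 bl'.
apply: sumr_cvg0 => k; case: (_ == s1); last by rewrite cnorm0; exact: cvg_cst.
have [hb hn] := IH _ (small k) (drop k.+1 l) erefl (lbound_drop _ bl').
apply: hn; apply: nullMr; last exact: lbound_nth.
apply: nullMr => //.
have [|hb' _] := IH (size (take k l)) _ (take k l) erefl (lbound_take k bl').
  by rewrite -sl size_take ltn_ord /= ltnS ltnW.
have [C hC] := hb' _ b1; apply: (@dominated_bounded _ _ _ (C1 * C)) => n.
by apply: le_trans (hC1 _ _) _; rewrite ler_wpM2l.
Qed.

Section Limits.
Variables (T : Type) (b : forall n, T -> 'I_n.+1 -> B).
Arguments b : clear implicits.
Hypothesis b_dominated : forall t, dominated (fun n i => b n t i).

Fixpoint diag_eval n (p : @bpoly R B T) (i : 'I_n.+1) : B :=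
  match p with
  | PConst c => c
  | PVar t => b n t i
  | PVarStar t => star (b n t i)
  | PAdd p q => diag_eval p i + diag_eval q i
  | PMul p q => diag_eval p i * diag_eval q i
  end.

Definition diag_seq (p : @bpoly R B T) : dseq := fun n i => diag_eval p i.

Lemma diag_dominated p : dominated (diag_seq p).
Proof.
elim: p => [c|t|t|p IHp q IHq|p IHp q IHq].
- exact: (@dominated_bounded _ _ (fun=> c) (N c)).
- exact: b_dominated.
- by have [g gb hg] := b_dominated t; exists g => // n i; rewrite cnorm_star.
- exact: dominatedD.
- exact: dominatedM.
Qed.

Hypothesis b_cvg : cvg_weakly (fun n => jdist (mat_expect n E)
      (fun t => mat_incl P (mat_D (b n t)))).
Local Notation Ym n := (fun s => mat_Y (a n s)).
Local Notation Dm n := (fun t => mat_incl P (mat_D (b n t))).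

Lemma mat_inclDE n (d : 'I_n.+1 -> B) i j :
  mat_incl P (mat_D d) i j = em (d i) *+ (i == j).
Proof. by rewrite !mxE raddfMn. Qed.

Lemma mat_diag_eval n (p : @bpoly R B T) :
  bpoly_eval (Dm n) p = mat_incl P (mat_D (diag_eval p)).
Proof.
elim: p => [c|t|t|p IHp q IHq|p IHp q IHq] /=; apply/matrixP => i j.
- by rewrite mat_inclDE mat_embE.
- by [].
- rewrite mat_inclDE [LHS]mxE mat_inclDE eq_sym; case: eqP => [->|_].
    by rewrite !mulr1n emb_star.
  by rewrite !mulr0n star0.
- by rewrite IHp IHq [LHS]mxE !mat_inclDE rmorphD mulrnDl.
- rewrite IHp IHq [LHS]mxE mat_inclDE (bigD1 i) //= big1 ?addr0; last first.
    by move=> k; rewrite eq_sym => /negbTE ki; rewrite mat_inclDE ki mul0r.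
  by rewrite !mat_inclDE eqxx mulr1n rmorphM mulrnAr.
Qed.

Lemma b_cvg_diag (p : @bpoly R B T) :
  norm_cvg (fun n => n.+1%:R^-1 *: \sum_(i < n.+1) diag_eval p i).
Proof.
have [L hL] := b_cvg p; exists L; move: hL; rewrite /norm_cvg_to.
rewrite (_ : (fun n => N (jdist _ _ _ - L)) = fun n =>
   N (n.+1%:R^-1 *: \sum_(i < n.+1) diag_eval p i - L)) //.
rewrite boolp.funeqE => n; rewrite /jdist mat_diag_eval /mat_expect.
congr (N (_ *: _ - _)); apply: eq_bigr => i _.
by rewrite mat_inclDE eqxx mulr1n expect_emb.
Qed.

Implicit Types (p : @bpoly R B T) (w : seq (S * @bpoly R B T)).

Definition diag_word w : seq (S * dseq) := [seq (x.1, diag_seq x.2) | x <- w].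

Lemma diag_word_dominated w : lbound (@dominated R B) (diag_word w).
Proof. by elim: w => //= x w IH; split => //; exact: diag_dominated. Qed.

Definition lim_trace p w : B :=
  xget 0 [set L | norm_cvg_to (trace_seq (diag_seq p) (diag_word w)) L].

Lemma lim_traceE p w L : norm_cvg_to (trace_seq (diag_seq p) (diag_word w)) L ->
  lim_trace p w = L.
Proof. by move=> h; rewrite /lim_trace; case: xgetP => [y _ hy|/(_ L)//]; exact: norm_cvg_unique hy h. Qed.

Definition sd_rhs s1 p0 p1 w : B := \sum_(k < size w)
  if (nth (s1, p1) w k).1 == s1 then
    lim_trace (PMul (PMul p0 (PConst _ (eta s1 (lim_trace p1 (take k w)))))
      (nth (s1, p1) w k).2) (drop k.+1 w) else 0.

(** In the approximate equation, replacing the inner traces by their limits changes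
    the first diagonal factor of the outer ones by a null sequence. *)
Lemma sd_step s1 p0 p1 w :
  (forall k p, (k < size w)%N ->
    norm_cvg_to (trace_seq (diag_seq p) (diag_word (take k w))) (lim_trace p (take k w)) /\
    norm_cvg_to (trace_seq (diag_seq p) (diag_word (drop k.+1 w))) (lim_trace p (drop k.+1 w))) ->
  norm_cvg_to (trace_seq (diag_seq p0) (diag_word ((s1, p1) :: w))) (sd_rhs s1 p0 p1 w).
Proof.
move=> h; set d0 := diag_seq p0; set d1 := diag_seq p1; set l := diag_word w.
pose F n := sd_sum s1 (d0 n) (d1 n) (at_size n l).
have bd := diag_dominated; have bl : lbound (@dominated R B) l := diag_word_dominated w.
suff cF : norm_cvg_to F (sd_rhs s1 p0 p1 w).
  exact: norm_cvg_close (sd_vanish s1 (bd p0) (bd p1) bl) cF.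
have FE : F = fun n => \sum_(k < size w) if (nth (s1, p1) w k).1 == s1 then
      trace_seq (fun n i => d0 n i * eta s1 (trace_seq d1 (take k l) n) *
        diag_seq (nth (s1, p1) w k).2 i) (drop k.+1 l) n else 0.
  rewrite boolp.funeqE => n; rewrite /F sd_sum_at_size size_map.
  by apply: eq_bigr => k _; rewrite (nth_map (s1, p1)).
rewrite FE; apply: norm_cvg_sum => k; case: (_ == s1); last exact: norm_cvg_cst.
set q := (nth _ _ _).2; set L := lim_trace p1 (take k w).
have [ck _] := h k p1 (ltn_ord k).
have [_ dk] := h k (PMul (PMul p0 (PConst T (eta s1 L))) q) (ltn_ord k).
apply: norm_cvg_close dk; rewrite /l -map_take -map_drop.
have bw := diag_word_dominated (drop k.+1 w).
have [_ hn] := trace_asymptotics erefl bw.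
have nz : null (fun n i => d0 n i * (eta s1 (trace_seq d1 (diag_word (take k w)) n) - eta s1 L) *
    diag_seq q i).
  apply: nullMr; last exact: bd.
  apply: nullMl; first exact: bd.
  apply: null_cvg; have [C C0 hC] := eta_bound.
  apply: (@cvg0_squeeze _ _ (fun n => C * N (trace_seq d1 (diag_word (take k w)) n - L))).
    by move=> n; rewrite cnorm_ge0 /= -linearB; exact: hC.
  by apply: cvg0Ml; exact: ck.
have := hn _ nz; apply: cvg0_squeeze => n; rewrite cnorm_ge0 /= traceB.
rewrite le_eqVlt; apply/orP; left; apply/eqP; congr N; apply: trace_ext => i /=.
by rewrite mulrBr mulrBl.
Qed.

Lemma lim_trace_cvg w p :
  norm_cvg_to (trace_seq (diag_seq p) (diag_word w)) (lim_trace p w).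
Proof.
move: {2}(size w) (erefl (size w)) => m; elim/ltn_ind: m w p => m IH w p sw.
suff [L hL] : norm_cvg (trace_seq (diag_seq p) (diag_word w)) by rewrite (lim_traceE hL).
case: w sw => [|[s1 p1] w] sw.
  have [L hL] := b_cvg_diag p; exists L.
  by rewrite /trace_seq (_ : (fun n => _) = fun n => n.+1%:R^-1 *: \sum_(i < n.+1) diag_eval p i) //
     boolp.funeqE => n; rewrite trace_nil.
exists (sd_rhs s1 p p1 w); apply: sd_step => k q kw; split.
  by apply: IH erefl; rewrite -sw size_take kw /= ltnS ltnW.
by apply: IH erefl; rewrite -sw size_drop /=; lia.
Qed.

Lemma lim_trace_sd s1 p0 p1 w : lim_trace p0 ((s1, p1) :: w) = sd_rhs s1 p0 p1 w.
Proof. by apply: lim_traceE; apply: sd_step => k p kw; split; exact: lim_trace_cvg. Qed.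

Local Notation letter := (@bpoly R B T + S)%type.

Lemma normal_form_val n (w : seq letter) : word_val (Ym n) (Dm n) w =
  mat_incl P (mat_D (diag_eval (normal_form w).1)) *
  \prod_(x <- (normal_form w).2) (mat_Y (a n x.1) * mat_incl P (mat_D (diag_eval x.2))).
Proof.
have D1 : mat_incl P (mat_D (fun _ : 'I_n.+1 => 1)) = 1 :> mat_balg P n.
  by apply/matrixP => i j; rewrite mat_inclDE rmorph1 mxE.
rewrite /word_val; elim: w => [|[p|s] w IH] /=; first by rewrite !big_nil D1 mulr1.
  rewrite big_cons IH /= mulrA; congr (_ * _).
  have := mat_diag_eval n (PMul p (normal_form w).1); rewrite /= => <-.
  by rewrite !mat_diag_eval.
by rewrite big_cons IH /= big_cons D1 mul1r mulrA.
Qed.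

Lemma mat_word_entry n (l : seq (S * @bpoly R B T)) i j :
  (\prod_(x <- l) (mat_Y (a n x.1) * mat_incl P (mat_D (diag_eval x.2))) : mat_balg P n) i j =
  \sum_(q <- words 'I_n.+1 (size l)) (if last i q == j then
     walk_term (a n) i (at_size n (diag_word l)) q else 0).
Proof.
elim: l i => [|x l IH] i.
  by rewrite big_nil big_seq1 /= mxE; case: eqP.
rewrite big_cons big_words [LHS]mxE; apply: eq_bigr => k _.
rewrite IH mulr_sumr; apply: eq_bigr => q _ /=.
case: ifP => _; last by rewrite mulr0.
congr (_ * _); rewrite [LHS]mxE (bigD1 k) //= big1 ?addr0; last first.
  by move=> h /negbTE hk; rewrite mat_inclDE hk mulr0.
by rewrite mat_inclDE eqxx mulr1n mxE.
Qed.

Lemma mat_expect_word n (w : seq letter) : mat_expect n E (word_val (Ym n) (Dm n) w) =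
  trace_seq (diag_seq (normal_form w).1) (diag_word (normal_form w).2) n.
Proof.
rewrite normal_form_val /mat_expect /trace_seq /trace; congr (_ *: _).
apply: eq_bigr => i _; rewrite mxE (bigD1 i) //= [X in _ + X]big1 ?addr0; last first.
  by move=> k; rewrite eq_sym => /negbTE ki; rewrite mat_inclDE ki mul0r.
rewrite mat_inclDE eqxx mulr1n expect_embl mat_word_entry linear_sum mulr_sumr.
rewrite !size_map; apply: eq_bigr => q _.
by case: ifP => _; rewrite ?linear0 ?mulr0.
Qed.

Definition word_lim (w : seq letter) : B := lim_trace (normal_form w).1 (normal_form w).2.

Lemma word_lim_cvg (w : seq letter) : norm_cvg_to
  (fun n => mat_expect n E (word_val (Ym n) (Dm n) w)) (word_lim w).
Proof.
rewrite (_ : (fun n => _) = trace_seq (diag_seq (normal_form w).1)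
   (diag_word (normal_form w).2)).
  exact: lim_trace_cvg.
by rewrite boolp.funeqE => n; rewrite mat_expect_word.
Qed.

Lemma lim_trace_ext (p p' : @bpoly R B T) w :
  (forall n (i : 'I_n.+1), diag_eval p i = diag_eval p' i) ->
  lim_trace p w = lim_trace p' w.
Proof.
move=> pp; rewrite /lim_trace (_ : trace_seq (diag_seq p) (diag_word w) =
  trace_seq (diag_seq p') (diag_word w)) //.
by rewrite boolp.funeqE => n; apply: trace_ext => i; exact: pp.
Qed.

Lemma word_lim_sd p s (w : seq letter) : word_lim (inl p :: inr s :: w) =
  \sum_(uv <- splits s w) word_lim (inl p :: inl (PConst T (eta s (word_lim uv.1))) :: uv.2).
Proof.
rewrite [LHS]lim_trace_sd.
rewrite /word_lim /=.
rewrite (splits_normal_form s w (s, (normal_form w).1) (fun x y => lim_trace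
  (PMul p (PMul (PConst T (eta s (lim_trace x.1 x.2))) y.1)) y.2)).
apply: eq_bigr => k _; case: ifP => // _; apply: lim_trace_ext => n i /=.
by rewrite mulr1 !mulrA.
Qed.

(** The equations of lim_trace_sd carry over to the limit space, where they are
    stated for arbitrary words instead of normal forms. *)
Lemma limit_law : exists (Q : bprob B) (Y : S -> Q) (D : T -> Q),
  [/\ cvg_weakly_to (fun n => jdist (mat_expect n E) (sumfam (Ym n) (Dm n)))
        (jdist (expect Q) (sumfam Y D)),
      forall s, star (Y s) = Y s &
      forall p s (w : seq letter), expect Q (bpoly_eval D p * Y s * word_val Y D w) =
        \sum_(uv <- splits s w) expect Q (bpoly_eval D p *
           emb Q (eta s (expect Q (word_val Y D uv.1))) * word_val Y D uv.2)].
Proof.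
have sYm n s : star (mat_Y (a n s)) = mat_Y (a n s) :> mat_balg P n.
  by apply/matrixP => i j; rewrite [LHS]mxE !mxE -a_star.
have [|Q [y [hcvg hid]]] := @limit_bprob R B (fun n => mat_bprob P n) (S + T)%type
    (fun n => sumfam (Ym n) (Dm n)).
  move=> q; exists (\sum_(w <- poly_words q) word_lim w).
  rewrite (_ : (fun n => _) = fun n => \sum_(w <- poly_words q)
      mat_expect n E (word_val (Ym n) (Dm n) w)).
    by apply: norm_cvg_sum => w; exact: word_lim_cvg.
  rewrite boolp.funeqE => n; rewrite (@poly_words_eval _ _ S T (mat_balg P n)) //.
  by rewrite [LHS](linear_sum (mat_expect n E)).
pose Y s := y (inl s); pose D t := y (inr t).
have yE : y = sumfam Y D by rewrite boolp.funeqE => -[].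
exists Q, Y, D.
have wE (w : seq letter) : expect Q (word_val Y D w) = word_lim w.
  have := hcvg (word_poly w); rewrite yE word_poly_eval => /norm_cvg_unique; apply.
  rewrite (_ : (fun n => _) = fun n => mat_expect n E (word_val (Ym n) (Dm n) w)).
    exact: word_lim_cvg.
  by rewrite boolp.funeqE => n; rewrite -(@word_poly_eval _ _ S T (mat_balg P n)).
split.
- by move=> q; rewrite -yE; exact: hcvg.
- move=> s; apply: (hid (PVarStar B (inl s)) (PVar B (inl s))) => n /=.
  exact: sYm.
- move=> p s w.
  have -> : bpoly_eval D p * Y s * word_val Y D w = word_val Y D (inl p :: inr s :: w).
    by rewrite /word_val !big_cons mulrA.
  rewrite wE word_lim_sd; apply: eq_bigr => uv _.
  by rewrite -wE /word_val !big_cons mulrA wE.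
Qed.

End Limits.

End MatrixModel.

(** * Freeness *)

Section Freeness.
Variables (R : realType) (B : cstarType R) (S : eqType) (T : Type) (A : bprob B).
Variables (Y : S -> A) (D : T -> A) (eta : S -> {linear B -> B}).
Local Notation E := (expect A).
Local Notation em := (emb A).
Local Notation bpolyT := (@bpoly R B T).
Local Notation letter := (bpolyT + S)%type.
Local Notation dval := (bpoly_eval D).
Local Notation wval := (word_val Y D).
Implicit Types (w u v : seq letter) (p q : bpolyT) (s : S).

Hypothesis Y_star : forall s, star (Y s) = Y s.
Hypothesis schwinger_dyson : forall p s w, E (dval p * Y s * wval w) =
  \sum_(uv <- splits s w) E (dval p * em (eta s (E (wval uv.1))) * wval uv.2).

Lemma splits_sum_eq (V : zmodType) s w (F G : seq letter -> seq letter -> V) :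
  (forall u v, w = u ++ inr s :: v -> F u v = G u v) ->
  \sum_(uv <- splits s w) F uv.1 uv.2 = \sum_(uv <- splits s w) G uv.1 uv.2.
Proof.
elim: w F G => [|x w IH] F G FG /=; first by rewrite !big_nil.
rewrite !big_cat !big_map /=; congr (_ + _); last first.
  by apply: (IH (fun u => F (x :: u)) (fun u => G (x :: u))) => u v e; apply: FG; rewrite e.
case: x FG => [p _|s' FG]; first by rewrite !big_nil.
by case: eqP FG => [-> FG|_ _]; rewrite ?big_nil // !big_seq1 /=; exact: (FG [::]).
Qed.

Lemma splits_sum0 (V : zmodType) s w (F : seq letter -> seq letter -> V) :
  (forall u v, w = u ++ inr s :: v -> F u v = 0) ->
  \sum_(uv <- splits s w) F uv.1 uv.2 = 0.
Proof. by move=> h; rewrite (splits_sum_eq (G := fun _ _ => 0) h) big1. Qed.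

Lemma splits_cat (V : zmodType) s w w' (F : seq letter -> seq letter -> V) :
  \sum_(uv <- splits s (w ++ w')) F uv.1 uv.2 =
  \sum_(uv <- splits s w) F uv.1 (uv.2 ++ w') +
  \sum_(uv <- splits s w') F (w ++ uv.1) uv.2.
Proof.
elim: w F => [|x w IH] F /=; first by rewrite big_nil add0r.
rewrite !big_cat !big_map /= (IH (fun u => F (x :: u))) addrA; congr (_ + _ + _).
by case: x => [p|s']; rewrite ?big_nil //; case: eqP => _; rewrite ?big_nil ?big_seq1.
Qed.

Lemma wval_cons x w : wval (x :: w) = letter_eval Y D x * wval w.
Proof. by rewrite /word_val big_cons. Qed.

Lemma wval_nil : wval [::] = 1. Proof. by rewrite /word_val big_nil. Qed.

Definition yletter s (x : letter) : bool :=
  match x with inl (PConst _) => true | inl _ => false | inr s' => s' == s end.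
Definition yword s w := all (yletter s) w.
Definition ydeg w := count (fun x : letter => if x is inr _ then true else false) w.

Lemma yword_cases s w : yword s w ->
  (exists2 c, wval w = em c & ydeg w = 0%N) \/
  (exists c w', [/\ wval w = em c * Y s * wval w', yword s w' & ydeg w = (ydeg w').+1]).
Proof.
elim: w => [_|x w IH /= /andP[xs ws]].
  by left; exists 1; rewrite ?wval_nil ?rmorph1.
case: x xs => [[c| | | |]|s'] //= xs; last first.
  right; exists 1, w; rewrite wval_cons /= rmorph1 mul1r (eqP xs); split=> //.
case: (IH ws) => [[c' e d]|[c' [w' [e yw d]]]].
  by left; exists (c * c'); rewrite // wval_cons /= e rmorphM.
by right; exists (c * c'), w'; rewrite wval_cons /= e rmorphM !mulrA; split.
Qed.

Lemma yword_split s s' w u v : yword s w -> w = u ++ inr s' :: v ->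
  [/\ s' = s, yword s u, yword s v & ydeg w = (ydeg u + (ydeg v).+1)%N].
Proof.
move=> yw e; move: yw; rewrite e /yword all_cat /= => /and3P[yu /eqP-> yv].
by rewrite /ydeg count_cat.
Qed.

Local Notation block := (bpolyT + S * seq letter)%type.
Implicit Types (x : block) (l : seq block).

Definition centered w : A := wval w - em (E (wval w)).

(** Factors of alternating products: inl p stands for the element p of the algebra
    of the D_t, and inr (s, w) for the centered word w - E w. *)
Definition block_val x : A := match x with inl p => dval p | inr sw => centered sw.2 end.
Definition blocks_val l : A := \prod_(x <- l) block_val x.
Definition block_label x : option S := match x with inl _ => None | inr sw => Some sw.1 end.
Definition block_ok x : Prop :=
  match x with inl p => E (dval p) = 0 | inr sw => yword sw.1 sw.2 end.
Definition blocks_deg l := sumn [seq (match x with inl _ => 0 | inr sw => ydeg sw.2 end)%N | x <- l].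
Definition alternating (ks : seq (option S)) := sorted (fun k k' => k != k') ks.

Fixpoint every (X : Type) (Q : X -> Prop) (l : seq X) : Prop :=
  if l is x :: l' then Q x /\ every Q l' else True.

Lemma every_cat (X : Type) (Q : X -> Prop) (l l' : seq X) :
  every Q (l ++ l') <-> every Q l /\ every Q l'.
Proof. by elim: l => [|x l IH] /=; tauto. Qed.

Lemma blocks_val_cons x l : blocks_val (x :: l) = block_val x * blocks_val l.
Proof. by rewrite /blocks_val big_cons. Qed.

Lemma blocks_val_cat l l' : blocks_val (l ++ l') = blocks_val l * blocks_val l'.
Proof. by rewrite /blocks_val big_cat. Qed.

Lemma blocks_val_nil : blocks_val [::] = 1.
Proof. by rewrite /blocks_val big_nil. Qed.

(** The terms of the Schwinger-Dyson equation for Y_s in which Y_s is paired with a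
    letter of one of the blocks of l, where z is the product of what lies between
    Y_s and l. *)
Fixpoint paired_in_blocks p s (z : A) l : B :=
  match l with
  | [::] => 0
  | x :: l' =>
    (if x is inr sw then \sum_(uv <- splits s sw.2)
        E (dval p * em (eta s (E (z * wval uv.1))) * (wval uv.2 * blocks_val l'))
     else 0) + paired_in_blocks p s (z * block_val x) l'
  end.

Lemma paired_in_blocksB p s z z' l :
  paired_in_blocks p s (z - z') l = paired_in_blocks p s z l - paired_in_blocks p s z' l.
Proof.
elim: l z z' => [|x l IH] z z' /=; first by rewrite subr0.
rewrite mulrBl IH opprD addrACA; congr (_ + _).
case: x => [q|sw]; first by rewrite subr0.
rewrite -sumrB; apply: eq_bigr => uv _.
by rewrite mulrBl !linearB /= mulrBr mulrBl linearB.
Qed.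

(** The blocks of l are absorbed into w one by one, a centered block being a
    difference of two words. *)
Lemma sd_blocks p s w l : E (dval p * Y s * (wval w * blocks_val l)) =
  \sum_(uv <- splits s w)
    E (dval p * em (eta s (E (wval uv.1))) * (wval uv.2 * blocks_val l)) +
  paired_in_blocks p s (wval w) l.
Proof.
elim: l w => [|x l IH] w.
  rewrite blocks_val_nil mulr1 schwinger_dyson addr0.
  by apply: eq_bigr => uv _; rewrite mulr1.
rewrite blocks_val_cons; case: x => [q|sw] /=.
  have qE : dval q = wval [:: inl q] by rewrite wval_cons wval_nil mulr1.
  rewrite add0r qE [wval w * (_ * _)]mulrA -word_val_cat IH; congr (_ + _).
  rewrite (splits_cat s w _ (fun u v => E (dval p * em (eta s (E (wval u))) * (wval v * blocks_val l)))).
  rewrite /= big_nil addr0; apply: eq_bigr => uv _.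
  by rewrite word_val_cat -mulrA -!mulrA.
case: sw => s' w2 /=; set c := E (wval w2).
have cE : em c = wval [:: inl (PConst T c)] by rewrite wval_cons wval_nil mulr1.
have -> : wval w * (centered w2 * blocks_val l) =
   wval (w ++ w2) * blocks_val l - wval (w ++ [:: inl (PConst T c)]) * blocks_val l.
  by rewrite !word_val_cat -cE -!mulrA -mulrBr -mulrBl.
rewrite mulrBr linearB /= !IH.
rewrite !(splits_cat s w _ (fun u v => E (dval p * em (eta s (E (wval u))) * (wval v * blocks_val l)))).
rewrite /= big_nil addr0 opprD addrACA -paired_in_blocksB.
rewrite !word_val_cat -cE -mulrBr -/c -/(centered w2) [RHS]addrA; congr (_ + _).
rewrite addrAC -sumrB; congr (_ + _); apply: eq_bigr => uv _ /=.
  by rewrite -linearB /= -mulrBr !word_val_cat -cE -!mulrA -mulrBr -mulrBl.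
by rewrite word_val_cat.
Qed.

Lemma paired_in_blocks0 p s z l :
  (forall l1 s' w l2 u v, l = l1 ++ inr (s', w) :: l2 -> w = u ++ inr s :: v ->
     E (z * blocks_val l1 * wval u) = 0) ->
  paired_in_blocks p s z l = 0.
Proof.
elim: l z => //= x l IH z h; rewrite IH ?addr0.
  case: x h => // -[s' w] h /=.
  apply: (splits_sum0 (F := fun u v => E (dval p * em (eta s (E (z * wval u))) * (wval v * blocks_val l)))).
  move=> u v wE; have := h [::] s' w l u v erefl wE.
  by rewrite blocks_val_nil mulr1 => ->; rewrite linear0 rmorph0 mulr0 mul0r linear0.
move=> l1 s' w l2 u v lE wE.
rewrite -[z * _ * _]mulrA -blocks_val_cons; apply: h wE; rewrite lE.
exact: cat_cons.
Qed.

Lemma alternating_infix ks ks1 ks2 : alternating (ks1 ++ ks ++ ks2) -> alternating ks.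
Proof.
by rewrite /alternating => /cat_sorted2[_ /cat_sorted2[]].
Qed.

(** Apply the Schwinger-Dyson equation to the first letter Y_s of w. If it is paired
    inside w, center the part v of w to the right of its partner: the centered
    part gives the products of the second hypothesis, and the scalar parts add up
    to E w times the rest, which the centering of w subtracts. If it is paired
    with a letter of a block of l, some block separates them, because neighbouring
    labels differ; what lies in between is, up to centering of its two ends, a
    shorter alternating product and has expectation 0. *)
Lemma alternating_step p s w l :
  (forall l', l' <> [::] -> alternating (map block_label l') -> every block_ok l' ->
     (blocks_deg l' < ydeg w + blocks_deg l)%N -> E (blocks_val l') = 0) ->
  (forall c v, yword s v -> (ydeg v < ydeg w)%N ->
     E (dval p * em c * (centered v * blocks_val l)) = 0) ->
  yword s w -> alternating (Some s :: map block_label l) -> every block_ok l ->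
  E (dval p * (centered w * blocks_val l)) = 0.
Proof.
move=> IH H yw alt ok.
case: (yword_cases yw) => [[c e _]|[c [w' [e yw' dw]]]].
  by rewrite /centered e expect_emb subrr mul0r mulr0 linear0.
have centered_add z : wval z = centered z + em (E (wval z)) by rewrite subrK.
pose p' := PMul p (PConst T c).
have p'E : dval p' = dval p * em c by [].
have extra0 : paired_in_blocks p' s (wval w') l = 0.
  apply: paired_in_blocks0 => l1 s' w2 l2 u v lE w2E.
  have ok2 : every block_ok (l1 ++ inr (s', w2) :: l2) by rewrite -lE.
  have [ok1 /= [yw2 _]] := proj1 (every_cat _ _ _) ok2.
  have [es yu _ dw2] := yword_split yw2 w2E; subst s'.
  have altl1 : alternating (Some s :: map block_label l1 ++ [:: Some s]).
    move: alt; rewrite lE map_cat /= -cat_rcons -cats1 -[Some s :: _]cat0s.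
    by move=> /(@alternating_infix (Some s :: _ ++ [:: Some s]) [::]).
  have l1n : l1 <> [::] by move=> l1E; move: altl1; rewrite l1E /alternating /= eqxx.
  have degs : blocks_deg l = (blocks_deg l1 + ydeg w2 + blocks_deg l2)%N.
    by rewrite lE /blocks_deg map_cat sumn_cat /= addnA.
  rewrite (centered_add w') (centered_add u); set c1 := E (wval w'); set c2 := E (wval u).
  have oku : every block_ok [:: inr (s, u)] by [].
  have Z1 : E (blocks_val (inr (s, w') :: l1 ++ [:: inr (s, u)])) = 0.
    apply: IH => //=; first by rewrite map_cat.
      by split => //; apply/every_cat.
    by rewrite /blocks_deg /= map_cat sumn_cat /= addn0 -!/(blocks_deg _) degs dw; lia.
  have Z2 : E (blocks_val (inr (s, w') :: l1)) = 0.
    apply: IH => //=.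
      by move: altl1; rewrite -[Some s :: _ ++ _]cat0s -cat_cons => /alternating_infix.
    by rewrite /blocks_deg /= -!/(blocks_deg _) degs dw; lia.
  have Z3 : E (blocks_val (l1 ++ [:: inr (s, u)])) = 0.
    apply: IH => //=; first by case: (l1).
    - rewrite map_cat; move: altl1; rewrite -cat1s -[_ ++ [:: _]]cats0 => /alternating_infix.
      by rewrite cats0.
    - exact/every_cat.
    by rewrite /blocks_deg map_cat sumn_cat /= addn0 -!/(blocks_deg _) degs dw; lia.
  have Z4 : E (blocks_val l1) = 0.
    apply: IH => //=.
      by move: altl1; rewrite -cat1s => /alternating_infix.
    by rewrite degs dw; lia.
  move: Z1 Z2 Z3; rewrite !(blocks_val_cons, blocks_val_cat) /= blocks_val_nil mulr1.
  move: (centered w') (centered u) (blocks_val l1) Z4 => x y z Z4 Z1 Z2 Z3.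
  rewrite !mulrDl !mulrDr !linearD /= -!mulrA Z1 [x * (_ * em c2)]mulrA.
  by rewrite !expect_embl !expect_embr Z2 Z3 Z4 !(mul0r, mulr0, addr0).
have Ew : E (wval w) = \sum_(uv <- splits s w') c * eta s (E (wval uv.1)) * E (wval uv.2).
  rewrite e; have := schwinger_dyson (PConst T c) s w'; rewrite /= => ->.
  by apply: eq_bigr => uv _; rewrite -mulrA !expect_embl mulrA.
rewrite {1}/centered mulrBl mulrBr linearB /= {1}e -!mulrA !mulrA -p'E.
rewrite -[dval p' * _ * _ * _]mulrA sd_blocks extra0 addr0.
rewrite Ew rmorph_sum /= mulr_sumr mulr_suml linear_sum -sumrB.
apply: (splits_sum0 (F := fun u v => E (dval p' * em (eta s (E (wval u))) * (wval v * blocks_val l)) -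
   E (dval p * em (c * eta s (E (wval u)) * E (wval v)) * blocks_val l))).
move=> u v w'E; have [_ _ yv dw'] := yword_split yw' w'E.
have := H (c * eta s (E (wval u))) v yv; rewrite dw dw' => /(_ _)/[!mulrA] h.
rewrite -linearB /= -[RHS]h; last by lia.
congr (E _); rewrite /centered !rmorphM /= mulrBr !mulrBl !mulrA //.
Qed.

(** Induction on the number of letters Y. The leading block in the algebra of the
    D_t, if any, is a spectator of alternating_step, and remains centered when
    multiplied by elements of B on the right. *)
Theorem blocks_free l : l <> [::] -> alternating (map block_label l) ->
  every block_ok l -> E (blocks_val l) = 0.
Proof.
move: {2}(blocks_deg l) (erefl (blocks_deg l)) => N; elim/ltn_ind: N l => N IH l dN ln alt ok.
have IH' l' : l' <> [::] -> alternating (map block_label l') -> every block_ok l' ->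
     (blocks_deg l' < N)%N -> E (blocks_val l') = 0.
  by move=> h1 h2 h3 h4; exact: IH h4 l' erefl h1 h2 h3.
case: l dN ln alt ok => // -[p|[s w]] l dN _ /= alt [ok okl]; last first.
  rewrite blocks_val_cons /= -[centered w * _]mul1r -(rmorph1 em).
  apply: (@alternating_step (PConst T 1) s w l) => //.
    by move=> l' h1 h2 h3 h4; apply: IH' => //; move: dN h4; rewrite /blocks_deg /=; lia.
  move=> c v yv dv; rewrite /= rmorph1 mul1r expect_embl.
  rewrite -[centered v](_ : block_val (inr (s, v)) = _) // -blocks_val_cons.
  rewrite IH' ?mulr0 //.
  by move: dN; rewrite /blocks_deg /=; lia.
case: l dN alt okl => [|[q|[s w]] l] dN //= alt okl.
  by rewrite blocks_val_cons blocks_val_nil mulr1.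
case: okl => yw okl; rewrite !blocks_val_cons /=.
apply: (@alternating_step p s w l) => //.
  by move=> l' h1 h2 h3 h4; apply: IH' => //; move: dN h4; rewrite /blocks_deg /=; lia.
move=> c v yv dv.
have := IH' (inl (PMul p (PConst T c)) :: inr (s, v) :: l).
rewrite !blocks_val_cons /=; apply => //.
  by rewrite expect_embr ok mul0r.
by move: dN; rewrite /blocks_deg /=; lia.
Qed.

Lemma star_gen_min (G C : set A) : is_star_subalg C -> G `<=` C -> star_gen G `<=` C.
Proof. by move=> hC GC x; apply; split. Qed.

Lemma star_gen_range_D z : star_gen (range D) z -> exists p, z = dval p.
Proof.
apply: (@star_gen_min _ [set z | exists p, z = dval p]); last first.
  by move=> _ [t _ <-]; exists (PVar B t).
split=> [c|_ _ [p ->] [q ->]|_ _ [p ->] [q ->]|_ [p ->]].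
- by exists (PConst T c).
- by exists (PAdd p q).
- by exists (PMul p q).
- by exists (bpoly_star p); rewrite bpoly_eval_star.
Qed.

Definition star_letter (x : letter) : letter :=
  match x with inl p => inl (bpoly_star p) | inr s => inr s end.

Lemma wval_star w : star (wval w) = wval (rev (map star_letter w)).
Proof.
elim: w => [|x w IH]; first by rewrite wval_nil star1.
rewrite wval_cons starM IH /= rev_cons -cats1 word_val_cat wval_cons wval_nil mulr1.
by congr (_ * _); case: x => [p|s] /=; rewrite ?bpoly_eval_star ?Y_star.
Qed.

Lemma yword_star s w : yword s w -> yword s (rev (map star_letter w)).
Proof.
rewrite /yword all_rev all_map; apply: sub_all => -[[c|t|t|p q|p q]|s'] //=.
Qed.

Lemma star_gen_Y s z : star_gen [set Y s] z ->
  exists2 ws, all (yword s) ws & z = \sum_(w <- ws) wval w.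
Proof.
apply: (@star_gen_min _ [set z | exists2 ws, all (yword s) ws & z = \sum_(w <- ws) wval w]); last first.
  move=> _ ->; exists [:: [:: inr s]]; rewrite /= ?eqxx //.
  by rewrite big_seq1 wval_cons wval_nil mulr1.
split=> [c|_ _ [u yu ->] [v yv ->]|_ _ [u yu ->] [v yv ->]|_ [u yu ->]].
- exists [:: [:: inl (PConst T c)]] => //.
  by rewrite big_seq1 wval_cons wval_nil mulr1.
- by exists (u ++ v); rewrite ?all_cat ?yu ?big_cat.
- exists [seq c ++ d | c <- u, d <- v].
    elim: u yu => //= c u IH /andP[yc /IH yu]; rewrite all_cat yu andbT all_map.
    by apply: sub_all yv => d yd /=; rewrite /yword all_cat; apply/andP.
  rewrite mulr_suml big_allpairs_dep; apply: eq_bigr => c _.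
  by rewrite mulr_sumr; apply: eq_bigr => d _; rewrite word_val_cat.
- exists [seq rev (map star_letter w) | w <- u].
    by rewrite all_map; apply: sub_all yu => w; exact: yword_star.
  by rewrite star_sum big_map; apply: eq_bigr => w _; rewrite wval_star.
Qed.

(** By multilinearity, centered elements of the algebra of Y_s may be replaced by
    centered words. *)
Lemma alternating_centered (g : seq (option S * A)) l :
  every (fun kz => star_gen (free_blocks Y D kz.1) kz.2 /\ E kz.2 = 0) g ->
  every block_ok l -> alternating (map block_label l ++ map fst g) ->
  (l <> [::] \/ g <> [::]) -> E (blocks_val l * \prod_(kz <- g) kz.2) = 0.
Proof.
elim: g l => [|[k z] g IH] l /=.
  by move=> _ ok alt [ln|//]; rewrite big_nil mulr1 cats0 in alt *; exact: blocks_free.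
move=> [[gz Ez] hg] ok alt _; rewrite big_cons /= mulrA.
have step x : block_label x = k -> block_ok x ->
    E (blocks_val l * block_val x * \prod_(kz <- g) kz.2) = 0.
  move=> xk okx; have -> : blocks_val l * block_val x = blocks_val (rcons l x).
    by rewrite -cats1 blocks_val_cat blocks_val_cons blocks_val_nil mulr1.
  apply: IH => //; first by rewrite -cats1; apply/every_cat.
    by rewrite map_rcons cat_rcons xk.
  by left; case: (l).
case: k gz alt step => [s|] /= gz alt step; last first.
  have [p zE] := star_gen_range_D gz; rewrite zE.
  by apply: (step (inl p)); rewrite //= -zE.
have [ws yws zE] := star_gen_Y gz.
have -> : z = \sum_(w <- ws) centered w.
  rewrite sumrB -zE -[X in _ - X]rmorph_sum /=.
  by rewrite -linear_sum -zE /= Ez rmorph0 subr0.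
rewrite mulr_sumr mulr_suml linear_sum /=.
elim: ws yws {zE} => [|w ws IHw] /=; first by rewrite big_nil.
move=> /andP[yw yws]; rewrite big_cons IHw // addr0.
exact: (step (inr (s, w))).
Qed.

Theorem free_of_schwinger_dyson : free_indep_subsets E (free_blocks Y D).
Proof.
move=> n i z hz Ez ne.
have := @alternating_centered [seq (i k, z k) | k <- iota 0 n.+1] [::].
rewrite blocks_val_nil mul1r big_map -[iota 0 n.+1]/(index_iota 0 n.+1) big_mkord => -> //.
- have : all (fun k => k <= n)%N (index_iota 0 n.+1).
    by apply/allP => k; rewrite mem_index_iota.
  elim: (index_iota 0 n.+1) => //= k ks IH /andP[kn /IH h].
  by split=> //; split; [exact: hz|exact: Ez].
- rewrite cat0s -map_comp /alternating; apply/(sortedP (i 0)) => k; rewrite size_map size_iota => kn.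
  rewrite !(nth_map 0%N) ?size_iota //; last exact: ltnW.
  by rewrite /= !nth_iota //; [apply/eqP; apply: ne|exact: ltnW].
- by right.
Qed.

End Freeness.

(** * Evaluation of noncrossing words *)

Section PairWords.
Variables (R : realType) (B : cstarType R) (eta : {linear B -> B}) (L : eqType).
Implicit Types (w u pre post : seq (L * (B * B))) (v : B) (x y : B * B) (c d : L).

(** In this section, a pair (b, b') encodes the argument b Y b' of the cumulants:
    inserting a value in a word only changes such pairs, which makes words in Y
    computable. *)
Definition pair_insert (left : seq (L * (B * B))) v (right : seq (L * (B * B))) :=
  match left, right with
  | x :: left', _ => rcons (belast x left')
      ((last x left').1, ((last x left').2.1, (last x left').2.2 * v)) ++ right
  | [::], x :: right' => (x.1, (v * x.2.1, x.2.2)) :: right'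
  | [::], [::] => [::]
  end.

Fixpoint pair_word_eval (rho : seq (B * B) -> B) (fuel : nat) w : B :=
  if constant (unzip1 w) then rho (unzip2 w) else
  if fuel is fuel'.+1 then
    let l := find (interval_at (unzip1 w)) (iota 0 (size w)) in
    if drop l w is x :: _ then
      let r := count_mem x.1 (unzip1 w) in
      pair_word_eval rho fuel'
        (pair_insert (take l w) (rho (take r (drop l (unzip2 w)))) (drop (l + r) w))
    else 0
  else 0.

Definition pair_cov (z : seq (B * B)) : B :=
  if z is [:: x; y] then x.1 * eta (x.2 * y.1) * y.2 else 0.

Local Notation pwe := (pair_word_eval pair_cov).

Lemma unzip1_rcons_belast (x : L * (B * B)) u (z : B * B) :
  unzip1 (rcons (belast x u) ((last x u).1, z)) = unzip1 (x :: u).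
Proof. by elim: u x => //= y u IH x; rewrite IH. Qed.

Lemma pair_insert_labels u v w : unzip1 (pair_insert u v w) = unzip1 u ++ unzip1 w.
Proof.
case: u => [|x u]; first by case: w.
by rewrite -(unzip1_rcons_belast x u ((last x u).2.1, (last x u).2.2 * v)) /= /unzip1 map_cat.
Qed.

Definition zero_pair (x : L * (B * B)) : bool := (x.2.1 == 0) || (x.2.2 == 0).

Lemma pair_insert_zero u w : u ++ w <> [::] -> has zero_pair (pair_insert u 0 w).
Proof.
case: u => [|x u] /=; first by case: w => //= y w _; rewrite /zero_pair /= mul0r eqxx.
by move=> _; rewrite has_cat has_rcons /zero_pair /= mulr0 eqxx orbT.
Qed.

Lemma pair_insert_has_zero u v w : has zero_pair (u ++ w) -> has zero_pair (pair_insert u v w).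
Proof.
case: u => [|x u] /=.
  by case: w => //= y w; rewrite /zero_pair /= => /orP[/orP[/eqP->|->]|->];
    rewrite ?mulr0 ?eqxx ?orbT.
rewrite !has_cat orbA => /orP[h|->]; last by rewrite orbT.
apply/orP; left; move: h.
elim: u x => [|y u IH] x /=.
  by rewrite !orbF /zero_pair /= => /orP[->//|/eqP->]; rewrite mul0r eqxx orbT.
by move=> /orP[->//|h]; rewrite (IH y h) orbT.
Qed.

Lemma pair_cov_zero (w : seq (L * (B * B))) : has zero_pair w -> pair_cov (unzip2 w) = 0.
Proof.
case: w => [//|[c x] [//|[d y] [|//]]] /=; rewrite orbF /zero_pair /=.
by move=> /orP[|] /orP[] /eqP->; rewrite ?(mul0r, mulr0, linear0).
Qed.

Lemma pair_cov_size (z : seq (B * B)) : size z <> 2%N -> pair_cov z = 0.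
Proof. by case: z => [|x [|y [|]]]. Qed.

Lemma constant_count (s : seq L) c : count_mem c s = size s -> constant s.
Proof.
case: s => //= d s; have := count_size (pred1 c) s.
case: eqP => [->|_]; last by rewrite add0n => h1 h2; rewrite h2 ltnn in h1.
by rewrite add1n => _ [] /eqP; rewrite -all_count.
Qed.

Lemma constant_eq_count (s : seq L) c : constant s -> c \in s -> count_mem c s = size s.
Proof.
case: s => //= d s ds; rewrite inE => cs.
have all_d : all (pred1 d) (d :: s) by rewrite /= eqxx.
have cd : c = d.
  by case/predU1P: cs => // cs; apply/eqP; exact: (allP ds).
by move: all_d; rewrite all_count -cd => /eqP.
Qed.

(** The block of the zero argument has value 0, and this value is inserted in a
    neighbouring letter. *)
Lemma pwe_zero fuel w : has zero_pair w -> pwe fuel w = 0.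
Proof.
elim: fuel w => [|fuel IH] w zw /=; case: ifPn => // nc; try exact: pair_cov_zero.
set l := find _ _; case dE: (drop l w) => [//|x w'].
set r := count_mem _ _; rewrite /unzip2 -map_drop -map_take.
set bl := take r (drop l w); apply: IH.
have wE : w = take l w ++ bl ++ drop (l + r) w.
  by rewrite addnC -drop_drop /bl !cat_take_drop.
have [zb|nzb] := boolP (has zero_pair bl).
  rewrite pair_cov_zero //; apply: pair_insert_zero => e.
  case/negP: nc; apply: (@constant_count _ x.1); rewrite -/r.
  have : size (take l w ++ drop (l + r) w) = 0%N by rewrite e.
  have := count_size (pred1 x.1) (unzip1 w); rewrite -/r size_map size_cat size_drop size_take.
  have : (l < size w)%N by rewrite ltnNge; apply/negP => /drop_oversize; rewrite dE.
  by move=> ->; lia.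
apply: pair_insert_has_zero.
by move: zw; rewrite {1}wE !has_cat (negbTE nzb).
Qed.

Lemma interval_atP (s : seq L) c l : (l < size s)%N -> nth c s l = c -> interval_at s l ->
  [/\ index c s = l, c \notin take l s,
      all (pred1 c) (take (count_mem c s) (drop l s)),
      (count_mem c s <= size (drop l s))%N & c \notin drop (l + count_mem c s) s].
Proof.
move=> ls nc; have dE : drop l s = c :: drop l.+1 s by rewrite (drop_nth c ls) nc.
rewrite /interval_at dE -dE => /andP[/eqP il al].
have ntake : c \notin take l s.
  apply/negP => h; have := index_mem c (take l s); rewrite h.
  have : index c s = index c (take l s) by rewrite -{1}(cat_take_drop l s) index_cat h.
  by rewrite il size_takel ?(ltnW ls) // => <-; rewrite ltnn.
have cE : count_mem c s = count_mem c (drop l s).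
  by rewrite -{1}(cat_take_drop l s) count_cat (count_memPn ntake).
have cs : (count_mem c s <= size (drop l s))%N by rewrite cE count_size.
split=> //; rewrite addnC -drop_drop.
have : count_mem c (drop l s) = (count_mem c (take (count_mem c s) (drop l s)) +
    count_mem c (drop (count_mem c s) (drop l s)))%N by rewrite -count_cat cat_take_drop.
move: al; rewrite all_count size_takel // => /eqP ->.
rewrite -cE => h; apply/count_memPn; lia.
Qed.

Lemma find_interval w (x : L * (B * B)) w' :
  drop (find (interval_at (unzip1 w)) (iota 0 (size w))) w = x :: w' ->
  let l := find (interval_at (unzip1 w)) (iota 0 (size w)) in
  [/\ (l < size w)%N, interval_at (unzip1 w) l & nth x.1 (unzip1 w) l = x.1].
Proof.
set l := find _ _ => dE /=.
have lw : (l < size w)%N by rewrite ltnNge; apply/negP => /drop_oversize; rewrite dE.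
split=> //.
  have h : has (interval_at (unzip1 w)) (iota 0 (size w)) by rewrite has_find size_iota.
  by have := nth_find 0 h; rewrite -/l nth_iota.
by have := nth_drop l x.1 (unzip1 w) 0; rewrite addn0 => <-; rewrite -map_drop dE.
Qed.

(** Blocks of other sizes than 2 have value 0, whenever they are removed. *)
Lemma pwe_not_pair fuel w c : c \in unzip1 w -> count_mem c (unzip1 w) <> 2%N ->
  pwe fuel w = 0.
Proof.
elim: fuel w => [|fuel IH] w cw c2 /=; case: ifPn => // cst.
- apply: pair_cov_size; rewrite size_map -(size_map fst).
  by rewrite -/(unzip1 w) -(constant_eq_count cst cw).
- apply: pair_cov_size; rewrite size_map -(size_map fst).
  by rewrite -/(unzip1 w) -(constant_eq_count cst cw).
case dE: (drop _ w) => [//|x w'].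
have [lw il nx] := find_interval dE; move: lw il nx dE; set l := find _ _ => lw il nx dE.
have lw1 : (l < size (unzip1 w))%N by rewrite size_map.
have [ix ntk al szr ndr] := interval_atP lw1 nx il.
set r := count_mem x.1 _ in al szr ndr *.
have szb : size (take r (drop l (unzip2 w))) = r.
  by rewrite size_takel // size_drop size_map; move: szr; rewrite size_drop size_map.
have [r2|r2] := eqVneq r 2%N; last first.
  rewrite pair_cov_size ?szb; last exact/eqP.
  apply: pwe_zero; apply: pair_insert_zero => e.
  case/negP: cst; apply: (@constant_count _ x.1); rewrite -/r.
  have : size (take l w ++ drop (l + r) w) = 0%N by rewrite e.
  have := count_size (pred1 x.1) (unzip1 w); rewrite -/r size_map size_cat size_drop size_take lw.
  lia.
have cx : c != x.1 by apply/eqP => cx; apply: c2; rewrite cx.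
have cnt : count_mem c (unzip1 (take l w) ++ unzip1 (drop (l + r) w)) = count_mem c (unzip1 w).
  rewrite -[in RHS](cat_take_drop l w) -[in RHS](cat_take_drop r (drop l w)) drop_drop (addnC r).
  rewrite /unzip1 !map_cat !count_cat.
  have -> : count_mem c [seq i.1 | i <- take r (drop l w)] = 0%N.
    apply/count_memPn; apply/negP => h; move: al.
    by rewrite /unzip1 -map_drop -map_take => /allP/(_ _ h) /=; rewrite (negbTE cx).
  by rewrite add0n.
apply: IH; rewrite pair_insert_labels ?cnt //.
by rewrite -has_pred1 has_count cnt -has_count has_pred1.
Qed.

(** The block of the position l extends beyond the letter e, without containing it. *)
Lemma no_interval (s1 s2 : seq L) e l : (l < size s1)%N -> e \notin s1 ->
  nth e s1 l \in s2 -> ~~ interval_at (s1 ++ e :: s2) l.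
Proof.
move=> ls es ds; apply/negP; set d := nth e s1 l in ds; set s := s1 ++ _ => il.
have dl : nth d s l = d by rewrite /s nth_cat ls (set_nth_default e).
have ls' : (l < size s)%N by rewrite /s size_cat /=; lia.
have [_ _ al sz ndr] := interval_atP ls' dl il.
set r := count_mem d s in al sz ndr.
have de : d != e by apply: contraNneq es => <-; exact: mem_nth.
have lr : (size s1 < l + r)%N.
  rewrite ltnNge; apply/negP => le; case/negP: ndr.
  rewrite /s drop_cat; case: ltngtP le => // [lt _|-> _]; rewrite ?subnn ?drop0.
    by rewrite mem_cat inE ds !orbT.
  by rewrite inE ds orbT.
have : e \in take r (drop l s).
  have -> : e = nth d (take r (drop l s)) (size s1 - l).
    rewrite nth_take; last by lia.
    by rewrite nth_drop subnKC ?(ltnW ls) // /s nth_cat ltnn subnn.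
  by apply: mem_nth; rewrite size_takel //; lia.
by move=> /(allP al) /=; rewrite eq_sym (negbTE de).
Qed.

Lemma find_iota (p : pred nat) m n : (forall l, (l < m)%N -> ~~ p l) -> p m -> (m < n)%N ->
  find p (iota 0 n) = m.
Proof.
move=> h pm mn; have hp : has p (iota 0 n).
  by apply/hasP; exists m; rewrite ?mem_iota.
have ln : (find p (iota 0 n) < n)%N by rewrite -[X in (_ < X)%N](size_iota 0 n) -has_find.
have := nth_find 0 hp; rewrite nth_iota // add0n => pf.
have [lt|gt|//] := ltngtP (find p (iota 0 n)) m.
  by have := h _ lt; rewrite pf.
by have := before_find 0 gt; rewrite nth_iota // add0n pm.
Qed.

(** As every label of pre reoccurs after the two letters labelled c, these form the
    leftmost interval block. *)
Lemma pwe_step fuel pre post c x y : pre ++ post <> [::] ->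
  c \notin unzip1 pre -> c \notin unzip1 post ->
  (forall d, d \in unzip1 pre -> d \in unzip1 post) ->
  pwe fuel.+1 (pre ++ (c, x) :: (c, y) :: post) =
  pwe fuel (pair_insert pre (pair_cov [:: x; y]) post).
Proof.
move=> ne cpre cpost sub; set w := pre ++ _.
have lab : unzip1 w = unzip1 pre ++ c :: c :: unzip1 post by rewrite /w /unzip1 map_cat.
have cnt : count_mem c (unzip1 w) = 2.
  by rewrite lab count_cat /= eqxx (count_memPn cpre) (count_memPn cpost).
have szw : size w = (size pre + (size post).+2)%N by rewrite size_cat.
have ncst : ~~ constant (unzip1 w).
  apply/negP => cst; have := @constant_eq_count _ c cst.
  rewrite cnt size_map szw lab mem_cat inE eqxx orbT => /(_ isT).
  by case: (pre) (post) ne => [|? ?] [|? ?] //= _; lia.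
have fE : find (interval_at (unzip1 w)) (iota 0 (size w)) = size pre.
  apply: find_iota; last by rewrite szw; lia.
    move=> l lp; rewrite lab; have lp' : (l < size (unzip1 pre))%N by rewrite size_map.
    by apply: no_interval => //; rewrite inE (sub _ (mem_nth _ lp')) orbT.
  rewrite /interval_at lab drop_cat size_map ltnn subnn drop0 -lab cnt /= !eqxx /= take0 andbT.
  by rewrite lab index_cat (negbTE cpre) /= eqxx addn0 size_map.
rewrite [LHS]/= (negbTE ncst) fE {1}/w drop_size_cat //= cnt.
rewrite /unzip2 -map_drop /w drop_size_cat //= take0 take_size_cat //.
by rewrite drop_cat ltnNge leq_addr /= addKn /= drop0.
Qed.

(** Noncrossing pair words, decomposed at the partner y of the first letter x into
    the word u1 between them and the word u2 after them. The last argument is the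
    value obtained by evaluating recursively along this decomposition, instead of
    removing the leftmost interval first. *)
Inductive good : seq (L * (B * B)) -> B -> Prop :=
| good_nil : good [::] 1
| good_cons c x y u1 u2 v1 v2 : good u1 v1 -> good u2 v2 ->
    c \notin unzip1 u1 -> c \notin unzip1 u2 ->
    (forall d, d \in unzip1 u1 -> d \notin unzip1 u2) ->
    good ((c, x) :: u1 ++ (c, y) :: u2) (x.1 * eta (x.2 * v1 * y.1) * y.2 * v2).

Lemma pair_insert_rcons pre c x v post : pair_insert (rcons pre (c, x)) v post =
  rcons pre (c, (x.1, x.2 * v)) ++ post.
Proof.
rewrite /pair_insert; case: pre => [|z pre] //=.
by rewrite last_rcons belast_rcons.
Qed.

(** The letters of u are removed before those of pre, because all blocks meeting
    pre end after u; the values are successively inserted in the last letter of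
    pre. *)
Lemma pwe_absorb u v : good u v -> forall pre c0 x0 post,
  (forall d, d \in unzip1 u -> d \notin c0 :: unzip1 pre ++ unzip1 post) ->
  (forall d, d \in c0 :: unzip1 pre -> d \in unzip1 post) ->
  exists2 k, (k <= size u)%N & forall fuel,
    pwe (k + fuel) (rcons pre (c0, x0) ++ u ++ post) =
    pwe fuel (rcons pre (c0, (x0.1, x0.2 * v)) ++ post).
Proof.
elim=> {u v} [|c x y u1 u2 v1 v2 _ IH1 _ IH2 cu1 cu2 dis] pre c0 x0 post h1 h2.
  by exists 0 => // fuel; rewrite mulr1 -surjective_pairing.
have cin : c \in unzip1 ((c, x) :: u1 ++ (c, y) :: u2) by rewrite /= mem_head.
have [|d|k1 k1s e1] := IH1 (rcons pre (c0, x0)) c x ((c, y) :: u2 ++ post).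
- move=> d du1; have : d \in unzip1 ((c, x) :: u1 ++ (c, y) :: u2).
    by rewrite /unzip1 /= map_cat inE mem_cat du1 orbT.
  move/h1; rewrite /unzip1 /= map_rcons !inE !map_cat !mem_cat mem_rcons !inE /= !negb_or.
  have dc : d != c by apply: contraNneq cu1 => <-.
  by move=> /and3P[-> -> dpost]; rewrite dc mem_cat negb_or dpost (dis d du1).
- rewrite /unzip1 /= map_rcons !inE mem_rcons !inE map_cat mem_cat => /orP[->//|/h2->].
  by rewrite !orbT.
have [|d|k2 k2s e2] := IH2 pre c0 (x0.1, x0.2 * pair_cov [:: (x.1, x.2 * v1); y]) post.
- move=> d du2; apply: h1; rewrite /unzip1 /= map_cat inE mem_cat /= inE.
  by rewrite -/(unzip1 u2) du2 !orbT.
- exact: h2.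
exists (k1 + (k2.+1))%N; first by rewrite /= size_cat /=; lia.
move=> fuel; rewrite -addnA /= -catA cat_cons -[rcons pre _ ++ _ :: _]cat_rcons.
rewrite e1 cat_rcons addSn pwe_step.
- by rewrite pair_insert_rcons e2 /= -!mulrA.
- by case: (pre).
- move: (h1 c cin); rewrite inE mem_cat !negb_or /unzip1 map_rcons mem_rcons inE negb_or.
  by move=> /and3P[-> ->].
- move: (h1 c cin); rewrite inE mem_cat !negb_or /unzip1 map_cat mem_cat negb_or cu2.
  by move=> /and3P[].
- move=> d; rewrite /unzip1 map_rcons mem_rcons => /h2.
  by rewrite map_cat mem_cat => ->; rewrite orbT.
Qed.

Lemma good_scale u v t : good u v -> u <> [::] -> good (pair_insert [::] t u) (t * v).
Proof.
case=> // c x y u1 u2 v1 v2 g1 g2 cu1 cu2 dis _.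
have := @good_cons c (t * x.1, x.2) y u1 u2 v1 v2 g1 g2 cu1 cu2 dis.
by rewrite /= !mulrA.
Qed.

Lemma good_size0 v : good [::] v -> v = 1.
Proof. by move=> g; inversion g. Qed.

(** Once the word under the first pair is absorbed, this pair is an interval, and its
    value multiplies the next letter on the left. *)
Lemma pwe_good w v : good w v -> w <> [::] ->
  exists2 k, (k <= size w)%N & forall fuel, pwe (k + fuel) w = v.
Proof.
move: {2}(size w) (erefl (size w)) => m; elim/ltn_ind: m w v => m IH w v sw g.
case: g sw => // c x y u1 u2 v1 v2 g1 g2 cu1 cu2 dis sw _.
have [|d|k1 k1s e1] := pwe_absorb g1 (pre := [::]) (c0 := c) x (post := (c, y) :: u2).
- move=> d du1; rewrite /= !inE (negbTE (dis d du1)) orbF orbb.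
  by apply: contraNneq cu1 => <-.
- by rewrite /= !inE => ->.
case: u2 g2 cu2 dis sw e1 => [|z u2] g2 cu2 dis sw e1.
  exists k1; first by rewrite /= size_cat /=; lia.
  by move=> fuel; rewrite [LHS](e1 fuel) (good_size0 g2) mulr1; case: fuel => [|fuel] /=; rewrite eqxx.
set t := x.1 * eta (x.2 * v1 * y.1) * y.2.
have gs : good (pair_insert [::] t (z :: u2)) (t * v2) by exact: good_scale.
have [|//|k2 k2s e2] := IH (size (z :: u2)) _ (pair_insert [::] t (z :: u2)) (t * v2) erefl gs.
  by rewrite -sw /= size_cat /=; lia.
exists (k1 + k2.+1)%N; first by move: k2s; rewrite /= size_cat /=; lia.
move=> fuel; rewrite -addnA [LHS]e1 addSn.
by rewrite [LHS](@pwe_step _ [::] (z :: u2)) // [LHS]e2.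
Qed.

Lemma pwe_good_size w v : good w v -> w <> [::] -> pwe (size w) w = v.
Proof. by move=> g wn; have [k /subnKC <- h] := pwe_good g wn. Qed.

End PairWords.

(** * Noncrossing pair partitions *)

Section PairPartitions.
Variable N : nat.
Local Notation V := 'I_N.
Implicit Types (A C W : {set V}) (P : {set {set V}}) (i j k l a : V).

Definition nc2 A P : bool :=
  [&& finset.partition P A, [forall W in P, #|pred_of_set W| == 2%N] &
   [forall W in P, forall W' in P, forall i in W, forall j in W', forall k in W,
     forall l in W', [&& i < j, j < k & k < l]%N ==> (W == W')]].

Lemma nc2P A P : reflect [/\ finset.partition P A, forall W, W \in P -> #|W| = 2%N &
   forall W W' i j k l, W \in P -> W' \in P -> i \in W -> k \in W -> j \in W' -> l \in W' ->
     (i < j)%N -> (j < k)%N -> (k < l)%N -> W = W'] (nc2 A P).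
Proof.
apply: (iffP and3P) => -[part pr nc]; split=> //.
- by move=> W WP; apply/eqP; have /forallP/(_ W)/implyP/(_ WP) := pr.
- move=> W W' i j k l WP WP' iW kW jW lW ij jk kl; apply/eqP.
  move: nc => /forall_inP/(_ W WP)/forall_inP/(_ W' WP')/forall_inP/(_ i iW).
  move=> /forall_inP/(_ j jW)/forall_inP/(_ k kW)/forall_inP/(_ l lW).
  by rewrite ij jk kl.
- by apply/forall_inP => W WP; rewrite pr.
- apply/forall_inP => W WP; apply/forall_inP => W' WP'; apply/forall_inP => i iW.
  apply/forall_inP => j jW; apply/forall_inP => k kW; apply/forall_inP => l lW.
  by apply/implyP => /and3P[ij jk kl]; apply/eqP; exact: (nc W W' i j k l).
Qed.

Lemma sorted_enum A : sorted (fun i j => i < j)%N (enum A).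
Proof.
rewrite -(@sorted_map _ _ val ltn); apply: (subseq_sorted ltn_trans _ (iota_ltn_sorted 0 N)).
have -> : enum A = [seq i <- enum V | i \in A] by rewrite enumT.
by rewrite -val_enum_ord; apply: map_subseq; apply: filter_subseq.
Qed.

Lemma enum_sorted_eq A (s : seq V) : sorted (fun i j => i < j)%N s -> s =i A -> enum A = s.
Proof.
move=> ss sA; apply: (irr_sorted_eq _ _ (sorted_enum A) ss).
- by move=> j i k; exact: ltn_trans.
- by move=> i; rewrite /= ltnn.
- by move=> i; rewrite mem_enum sA.
Qed.

Definition between A a k : {set V} := [set i in A | (a < i < k)%N]%SET.
Definition above A k : {set V} := [set i in A | (k < i)%N]%SET.

Lemma enum_min A a s : enum A = a :: s -> a \in A /\ (forall i, i \in A -> i != a -> (a < i)%N).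
Proof.
move=> e; split; first by rewrite -mem_enum e mem_head.
move=> i; rewrite -mem_enum e inE => /predU1P[->|]; first by rewrite eqxx.
move=> is_ _; have := sorted_enum A; rewrite e /= => /order_path_min h.
by have /allP/(_ i is_) := h (fun j i k => @ltn_trans j i k).
Qed.

Lemma enum_split A a k s : enum A = a :: s -> k \in A -> (a < k)%N ->
  enum A = a :: enum (between A a k) ++ k :: enum (above A k).
Proof.
move=> eA kA ak; have [aA amin] := enum_min eA; apply: enum_sorted_eq.
  have trans : transitive (fun i j : V => i < j)%N by move=> j i l; exact: ltn_trans.
  have := sorted_enum (between A a k); have := sorted_enum (above A k).
  rewrite !(sorted_pairwise trans) /= => p2 p1; rewrite pairwise_cat /= p1 p2 andbT.
  apply/and4P; split.
  - apply/allP => i; rewrite mem_cat inE !mem_enum !finset.inE.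
    by move=> /or3P[/and3P[]|/eqP->|/andP[iA ki]] //; apply: ltn_trans ki.
  - apply/allrelP => i j; rewrite inE !mem_enum !finset.inE.
    by move=> /and3P[_ _ ik] /predU1P[->//|/andP[_ kj]]; exact: ltn_trans kj.
  - by [].
  - by apply/allP => i; rewrite mem_enum !finset.inE => /andP[].
move=> i; rewrite inE mem_cat inE !mem_enum !finset.inE.
have [->|ia] := eqVneq i a; first by rewrite aA.
case iA: (i \in A) => /=; last first.
  by apply/negbTE; rewrite orbF; apply: contraFneq iA => ->.
rewrite (amin i iA ia) /=; case: (ltngtP i k) => //= ik; first by rewrite orbT.
by rewrite (val_inj ik) eqxx.
Qed.

Definition join_at a k P1 P2 : {set {set V}} := ([set a; k] |: (P1 :|: P2))%SET.
Definition blocks_within P C : {set {set V}} := [set W in P | W \subset C]%SET.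

(** The elementwise form of nc2, with which the combinatorial arguments are carried
    out. *)
Record pairing A P : Prop := {
  pairing_block : forall i, i \in A -> exists2 W, W \in P & i \in W;
  pairing_sub : forall W i, W \in P -> i \in W -> i \in A;
  pairing_uniq : forall W W' i, W \in P -> W' \in P -> i \in W -> i \in W' -> W = W';
  pairing_card : forall W, W \in P -> #|W| = 2%N;
  pairing_nc : forall W W' i j k l, W \in P -> W' \in P ->
     i \in W -> k \in W -> j \in W' -> l \in W' ->
     (i < j)%N -> (j < k)%N -> (k < l)%N -> W = W' }.

Lemma nc2_pairing A P : nc2 A P <-> pairing A P.
Proof.
split=> [/nc2P[part c2 nc]|[h1 h2 h3 h4 h5]].
  split=> //.
  - move=> i iA; exists (finset.pblock P i).
      by rewrite finset.pblock_mem // (finset.cover_partition part).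
    by rewrite finset.mem_pblock (finset.cover_partition part).
  - by move=> W i WP; apply/fintype.subsetP/(finset.partitionS part WP).
  - move=> W W' i WP W'P iW iW'; have tI := finset.partition_trivIset part.
    by rewrite -(finset.def_pblock tI WP iW) (finset.def_pblock tI W'P iW').
apply/nc2P; split=> //; apply/and3P; split.
- apply/eqP/finset.setP => i; apply/finset.bigcupP/idP => [[W WP iW]|/h1[W WP iW]].
    exact: h2 WP iW.
  by exists W.
- apply/finset.trivIsetP => W W' WP W'P; apply: contraR => /pred0Pn[i /andP[iW iW']].
  by apply/eqP; exact: h3 WP W'P iW iW'.
- by apply/negP => /h4; rewrite cards0.
Qed.

Lemma pairing_pblock A P W i : pairing A P -> W \in P -> i \in W -> finset.pblock P i = W.
Proof.
move=> /nc2_pairing/nc2P[part _ _]; apply: finset.def_pblock.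
exact: finset.partition_trivIset part.
Qed.

Lemma pairing_pblockP A P i : pairing A P -> i \in A ->
  finset.pblock P i \in P /\ i \in finset.pblock P i.
Proof. by move=> pp iA; have [W WP iW] := pairing_block pp iA; rewrite (pairing_pblock pp WP iW). Qed.

Lemma pair_other W i : #|W| = 2%N -> i \in W -> exists2 j, j != i & W = [set i; j]%SET.
Proof.
move=> /eqP/cards2P[x [y [xy ->]]]; rewrite finset.in_set2 => /orP[]/eqP->.
  by exists y; rewrite // eq_sym.
by exists x; rewrite // finset.setUC.
Qed.

Section AtMinimum.
Variables (A : {set V}) (a k : V).
Hypotheses (aA : a \in A) (kA : k \in A) (ak : (a < k)%N).
Hypothesis amin : forall i, i \in A -> i != a -> (a < i)%N.
Local Notation A1 := (between A a k).
Local Notation A2 := (above A k).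

Lemma betweenP i : reflect [/\ i \in A, (a < i)%N & (i < k)%N] (i \in A1).
Proof. by rewrite finset.inE; apply: (iffP and3P). Qed.

Lemma aboveP i : reflect (i \in A /\ (k < i)%N) (i \in A2).
Proof. by rewrite finset.inE; apply: (iffP andP). Qed.

Lemma above_cases i : i \in A -> [\/ i = a, i = k, i \in A1 | i \in A2].
Proof.
move=> iA; have [->|ia] := eqVneq i a; first exact: Or41.
have ai := amin iA ia; case: (ltngtP i k) => [ik|ki|/val_inj->]; last exact: Or42.
  by apply: Or43; apply/betweenP.
by apply: Or44; apply/aboveP.
Qed.

Lemma join_atP P1 P2 W : reflect [\/ W = [set a; k]%SET, W \in P1 | W \in P2]
  (W \in join_at a k P1 P2).
Proof. by rewrite !finset.inE; apply: (iffP or3P) => -[/eqP|h|h]; constructor. Qed.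

Lemma pairing_join P1 P2 : pairing A1 P1 -> pairing A2 P2 -> pairing A (join_at a k P1 P2).
Proof.
move=> p1 p2.
have s1 W i : W \in P1 -> i \in W -> [/\ i \in A, (a < i)%N & (i < k)%N].
  by move=> WP iW; apply/betweenP; exact: (pairing_sub p1 WP iW).
have s2 W i : W \in P2 -> i \in W -> i \in A /\ (k < i)%N.
  by move=> WP iW; apply/aboveP; exact: (pairing_sub p2 WP iW).
split.
- move=> i iA; case: (above_cases iA) => [->|->|i1|i2].
  + by exists [set a; k]%SET; [apply/join_atP; exact: Or31|rewrite finset.set21].
  + by exists [set a; k]%SET; [apply/join_atP; exact: Or31|rewrite finset.set22].
  + have [W WP iW] := pairing_block p1 i1.
    by exists W => //; apply/join_atP; exact: Or32.
  + have [W WP iW] := pairing_block p2 i2.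
    by exists W => //; apply/join_atP; exact: Or33.
- move=> W i /join_atP[->|WP iW|WP iW].
  + by rewrite finset.in_set2 => /orP[]/eqP->.
  + by case: (s1 _ _ WP iW).
  + by case: (s2 _ _ WP iW).
- move=> W W' i /join_atP[->|WP|WP] /join_atP[->|WP'|WP'] iW iW' //.
  + case: (s1 _ _ WP' iW') => _ h1 h2; move: iW; rewrite finset.in_set2.
    by move=> /orP[]/eqP e; move: h1 h2; rewrite e ?ltnn.
  + case: (s2 _ _ WP' iW') => _ h1; move: iW; rewrite finset.in_set2.
    by move=> /orP[]/eqP e; move: h1; rewrite e; lia.
  + case: (s1 _ _ WP iW) => _ h1 h2; move: iW'; rewrite finset.in_set2.
    by move=> /orP[]/eqP e; move: h1 h2; rewrite e ?ltnn.
  + exact: (pairing_uniq p1 WP WP' iW iW').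
  + by case: (s1 _ _ WP iW) (s2 _ _ WP' iW') => _ _ h1 [_ h2]; lia.
  + case: (s2 _ _ WP iW) => _ h1; move: iW'; rewrite finset.in_set2.
    by move=> /orP[]/eqP e; move: h1; rewrite e; lia.
  + by case: (s2 _ _ WP iW) (s1 _ _ WP' iW') => _ h1 [_ _ h2]; lia.
  + exact: (pairing_uniq p2 WP WP' iW iW').
- move=> W /join_atP[->|WP|WP].
  + by rewrite cards2; case: eqP => // e; move: ak; rewrite e ltnn.
  + exact: (pairing_card p1 WP).
  + exact: (pairing_card p2 WP).
- move=> W W' i j x l /join_atP[WE|WP|WP] /join_atP[WE'|WP'|WP'] iW xW jW' lW' ij jx xl;
    rewrite ?WE ?WE' // in iW xW jW' lW' *.
  + have [_ h1 h2] := s1 _ _ WP' jW'; have [_ h3 h4] := s1 _ _ WP' lW'.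
    by move: xW; rewrite finset.in_set2 => /orP[]/eqP e; subst x; lia.
  + have [_ h1] := s2 _ _ WP' jW'.
    by move: xW; rewrite finset.in_set2 => /orP[]/eqP e; subst x; lia.
  + have [_ h1 h2] := s1 _ _ WP iW; have [_ h3 h4] := s1 _ _ WP xW.
    by move: jW'; rewrite finset.in_set2 => /orP[]/eqP e; subst j; lia.
  + exact: (pairing_nc p1 WP WP' iW xW jW' lW').
  + have [_ h1 h2] := s1 _ _ WP xW; have [_ h3] := s2 _ _ WP' jW'; lia.
  + have [_ h1] := s2 _ _ WP iW.
    by move: jW'; rewrite finset.in_set2 => /orP[]/eqP e; subst j; lia.
  + have [_ h1] := s2 _ _ WP iW; have [_ h3 h4] := s1 _ _ WP' jW'; lia.
  + exact: (pairing_nc p2 WP WP' iW xW jW' lW').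
Qed.

Lemma blocks_withinP P C W : reflect (W \in P /\ forall i, i \in W -> i \in C)
  (W \in blocks_within P C).
Proof.
rewrite finset.inE; apply: (iffP andP) => -[WP h]; split=> //.
  exact/fintype.subsetP.
exact/fintype.subsetP.
Qed.

(** A block with one point under the pair {a, k} and one above it would cross this
    pair. *)
Lemma pairing_split P : pairing A P -> [set a; k]%SET \in P ->
  [/\ pairing A1 (blocks_within P A1), pairing A2 (blocks_within P A2) &
     join_at a k (blocks_within P A1) (blocks_within P A2) = P].
Proof.
move=> pp akP.
have inak i W : W \in P -> i \in W -> (i == a) || (i == k) -> W = [set a; k]%SET.
  by move=> WP iW h; apply: (pairing_uniq pp WP akP iW); rewrite finset.in_set2.
have dich W i : W \in P -> i \in W -> W <> [set a; k]%SET ->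
    (i \in A1 -> forall j, j \in W -> j \in A1) /\ (i \in A2 -> forall j, j \in W -> j \in A2).
  move=> WP iW Wn; split=> ii j jW.
    case: (above_cases (pairing_sub pp WP jW)) => [e|e|//|/aboveP[_ kj]].
    - by case: Wn; apply: (inak j) => //; rewrite e eqxx.
    - by case: Wn; apply: (inak j) => //; rewrite e eqxx orbT.
    - case: Wn; have /betweenP[_ ai ik] := ii.
      apply/esym; apply: (@pairing_nc _ _ pp _ _ a i k j) => //; first exact: finset.set21.
      exact: finset.set22.
  case: (above_cases (pairing_sub pp WP jW)) => [e|e|/betweenP[_ aj jk]|//].
  - by case: Wn; apply: (inak j) => //; rewrite e eqxx.
  - by case: Wn; apply: (inak j) => //; rewrite e eqxx orbT.
  - case: Wn; have /aboveP[_ ki] := ii.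
    apply/esym; apply: (@pairing_nc _ _ pp _ _ a j k i) => //; first exact: finset.set21.
    exact: finset.set22.
have sub C : (forall i, i \in C -> i \in A) ->
    (forall W i, W \in P -> i \in W -> i \in C -> forall j, j \in W -> j \in C) ->
    pairing C (blocks_within P C).
  move=> CA cl; split.
  - move=> i iC; have [W WP iW] := pairing_block pp (CA i iC).
    by exists W => //; apply/blocks_withinP; split=> // j; exact: cl iC j.
  - by move=> W i /blocks_withinP[_ h] /h.
  - move=> W W' i /blocks_withinP[WP _] /blocks_withinP[WP' _]; exact: pairing_uniq pp _ _ _ WP WP'.
  - by move=> W /blocks_withinP[/(pairing_card pp)].
  - move=> W W' i j x l /blocks_withinP[WP _] /blocks_withinP[WP' _]; exact: (pairing_nc pp WP WP').
have nak1 W i : i \in W -> i \in A1 -> W <> [set a; k]%SET.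
  move=> iW /betweenP[_ h1 h2] We; move: iW; rewrite We finset.in_set2.
  by move=> /orP[]/eqP e; subst i; lia.
have nak2 W i : i \in W -> i \in A2 -> W <> [set a; k]%SET.
  move=> iW /aboveP[_ h1] We; move: iW; rewrite We finset.in_set2.
  by move=> /orP[]/eqP e; subst i; lia.
split.
- apply: sub => [i /betweenP[]//|W i WP iW i1].
  by have [h _] := dich W i WP iW (nak1 W i iW i1); exact: h.
- apply: sub => [i /aboveP[]//|W i WP iW i2].
  by have [_ h] := dich W i WP iW (nak2 W i iW i2); exact: h.
- apply/finset.setP => W; apply/join_atP/idP => [[->//|/blocks_withinP[]//|/blocks_withinP[]//]|WP].
  have [->|Wn] := eqVneq W [set a; k]%SET; first exact: Or31.
  have [i iW] : exists i, i \in W.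
    by apply/card_gt0P; rewrite (pairing_card pp WP).
  have [h1 h2] := dich W i WP iW (elimN eqP Wn).
  case: (above_cases (pairing_sub pp WP iW)) => [e|e|i1|i2].
  + by apply: Or31; apply: (inak i) => //; rewrite e eqxx.
  + by apply: Or31; apply: (inak i) => //; rewrite e eqxx orbT.
  + by apply: Or32; apply/blocks_withinP; split=> //; exact: h1.
  + by apply: Or33; apply/blocks_withinP; split=> //; exact: h2.
Qed.

Lemma blocks_within_join P1 P2 : pairing A1 P1 -> pairing A2 P2 ->
  blocks_within (join_at a k P1 P2) A1 = P1 /\ blocks_within (join_at a k P1 P2) A2 = P2.
Proof.
move=> p1 p2.
have ne W : #|W| = 2%N -> exists i, i \in W by move=> c; apply/card_gt0P; rewrite c.
split; apply/finset.setP => W; apply/blocks_withinP/idP.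
- move=> [/join_atP[->|//|WP] h]; first by have /h/betweenP[] := finset.set21 a k; lia.
  have [i iW] := ne W (pairing_card p2 WP).
  have /betweenP[_ _ h1] := h i iW.
  by have /aboveP[_ h2] := pairing_sub p2 WP iW; lia.
- by move=> WP; split=> [|i]; [apply/join_atP; exact: Or32|exact: (pairing_sub p1 WP)].
- move=> [/join_atP[->|WP|//] h].
    by have /h/aboveP[_] := finset.set21 a k; lia.
  have [i iW] := ne W (pairing_card p1 WP).
  have /aboveP[_ h1] := h i iW.
  by have /betweenP[_ _ h2] := pairing_sub p1 WP iW; lia.
- by move=> WP; split=> [|i]; [apply/join_atP; exact: Or33|exact: (pairing_sub p2 WP)].
Qed.

Lemma big_join (Z : zmodType) (F : {set {set V}} -> Z) :
  \sum_(P | nc2 A P && ([set a; k]%SET \in P)) F P =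
  \sum_(P1 | nc2 A1 P1) \sum_(P2 | nc2 A2 P2) F (join_at a k P1 P2).
Proof.
rewrite pair_big (reindex_onto (fun q : {set {set V}} * {set {set V}} => join_at a k q.1 q.2)
  (fun P => (blocks_within P A1, blocks_within P A2))) /=; last first.
  by move=> P /andP[/nc2_pairing pp akP]; have [_ _] := pairing_split pp akP.
apply: eq_bigl => -[P1 P2] /=; apply/idP/idP.
  move=> /andP[/andP[/nc2_pairing pp akP] /eqP[e1 e2]].
  have [/nc2_pairing h1 /nc2_pairing h2 _] := pairing_split pp akP.
  by rewrite e1 in h1; rewrite e2 in h2; rewrite h1 h2.
move=> /andP[/nc2_pairing p1 /nc2_pairing p2].
have [-> ->] := blocks_within_join p1 p2; rewrite eqxx andbT.
by apply/andP; split; [apply/nc2_pairing/pairing_join|apply/join_atP; exact: Or31].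
Qed.

End AtMinimum.

Lemma pairing_mate A P a : pairing A P -> a \in A ->
  (forall i, i \in A -> i != a -> (a < i)%N) ->
  exists k, [/\ k \in A, (a < k)%N & forall j, ((j \in A) && (a < j)%N) &&
     ([set a; j]%SET \in P) = (j == k)].
Proof.
move=> pp aA amin; have [W WP aW] := pairing_block pp aA.
have [k ka WE] := pair_other (pairing_card pp WP) aW.
have kA : k \in A by apply: (pairing_sub pp WP); rewrite WE finset.set22.
have ak := amin k kA ka; exists k; split=> // j.
apply/idP/eqP => [/andP[/andP[jA aj] jP]|->]; last by rewrite kA ak -WE.
have := pairing_uniq pp jP WP (finset.set21 a j) aW; rewrite WE => e.
have : j \in [set a; k]%SET by rewrite -e finset.set22.
by rewrite finset.in_set2 => /orP[/eqP ja|/eqP//]; move: aj; rewrite ja ltnn.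
Qed.

(** A noncrossing pair partition is determined by the partner k of the minimum a and
    its restrictions to both sides of k. *)
Lemma big_nc2 (Z : zmodType) A a (F : {set {set V}} -> Z) : a \in A ->
  (forall i, i \in A -> i != a -> (a < i)%N) ->
  \sum_(P | nc2 A P) F P = \sum_(k in A | (a < k)%N) \sum_(P1 | nc2 (between A a k) P1)
     \sum_(P2 | nc2 (above A k) P2) F (join_at a k P1 P2).
Proof.
move=> aA amin.
transitivity (\sum_(P | nc2 A P) \sum_(k | ((k \in A) && (a < k)%N) && ([set a; k]%SET \in P)) F P).
  apply: eq_bigr => P /nc2_pairing pp; have [k [kA ak kE]] := pairing_mate pp aA amin.
  by rewrite (eq_bigl _ _ kE) big_pred1_eq.
rewrite (exchange_big_dep (fun k => (k \in A) && (a < k)%N)) /=; last first.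
  by move=> P k _ /andP[].
apply: eq_bigr => k /andP[kA ak]; rewrite -(big_join aA kA ak amin).
by apply: eq_bigl => P; rewrite kA ak.
Qed.

End PairPartitions.

(** * Moments and cumulants of a semicircular element *)

Section PairingSum.
Variables (R : realType) (B : cstarType R) (eta : {linear B -> B}).
Variable mom : seq (B * B) -> B.
Hypothesis mom_nil : mom [::] = 1.
Hypothesis mom_cons : forall y z, mom (y :: z) = \sum_(k < size z)
  y.1 * eta (y.2 * mom (take k z) * (nth y z k).1) * (nth y z k).2 * mom (drop k.+1 z).
Variables (N : nat) (x : 'I_N -> B * B).
Local Notation V := 'I_N.
Local Notation pwe := (pair_word_eval (pair_cov eta)).
Implicit Types (A : {set V}) (P : {set {set V}}).

Definition labelled_word A P := [seq (finset.pblock P i, x i) | i <- enum A].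

Definition pairing_val A P : B :=
  if enum A is [::] then 1 else pwe (size (labelled_word A P)) (labelled_word A P).

Lemma pairing_val_good A P v : good eta (labelled_word A P) v -> pairing_val A P = v.
Proof.
rewrite /pairing_val /labelled_word; case: (enum A) => [|i s] g.
  by rewrite (good_size0 g).
exact: (pwe_good_size g).
Qed.

Lemma labelled_word_join A a k P1 P2 s : enum A = a :: s -> k \in A -> (a < k)%N ->
  pairing (between A a k) P1 -> pairing (above A k) P2 ->
  labelled_word A (join_at a k P1 P2) =
  ([set a; k]%SET, x a) :: labelled_word (between A a k) P1 ++
    ([set a; k]%SET, x k) :: labelled_word (above A k) P2.
Proof.
move=> eA kA ak p1 p2; have [aA amin] := enum_min eA.
have pj := pairing_join aA kA ak amin p1 p2.
have W0 : [set a; k]%SET \in join_at a k P1 P2 by apply/join_atP; exact: Or31.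
rewrite /labelled_word (enum_split eA kA ak) /= map_cat /=.
rewrite (pairing_pblock pj W0 (finset.set21 a k)) (pairing_pblock pj W0 (finset.set22 a k)).
congr (_ :: _ ++ _ :: _); apply/eq_in_map => i; rewrite mem_enum => iA; congr (_, _).
  have [WP iW] := pairing_pblockP p1 iA.
  by apply: (pairing_pblock pj _ iW); apply/join_atP; exact: Or32.
have [WP iW] := pairing_pblockP p2 iA.
by apply: (pairing_pblock pj _ iW); apply/join_atP; exact: Or33.
Qed.

Lemma labelled_wordP A P W : pairing A P -> W \in unzip1 (labelled_word A P) ->
  W \in P /\ exists2 i, i \in A & i \in W.
Proof.
move=> pp; have -> : unzip1 (labelled_word A P) = [seq finset.pblock P i | i <- enum A].
  by rewrite /unzip1 /labelled_word -map_comp.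
move=> /mapP[j]; rewrite mem_enum => jA ->.
by have [WP jW] := pairing_pblockP pp jA; split=> //; exists j.
Qed.

Lemma good_join A a k P1 P2 v1 v2 s : enum A = a :: s -> k \in A -> (a < k)%N ->
  pairing (between A a k) P1 -> pairing (above A k) P2 ->
  good eta (labelled_word (between A a k) P1) v1 ->
  good eta (labelled_word (above A k) P2) v2 ->
  good eta (labelled_word A (join_at a k P1 P2))
    ((x a).1 * eta ((x a).2 * v1 * (x k).1) * (x k).2 * v2).
Proof.
move=> eA kA ak p1 p2 g1 g2; rewrite (labelled_word_join eA kA ak p1 p2).
apply: good_cons => //.
- apply/negP => /(labelled_wordP p1)[WP _].
  by have /betweenP[_] := pairing_sub p1 WP (finset.set21 a k); rewrite ltnn.
- apply/negP => /(labelled_wordP p2)[WP _].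
  by have /aboveP[_] := pairing_sub p2 WP (finset.set22 a k); rewrite ltnn.
- move=> W /(labelled_wordP p1)[_ [i /betweenP[_ _ ik] iW]].
  apply/negP => /(labelled_wordP p2)[WP _].
  by have /aboveP[_ ki] := pairing_sub p2 WP iW; move: (ltn_trans ik ki); rewrite ltnn.
Qed.

Lemma nc2_set0 P : nc2 (finset.set0 : {set V}) P = (P == finset.set0).
Proof.
apply/idP/eqP => [/nc2P[]|->].
  by rewrite finset.partition_set0 => /eqP.
apply/nc2_pairing; split=> [i|W i|W W' i|W|W W' i j k l]; by rewrite finset.in_set0.
Qed.

(** The decomposition of big_nc2 is the recursion that defines mom. *)
Lemma nc2_sum A :
  (forall P, nc2 A P -> good eta (labelled_word A P) (pairing_val A P)) /\
  \sum_(P | nc2 A P) pairing_val A P = mom [seq x i | i <- enum A].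
Proof.
move: {2}#|A| (erefl #|A|) => m; elim/ltn_ind: m A => m IH A cA.
case eA: (enum A) => [|a s].
  have A0 : A = finset.set0.
    by apply/finset.setP => i; rewrite finset.in_set0 -mem_enum eA.
  split=> [P _|]; first by rewrite /pairing_val /labelled_word eA; exact: good_nil.
  rewrite mom_nil A0 (eq_bigl _ _ nc2_set0) big_pred1_eq -A0.
  by rewrite /pairing_val eA.
have [aA amin] := enum_min eA.
have lt1 k : (#|between A a k| < m)%N.
  rewrite -cA; apply/proper_card/fintype.properP; split.
    by apply/fintype.subsetP => i /betweenP[].
  by exists a => //; apply/negP => /betweenP[_]; rewrite ltnn.
have lt2 (k : V) : (a < k)%N -> (#|above A k| < m)%N.
  move=> ak; rewrite -cA; apply/proper_card/fintype.properP; split.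
    by apply/fintype.subsetP => i /aboveP[].
  by exists a => //; apply/negP => /aboveP[_] /(ltn_trans ak); rewrite ltnn.
have gj k P1 P2 : k \in A -> (a < k)%N -> nc2 (between A a k) P1 -> nc2 (above A k) P2 ->
   good eta (labelled_word A (join_at a k P1 P2))
    ((x a).1 * eta ((x a).2 * pairing_val (between A a k) P1 * (x k).1) * (x k).2 *
       pairing_val (above A k) P2).
  move=> kA ak n1 n2; have [g1 _] := IH _ (lt1 k) (between A a k) erefl.
  have [g2 _] := IH _ (lt2 k ak) (above A k) erefl.
  by apply: (good_join eA kA ak); [exact/nc2_pairing|exact/nc2_pairing|exact: g1|exact: g2].
split.
  move=> P nP; have /nc2_pairing pp := nP.
  have [k [kA ak kE]] := pairing_mate pp aA amin.
  have akP : [set a; k]%SET \in P by have := kE k; rewrite eqxx => /andP[].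
  have [p1 p2 PE] := pairing_split aA kA ak amin pp akP.
  have g := gj k _ _ kA ak (proj2 (nc2_pairing _ _) p1) (proj2 (nc2_pairing _ _) p2).
  by rewrite PE in g; rewrite (pairing_val_good g).
rewrite (big_nc2 _ aA amin).
transitivity (\sum_(k in A | (a < k)%N) (x a).1 * eta ((x a).2 *
    mom [seq x i | i <- enum (between A a k)] * (x k).1) * (x k).2 *
    mom [seq x i | i <- enum (above A k)]).
  apply: eq_bigr => k /andP[kA ak].
  have [_ <-] := IH _ (lt1 k) (between A a k) erefl.
  have [_ <-] := IH _ (lt2 k ak) (above A k) erefl.
  rewrite [(x a).2 * _]mulr_sumr mulr_suml linear_sum /= [(x a).1 * _]mulr_sumr !mulr_suml.
  apply: eq_bigr => P1 n1.
  rewrite mulr_sumr; apply: eq_bigr => P2 n2.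
  exact: pairing_val_good (gj k P1 P2 kA ak n1 n2).
rewrite /= mom_cons size_map -big_enum_cond eA big_cons ltnn.
have sA k : k \in s -> k \in A /\ (a < k)%N.
  move=> ks; have kA : k \in A by rewrite -mem_enum eA inE ks orbT.
  split=> //; apply: amin => //; apply: contraTneq ks => ->.
  by have := enum_uniq A; rewrite eA => /andP[].
rewrite big_seq_cond (eq_bigl (fun k => k \in s)); last first.
  by move=> k; case ks: (k \in s) => //=; case: (sA k ks).
rewrite -big_seq (big_nth a) big_mkord; apply: eq_bigr => j _.
set k := nth a s j; have ks : k \in s by exact: mem_nth.
have [kA ak] := sA k ks.
have sE : s = enum (between A a k) ++ k :: enum (above A k).
  by have := enum_split eA kA ak; rewrite eA => -[].
have us : uniq s by have := enum_uniq A; rewrite eA => /andP[].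
have jE : size (enum (between A a k)) = j.
  have := index_uniq a (ltn_ord j) us; rewrite -/k [in index _ _]sE index_cat.
  rewrite (_ : k \in enum _ = false) /= ?eqxx ?addn0 //.
  by apply/negP; rewrite mem_enum => /betweenP[_ _]; rewrite ltnn.
have cut h : size (enum (between A a k)) = h ->
    take h s = enum (between A a k) /\ drop h.+1 s = enum (above A k).
  move=> <-; rewrite [s]sE take_size_cat //; split=> //.
  by rewrite -cat_rcons drop_size_cat // size_rcons.
by rewrite (nth_map a) // -/k -map_take -map_drop; have [-> ->] := cut _ jE.
Qed.

End PairingSum.

Section Semicircular.
Variables (R : realType) (B : cstarType R) (A : bprob B) (Y : A) (eta : {linear B -> B}).
Local Notation E := (expect A).
Local Notation em := (emb A).

Definition sandwich (x : B * B) : A := em x.1 * Y * em x.2.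
Definition sandwich_mom (z : seq (B * B)) : B := E (\prod_(x <- z) sandwich x).

Hypothesis Y_star : star Y = Y.
Hypothesis mom_cons : forall y z, sandwich_mom (y :: z) = \sum_(k < size z)
  y.1 * eta (y.2 * sandwich_mom (take k z) * (nth y z k).1) * (nth y z k).2 *
    sandwich_mom (drop k.+1 z).

Lemma mom_nil : sandwich_mom [::] = 1.
Proof. by rewrite /sandwich_mom big_nil expect1. Qed.

Lemma insert_value_sandwich (L : eqType) (u w : seq (L * (B * B))) v :
  insert_value [seq (y.1, sandwich y.2) | y <- u] v [seq (y.1, sandwich y.2) | y <- w] =
  [seq (y.1, sandwich y.2) | y <- pair_insert u v w].
Proof.
case: u => [|y u] /=.
  by case: w => //= y w; rewrite /sandwich /= rmorphM !mulrA.
rewrite belast_map (last_map (fun y : L * (B * B) => (y.1, sandwich y.2))) map_cat map_rcons.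
by rewrite /sandwich /= rmorphM !mulrA.
Qed.

Lemma word_eval_sandwich (L : eqType) (rho : seq A -> B) fuel (w : seq (L * (B * B))) :
  word_eval rho fuel [seq (y.1, sandwich y.2) | y <- w] =
  pair_word_eval (fun z => rho [seq sandwich y | y <- z]) fuel w.
Proof.
have u1 (u : seq (L * (B * B))) : unzip1 [seq (y.1, sandwich y.2) | y <- u] = unzip1 u.
  by rewrite /unzip1 -map_comp.
have u2 (u : seq (L * (B * B))) : unzip2 [seq (y.1, sandwich y.2) | y <- u] =
    [seq sandwich y | y <- unzip2 u] by rewrite /unzip2 -!map_comp.
elim: fuel w => [|fuel IH] w /=; rewrite u1 u2 //; case: ifP => // _.
rewrite size_map -map_drop; case dE: (drop _ w) => [|y w'] //=.
by rewrite -map_take -map_drop -map_drop -map_take insert_value_sandwich IH.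
Qed.

Lemma zip_enum (L : Type) (n : nat) (lab : 'I_n -> L) (z : seq (B * B)) : size z = n ->
  zip [seq lab i | i <- enum 'I_n] [seq sandwich y | y <- z] =
  [seq (y.1, sandwich y.2) | y <- [seq (lab i, nth (0, 0) z i) | i <- enum 'I_n]].
Proof.
move=> sz; have -> : [seq sandwich y | y <- z] =
    [seq sandwich (nth (0, 0) z (i : 'I_n)) | i <- enum 'I_n].
  rewrite -{1}(mkseq_nth (0, 0) z) /mkseq sz -val_enum_ord -!map_comp.
  exact: eq_map.
by rewrite -[RHS]map_comp; elim: (enum 'I_n) => //= i s ->.
Qed.

Lemma noncrossing_nc2 (n : nat) (P : {set {set 'I_n}}) :
  nc2 [set: 'I_n]%SET P = noncrossing P && pair_partition P.
Proof.
apply/idP/andP => [nP|[/andP[part nc] pr]].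
  have /nc2P[part c2 _] := nP; have /nc2_pairing pp := nP; split; last first.
    by apply/forall_inP => W /c2->.
  rewrite /noncrossing part /=; apply/forallP => i; apply/forallP => j.
  apply/forallP => k; apply/forallP => l; apply/implyP.
  move=> /and4P[/andP[ij jk] kl /eqP ik /eqP jl].
  have [Wi ii] := pairing_pblockP pp (finset.in_setT i).
  have [Wj jj] := pairing_pblockP pp (finset.in_setT j).
  apply/eqP; apply: (pairing_nc pp Wi Wj ii _ jj _ ij jk kl).
    by have [_] := pairing_pblockP pp (finset.in_setT k); rewrite ik.
  by have [_] := pairing_pblockP pp (finset.in_setT l); rewrite jl.
apply/nc2P; split=> //; first by move=> W /(forall_inP pr)/eqP.
move=> W W' i j k l WP WP' iW kW jW lW ij jk kl.
have tI := finset.partition_trivIset part.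
move: nc => /forallP/(_ i)/forallP/(_ j)/forallP/(_ k)/forallP/(_ l)/implyP.
rewrite (finset.def_pblock tI WP iW) (finset.def_pblock tI WP kW).
rewrite (finset.def_pblock tI WP' jW) (finset.def_pblock tI WP' lW) !eqxx ij jk kl.
by move=> /(_ isT)/eqP.
Qed.

Lemma label_count (n : nat) (P : {set {set 'I_n}}) W (z : 'I_n -> B * B) :
  finset.partition P [set: 'I_n]%SET -> W \in P ->
  count_mem W (unzip1 [seq (finset.pblock P i, z i) | i <- enum 'I_n]) = #|W|.
Proof.
move=> part WP; have tI := finset.partition_trivIset part.
rewrite /unzip1 -map_comp count_map cardE.
have -> : enum W = [seq i <- enum 'I_n | i \in W] by rewrite enumT.
rewrite size_filter.
apply: eq_count => i /=; apply/eqP/idP => [<-|iW]; last exact: finset.def_pblock tI WP iW.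
by rewrite finset.mem_pblock (finset.cover_partition part) finset.in_setT.
Qed.

Lemma part_eval_sandwich (rho : seq A -> B) (z : seq (B * B))
    (P : {set {set 'I_(size [seq sandwich y | y <- z])}}) :
  part_eval rho P = pair_word_eval (fun z => rho [seq sandwich y | y <- z])
    (size z) [seq (finset.pblock P i, nth (0, 0) z i) | i <- enum 'I_(size [seq sandwich y | y <- z])].
Proof.
rewrite /part_eval zip_enum; last by rewrite size_map.
by rewrite word_eval_sandwich; congr (pair_word_eval _ _ _); rewrite size_map.
Qed.

Lemma size_label_word (L : Type) (s : seq A) (lab : 'I_(size s) -> L) :
  size (zip [seq lab i | i <- enum 'I_(size s)] s) = size s.
Proof. by rewrite size2_zip // size_map size_enum_ord. Qed.

Definition pair_expect (s : seq A) : B := if s is [:: p; q] then E (p * q) else 0.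

Lemma pair_expect_sandwich z : pair_expect [seq sandwich y | y <- z] = pair_cov eta z.
Proof.
case: z => [|y [|y' [|]]] //=.
have := mom_cons y [:: y']; rewrite big_ord1 /= mom_nil !mulr1 => <-.
by rewrite /sandwich_mom !big_cons big_nil mulr1.
Qed.

(** The recursion for cumulants involves lists of arbitrary elements of A. This
    function takes the expected values on lists of elements b Y b' and agrees with
    the cumulants on all the others, so that comparing the two reduces to lists of
    elements b Y b'. *)
Definition sandwich_cumulant (s : seq A) : B :=
  if `[< exists z, s = [seq sandwich y | y <- z] >] then pair_expect s else cumulant E s.

Lemma sandwich_cumulantE :
  (fun z => sandwich_cumulant [seq sandwich y | y <- z]) = pair_cov eta.
Proof.
rewrite boolp.funeqE => z; rewrite /sandwich_cumulant asboolT; last by exists z.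
exact: pair_expect_sandwich.
Qed.

Lemma pwe_pair_partition0 (z : seq (B * B)) n (P : {set {set 'I_n}}) fuel :
  noncrossing P -> ~~ pair_partition P ->
  pair_word_eval (pair_cov eta) fuel [seq (finset.pblock P i, nth (0, 0) z i) | i <- enum 'I_n] = 0.
Proof.
move=> /andP[part _] /forall_inPn[W WP c2].
have cE := label_count (fun i : 'I_n => nth (0, 0) z i) part WP.
apply: (@pwe_not_pair _ _ _ _ _ _ W); last by rewrite cE; exact/eqP.
rewrite -has_pred1 has_count cE card_gt0.
exact: finset.partition_neq0 part WP.
Qed.

(** By induction, the partitions with several blocks contribute the sum over
    noncrossing pair partitions, which by nc2_sum is the whole moment unless there
    are only two arguments; in that case they contribute nothing. *)
Lemma cumulant_sandwich z : z <> [::] ->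
  cumulant E [seq sandwich y | y <- z] = pair_cov eta z.
Proof.
move: {2}(size z) (erefl (size z)) => m; elim/ltn_ind: m z => m IH z sz zn.
set s := [seq sandwich y | y <- z].
have ss : size s = size z by rewrite size_map.
have s0 : (0 < size s)%N by rewrite ss; case: (z) zn.
rewrite cumulantE //.
have small t : (0 < size t < size s)%N -> cumulant E t = sandwich_cumulant t.
  move=> /andP[t0 ts]; rewrite /sandwich_cumulant; case: asboolP => // -[z' tE].
  rewrite tE pair_expect_sandwich (IH (size z')) //.
    by rewrite -sz -ss; move: ts; rewrite tE size_map.
  by move: t0; rewrite tE; case: (z').
have -> : E (\prod_(y <- s) y) = sandwich_mom z by rewrite big_map.
have evalE P : noncrossing P && (P != [set [set: 'I_(size s)]]%SET) ->
    part_eval (cumulant E) P = pair_word_eval (pair_cov eta) (size z)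
      [seq (finset.pblock P i, nth (0, 0) z i) | i <- enum 'I_(size s)].
  move=> /andP[nc n1]; rewrite (part_eval_ext small s0 nc n1) part_eval_sandwich.
  by rewrite sandwich_cumulantE.
rewrite (eq_bigr _ evalE).
have [z2|z2] := eqVneq (size z) 2%N.
  rewrite big1 ?subr0.
    case: (z) z2 => [|y [|y' [|]]] // _.
    by rewrite -pair_expect_sandwich /sandwich_mom /= !big_cons big_nil mulr1.
  move=> P /andP[nc n1]; apply: pwe_pair_partition0 => //; apply: contra n1 => pr.
  have [part _] := andP nc; apply/eqP/finset.setP => W; rewrite finset.in_set1.
  have full (W' : {set 'I_(size s)}) : W' \in P -> W' = [set: 'I_(size s)]%SET.
    move=> WP; apply/eqP; rewrite finset.eqEcard finset.subsetT finset.cardsT card_ord.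
    by rewrite (eqP (forall_inP pr _ WP)) ss z2.
  apply/idP/eqP => [/full//|->].
  have iP : finset.pblock P (Ordinal s0) \in P.
    by rewrite finset.pblock_mem // (finset.cover_partition part) finset.in_setT.
  by rewrite -(full _ iP).
rewrite pair_cov_size; last exact/eqP.
have eT : enum [set: 'I_(size s)]%SET = enum 'I_(size s) by rewrite enum_setT enumT.
have [_ sumE] := nc2_sum mom_nil mom_cons (fun i : 'I_(size s) => nth (0, 0) z i) [set: 'I_(size s)]%SET.
apply/eqP; rewrite subr_eq0; apply/eqP.
have -> : sandwich_mom z = \sum_(P | nc2 [set: 'I_(size s)]%SET P)
    pairing_val eta (fun i : 'I_(size s) => nth (0, 0) z i) [set: 'I_(size s)]%SET P.
  rewrite sumE eT; congr sandwich_mom.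
  rewrite -[LHS](mkseq_nth (0, 0)) /mkseq -ss -val_enum_ord -map_comp; exact: eq_map.
rewrite (eq_bigl _ _ (@noncrossing_nc2 _)) [RHS](bigID (@pair_partition _)) /=.
rewrite [X in _ = _ + X]big1 ?addr0; last first.
  by move=> P /andP[/andP[nc _] npr]; exact: pwe_pair_partition0.
have e0 : enum 'I_(size s) <> [::].
  by move=> e; have := size_enum_ord (size s); rewrite e /= => e'; move: s0; rewrite -e'.
apply: eq_big => [P|P /andP[nc pr]].
  case nc: (noncrossing P) => //=; case pr: (pair_partition P); rewrite ?andbF //= andbT.
  apply/esym/eqP => P1; move/forall_inP: pr => /(_ [set: 'I_(size s)]%SET).
  rewrite P1 finset.set11 finset.cardsT card_ord ss => /(_ isT).
  by rewrite (negbTE z2).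
have sw : size [seq (finset.pblock P i, nth (0, 0) z i) | i <- enum 'I_(size s)] = size z.
  by rewrite size_map size_enum_ord ss.
rewrite /pairing_val /labelled_word eT sw.
by case: (enum 'I_(size s)) e0.
Qed.

Lemma semicircular_args_sandwich m b : semicircular_args Y m b =
  [seq sandwich y | y <- rcons [seq (b k, 1) | k <- iota 0 m] (b m, b m.+1)].
Proof.
rewrite /semicircular_args map_rcons /sandwich /=; congr rcons.
by rewrite -map_comp; apply: eq_map => k /=; rewrite rmorph1 mulr1.
Qed.

Theorem semicircular_of_moments : semicircular E Y eta.
Proof.
split=> // [m b|b]; last first.
  have := mom_cons (1, b) [:: (1, 1)]; rewrite big_ord1 /= mom_nil !mulr1 mul1r => <-.
  by rewrite /sandwich_mom !big_cons big_nil /sandwich /= !rmorph1 !mulr1 !mul1r ?mulrA.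
rewrite semicircular_args_sandwich; set z := rcons _ _ => P nc npr.
have zn : z <> [::] by rewrite /z; case: (map _ _).
have -> : part_eval (cumulant E) P = part_eval sandwich_cumulant P.
  rewrite /part_eval; apply: (@word_eval_ext _ _ _ _ (size z).+2).
  - move=> t /andP[t0 _]; rewrite /sandwich_cumulant; case: asboolP => // -[z' tE].
    rewrite tE pair_expect_sandwich cumulant_sandwich //.
    by move=> z'0; move: t0; rewrite tE z'0.
  - by rewrite size_label_word size_map; case: (z) zn.
  - by apply: leq_trans (leq_addr _ _); rewrite size_label_word size_map.
rewrite part_eval_sandwich sandwich_cumulantE.
exact: pwe_pair_partition0.
Qed.

End Semicircular.

(** * The limit theorem *)

Section SandwichMoments.
Variables (R : realType) (B : cstarType R) (S : eqType) (T : Type) (A : bprob B).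
Variables (Y : S -> A) (D : T -> A) (eta : S -> {linear B -> B}).
Local Notation E := (expect A).
Local Notation em := (emb A).
Local Notation letter := (@bpoly R B T + S)%type.
Hypothesis schwinger_dyson : forall p s w,
  E (bpoly_eval D p * Y s * word_val Y D w) =
  \sum_(uv <- splits s w) E (bpoly_eval D p *
     em (eta s (E (word_val Y D uv.1))) * word_val Y D uv.2).

Fixpoint sandwich_word (s : S) (z : seq (B * B)) : seq letter :=
  if z is y :: z' then
    [:: inl (PConst T y.1), inr s, inl (PConst T y.2) & sandwich_word s z']
  else [::].

Lemma sandwich_wordE s z :
  word_val Y D (sandwich_word s z) = \prod_(y <- z) sandwich (Y s) y.
Proof.
elim: z => [|y z IH] /=; first by rewrite /word_val !big_nil.
by rewrite /word_val !big_cons -/(word_val Y D _) IH /= /sandwich !mulrA.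
Qed.

Lemma splits_sandwich (V : zmodType) s z y0 (G : seq letter -> seq letter -> V) :
  \sum_(uv <- splits s (sandwich_word s z)) G uv.1 uv.2 =
  \sum_(k < size z) G (rcons (sandwich_word s (take k z)) (inl (PConst T (nth y0 z k).1)))
    (inl (PConst T (nth y0 z k).2) :: sandwich_word s (drop k.+1 z)).
Proof.
elim: z G => [|y z IH] G /=; first by rewrite big_nil big_ord0.
rewrite eqxx /= big_cons big_map big_ord_recl /= drop0 big_map.
congr (_ + _); rewrite big_map /=.
exact: (IH (fun u => G [:: inl (PConst T y.1), inr s, inl (PConst T y.2) & u])).
Qed.

Lemma sandwich_mom_cons s y z : sandwich_mom (Y s) (y :: z) = \sum_(k < size z)
  y.1 * eta s (y.2 * sandwich_mom (Y s) (take k z) * (nth y z k).1) * (nth y z k).2 *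
    sandwich_mom (Y s) (drop k.+1 z).
Proof.
have -> : sandwich_mom (Y s) (y :: z) = E (bpoly_eval D (PConst T y.1) * Y s *
     word_val Y D (inl (PConst T y.2) :: sandwich_word s z)).
  rewrite /sandwich_mom big_cons /word_val big_cons -/(word_val Y D _) sandwich_wordE.
  by rewrite /sandwich /= !mulrA.
rewrite schwinger_dyson /= big_map /=.
rewrite (splits_sandwich s z y (fun u v => E (em y.1 * em (eta s (E (word_val Y D
   (inl (PConst T y.2) :: u)))) * word_val Y D v))).
apply: eq_bigr => k _; rewrite -cats1 /word_val !big_cons big_cat /= big_seq1 /=.
rewrite -!/(word_val Y D _) !sandwich_wordE expect_embl expect_embr.
by rewrite -mulrA !expect_embl !mulrA.
Qed.

End SandwichMoments.

Section BoundedMoments.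
Variable R : realType.

Lemma bounded_of_limn_esup (u : nat -> R) : (forall n, 0 <= u n) ->
  (limn_esup (fun n => (u n)%:E) < +oo)%E -> exists C, forall n, u n <= C.
Proof.
move=> u0 /ereal_inf_lt[_ [V [N _ NV] <-] supV].
have uV n : (N <= n)%N -> ((u n)%:E <= ereal_sup [set (u m)%:E | m in V])%E.
  by move=> Nn; apply: ereal_sup_ubound; exists n => //; exact: NV.
have [M hM] : exists M, forall n, (N <= n)%N -> u n <= M.
  move: supV uV; case: (ereal_sup _) => [M _ h|//|_ h].
    by exists M => n /h; rewrite lee_fin.
  by have := h N (leqnn N); rewrite leeNy_eq.
have M0 : 0 <= M := le_trans (u0 N) (hM N (leqnn N)).
exists (\sum_(m < N) u m + M) => n; have [nN|Nn] := ltnP n N.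
  by rewrite (bigD1 (Ordinal nN)) //= -addrA lerDl addr_ge0 // sumr_ge0.
by rewrite ler_wpDl ?hM // sumr_ge0.
Qed.

End BoundedMoments.

(* Matrices have size n.+1 for n : nat, and the products of
   m.+1 factors in Y4, for m : nat, are those of positive length. *)
Theorem theorem1p1 (R : realType) (B : cstarType R) (P : bprob B)
    (S T : Type)
    (a : forall n : nat, S -> 'I_n.+1 -> 'I_n.+1 -> P)
    (eta : S -> {linear B -> B})
    (b : forall n : nat, T -> 'I_n.+1 -> B)
    (Y1 : forall n s i j, a n s i j = star (a n s j i))
    (Y2 : forall n s i j, expect P (a n s i j) = 0)
    (eta_cp : forall s, completely_positive (eta s))
    (Y3 : forall n s i j (x : B),
      expect P (a n s i j * emb P x * a n s j i) = n.+1%:R^-1 *: eta s x)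
    (Y4 : forall m : nat, exists2 M : R, 0 < M &
      forall (n : nat) (x : 'I_m -> B) (s : 'I_m.+1 -> S)
        (i j : 'I_m.+1 -> 'I_n.+1),
        cnorm (expect P (a n (s ord0) (i ord0) (j ord0) *
          \prod_(k < m) (emb P (x k) *
            a n (s (lift ord0 k)) (i (lift ord0 k)) (j (lift ord0 k)))))
        <= M * n.+1%:R `^ (- (m.+1%:R / 2)) * \prod_(k < m) cnorm (x k))
    (Y5 : forall n : nat, cond_indep_rv (expect P)
      (fun k : S * {ij : 'I_n.+1 * 'I_n.+1 | (ij.1 <= ij.2)%N} =>
         a n k.1 (val k.2).1 (val k.2).2))
    (D1 : cvg_weakly (fun n => jdist (mat_expect n (expect P))
      (fun t => mat_incl P (mat_D (b n t)))))
    (D2 : forall (t : T) (k : nat),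
      mxnorm (mat_D (b n t)) ^+ k / n.+1%:R @[n --> \oo] --> (0 : R))
    (D3 : forall (t : T) (k : nat),
      (limn_esup (fun n =>
         (n.+1%:R^-1 * \sum_(i < n.+1) cnorm (b n t i) ^+ k)%:E) < +oo)%E) :
  exists (Q : bprob B) (Y : S -> Q) (D : T -> Q),
    [/\ cvg_weakly_to
          (fun n => jdist (mat_expect n (expect P))
             (sumfam (fun s => mat_Y (a n s))
                     (fun t => mat_incl P (mat_D (b n t)))))
          (jdist (expect Q) (sumfam Y D)),
        free_indep_subsets (expect Q) (free_blocks Y D) &
        forall s : S, semicircular (expect Q) (Y s) (eta s)].
Proof.
have b_dom t : dominated (fun n i => b n t i).
  exists (fun n i => cnorm (b n t i)) => //; split=> [n i|k]; first exact: cnorm_ge0.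
  apply: bounded_of_limn_esup (D3 t k) => n.
  by apply: avg_ge0 => i; rewrite exprn_ge0 ?cnorm_ge0.
(* {classic S} provides the decidable equality of labels used in the counting *)
have [Q [Y [D [cvgQ sY sd]]]] := @limit_law R B P {classic S} a eta
  Y1 Y2 Y3 Y4 Y5 T b b_dom D1.
exists Q, Y, D; split=> //.
- exact: (@free_of_schwinger_dyson R B {classic S} T Q Y D eta sY sd).
- move=> s; apply: semicircular_of_moments; first exact: sY.
  by move=> y z; exact: (sandwich_mom_cons sd).
Qed.
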